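(* Let $\mu$ be a $*$-infinitely divisible probability measure on $\mathbb{R}$. Let $(\mu_n)$ be a sequence of probability measures on $\mathbb{R}$ and $(k_n)$ a sequence of integers tending to $+\infty$ such that the sequence $\mu_n^{*k_n}$ converges weakly to $\mu$. For $d\ge1$ and $n\ge1$, let $\mathbb{K}_d^{\mu_n}$ be the distribution of $U\,\mathrm{diag}(X_{n,1},\ldots,X_{n,d})\,V$, where $U,V$ are independent Haar-distributed $d\times d$ unitary random matrices, independent of the i.i.d. random variables $X_{n,1},\ldots,X_{n,d}$ with distribution $\mu_n$. Then for every $d\ge 1$ the sequence $\big((\mathbb{K}_d^{\mu_n})^{*k_n}\big)_n$ of probability measures on the space of $d\times d$ complex matrices converges weakly, as $n\to\infty$, to a probability distribution $\mathbb{L}_d^\mu$. Moreover, the Fourier transform of $\mathbb{L}_d^\mu$ on the Euclidean space of complex $d\times d$ matrices endowed with the scalar product $(M,N)\mapsto\Re(\mathrm{Tr}\,M^*N)$ is given by: for every complex $d\times d$ matrix $A$, $$\int\exp\big(i\,\Re(\mathrm{Tr}\,A^*M)\big)\,d\mathbb{L}_d^\mu(M)=\exp\Big(\mathbb{E}\big(d\times\psi_\mu(\Re(\langle u,Av\rangle))\big)\Big),$$ where $\psi_\mu$ is the Lévy exponent of $\mu$, $\langle\cdot,\cdot\rangle$ is the canonical Hermitian product of $\mathbb{C}^d$, and $u=(u_1,\ldots,u_d)$, $v=(v_1,\ldots,v_d)$ are independent random vectors, uniformly distributed on the unit sphere of $\mathbb{C}^d$.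
   Context: A probability measure $\mu$ on $\mathbb{R}$ is $*$-infinitely divisible if for every $n\ge1$ there is a probability measure $\mu_n$ on $\mathbb{R}$ with $\mu_n^{*n}=\mu$ ($*$ denotes classical convolution; on the space of complex matrices, $*$ is the convolution for matrix addition). The Lévy exponent $\psi_\mu$ of a $*$-infinitely divisible $\mu$ is the unique continuous function $f:\mathbb{R}\to\mathbb{C}$ such that $f(0)=0$ and $\int e^{itx}\,d\mu(x)=\exp(f(t))$ for all $t\in\mathbb{R}$. *)

(* Defs.v *)
From HB Require Import structures.
From mathcomp Require Import all_boot all_order all_algebra.
From mathcomp Require Import complex.
From mathcomp Require Import all_classical all_reals all_analysis.
From mathcomp Require Import measurable_realfun.

Set Implicit Arguments.
Unset Strict Implicit.
Unset Printing Implicit Defensive.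

Import Order.TTheory GRing.Theory Num.Theory numFieldNormedType.Exports.

Local Open Scope classical_set_scope.
Local Open Scope ring_scope.
Local Open Scope complex_scope.
Local Open Scope sesquilinear_scope.

(** [R[i]] with the topology of the modulus; ['M[R[i]]_(m, n)] then has the
    entrywise topology, i.e. the one of the Euclidean norm [Re (\tr (M^t* *m M))],
    and we give it the Borel sigma-algebra. *)
HB.instance Definition _ (R : rcfType) := PseudoPointedMetric.copy R[i] R[i]^o.

HB.instance Definition _ (m n : nat) (T : ptopologicalType) :=
  Measurable.copy 'M[T]_(m, n) (g_sigma_algebraType (@open 'M[T]_(m, n))).

Local Notation Re := complex.Re.
Local Notation Im := complex.Im.

Section complex_matrix_measurability.
Context (R : realType) (m n : nat).
Local Notation MC := 'M[R[i]]_(m, n).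

Lemma normc_le_ReIm (z : R[i]) : `|z| <= (`|Re z| + `|Im z|)%:C.
Proof.
case: z => a b; rewrite normc_def lecE/= eqxx/=.
rewrite -(ger0_norm (addr_ge0 (normr_ge0 a) (normr_ge0 b))) -sqrtr_sqr.
apply: ler_wsqrtr; rewrite sqrrD !real_normK ?num_real// -addrA lerD2l.
by rewrite lerDr mulrn_wge0// mulr_ge0.
Qed.

Lemma normc_ge_Im (z : R[i]) : `|Im z|%:C <= `|z|.
Proof.
case: z => a b; rewrite normc_def lecE/= eqxx/= -sqrtr_sqr.
by apply: ler_wsqrtr; rewrite lerDr sqr_ge0.
Qed.

Lemma nbhs_mx_box (M : MC) (U : set MC) : nbhs M U ->
  exists2 e : R, 0 < e & forall N : MC,
    (forall i j, `|Re (M i j) - Re (N i j)| < e /\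
                 `|Im (M i j) - Im (N i j)| < e) -> U N.
Proof.
move=> /nbhs_ballP[[e ie] /= e0 eU].
move: e0; rewrite ltcE /= => /andP[/eqP ie0 e0]; subst ie.
exists (e / 2); first by rewrite divr_gt0.
move=> N MN; apply: eU; split=> [|i j]; first by rewrite ltcE/= eqxx.
have [rMN iMN] := MN i j; rewrite /ball/=.
apply: (le_lt_trans (normc_le_ReIm _)).
rewrite ltcE/= eqxx/=; move: rMN iMN.
case: (M i j) (N i j) => [a b] [c d] /= rMN iMN.
by rewrite [e]splitr ltrD.
Qed.

Lemma continuous_mx_coord (i : 'I_m) (j : 'I_n) :
  continuous (fun M : MC => Re (M i j)) /\
  continuous (fun M : MC => Im (M i j)).
Proof.
have box (M : MC) (e : R) : 0 < e ->
    nbhs M [set N : MC | `|M i j - N i j| < e%:C].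
  move=> e0; apply/nbhs_ballP; exists e%:C => /=.
    by rewrite ltcE/= eqxx.
  by move=> N [_ /(_ i j)].
split=> M; apply/(cvgrPdist_lt (FF := nbhs_filter M)) => e e0; 
  apply: (@filterS _ (nbhs M) (nbhs_filter M) _ _ _ (box M e e0)) => N /=.
- move=> /(le_lt_trans (normc_ge_Re _)); rewrite ltcE/= eqxx/=.
  by case: (M i j) (N i j) => [a b] [c d].
- move=> /(le_lt_trans (normc_ge_Im _)); rewrite ltcE/= eqxx/=.
  by case: (M i j) (N i j) => [a b] [c d].
Qed.

Lemma continuous_mx_measurable (f : MC -> R) :
  continuous f -> measurable_fun [set: MC] f.
Proof.
move=> /continuousP cf; apply: (measurability _ (RGenOpens.measurableE R)).
move=> _ [_ [a [b ->] <-]]; rewrite setTI.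
by apply: sub_sigma_algebra; apply: cf; exact: interval_open.
Qed.

Lemma measurable_mx_Re (i : 'I_m) (j : 'I_n) :
  measurable_fun [set: MC] (fun M : MC => Re (M i j)).
Proof. by apply: continuous_mx_measurable; case: (continuous_mx_coord i j). Qed.

Lemma measurable_mx_Im (i : 'I_m) (j : 'I_n) :
  measurable_fun [set: MC] (fun M : MC => Im (M i j)).
Proof. by apply: continuous_mx_measurable; case: (continuous_mx_coord i j). Qed.

Lemma measurable_fun_mxP d (T : measurableType d) (f : T -> MC) :
  (forall i j, measurable_fun [set: T] (fun x => Re (f x i j)) /\
               measurable_fun [set: T] (fun x => Im (f x i j))) ->
  measurable_fun [set: T] f.
Proof.
move=> mf.
pose box (q : 'M[rat]_(m, n) * 'M[rat]_(m, n) * rat) : set MC :=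
  [set N | forall i j, `|ratr (q.1.1 i j) - Re (N i j)| < ratr q.2 /\
                       `|ratr (q.1.2 i j) - Im (N i j)| < ratr q.2].
have mbox q : measurable (f @^-1` box q).
  have -> : f @^-1` box q = \bigcap_(ij in [set: 'I_m * 'I_n])
     ((fun x => Re (f x ij.1 ij.2)) @^-1` ball (ratr (q.1.1 ij.1 ij.2) : R) (ratr q.2)
     `&` (fun x => Im (f x ij.1 ij.2)) @^-1` ball (ratr (q.1.2 ij.1 ij.2) : R) (ratr q.2)).
    apply/seteqP; split=> x /= bx; first by move=> [i j] _; exact: bx.
    by move=> i j; exact: (bx (i, j)).
  apply: fin_bigcap_measurable => // -[i j] _; have [mr mi] := mf i j.
  apply: measurableI; rewrite -[X in measurable X]setTI.
    by apply: mr => //; rewrite ball_itv; exact: measurable_itv.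
  by apply: mi => //; rewrite ball_itv; exact: measurable_itv.
apply: (measurability _ (erefl : @measurable _ MC = <<s @open MC >>)).
move=> _ [U oU <-]; rewrite setTI.
have -> : U = \bigcup_(q in [set: 'M[rat]_(m, n) * 'M[rat]_(m, n) * rat])
                (if pselect (box q `<=` U) then box q else set0).
  apply/seteqP; split=> [M UM|M [q _]]; last by case: pselect => // qU /qU.
  have [e e0 eU] := nbhs_mx_box (open_nbhs_nbhs (conj oU UM)).
  have e20 : 0 < e / 2 by rewrite divr_gt0.
  have /rat_in_itvoo[r] := e20; rewrite in_itv/= => /andP[r0 re].
  have appr (x : R) : exists q : rat, `|ratr q - x| < ratr r.
    have : x - ratr r < x + ratr r by rewrite ltrD2l gtrN.
    move=> /rat_in_itvoo[q]; rewrite in_itv/= => qx.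
    by exists q; rewrite ltr_distl.
  pose A : 'M[rat]_(m, n) := \matrix_(i, j) sval (cid (appr (Re (M i j)))).
  pose B : 'M[rat]_(m, n) := \matrix_(i, j) sval (cid (appr (Im (M i j)))).
  exists (A, B, r) => //; case: pselect => /= [_|nU].
    by move=> i j /=; rewrite !mxE; split; case: cid.
  exfalso; apply: nU => N Nbox; apply: eU => i j; have [] := Nbox i j; rewrite !mxE.
  have tri (x y : R) (c : {q : rat | `|ratr q - x| < ratr r}) :
      `|ratr (sval c) - y| < ratr r -> `|x - y| < e.
    case: c => c /= cx cy; rewrite (splitr e) -(subrK (ratr c) x) -addrA.
    apply: (le_lt_trans (ler_normD _ _)); rewrite ltrD//.
      by rewrite distrC (lt_trans cx).
    by rewrite (lt_trans cy).
  by move=> h1 h2; split; [exact: tri h1|exact: tri h2].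
rewrite preimage_bigcup; apply: countable_bigcupT_measurable => //= q.
by case: pselect => //= _; rewrite preimage_set0.
Qed.

End complex_matrix_measurability.

Definition add_real (R : realType) (p : R * R) : R := p.1 + p.2.

Lemma measurable_add_real (R : realType) :
  measurable_fun [set: R * R] (@add_real R).
Proof. exact: measurable_funD. Qed.

HB.instance Definition _ (R : realType) :=
  isMeasurableFun.Build _ _ _ _ (@add_real R) (@measurable_add_real R).

Definition add_mx (R : realType) (m n : nat)
  (p : 'M[R[i]]_(m, n) * 'M[R[i]]_(m, n)) : 'M[R[i]]_(m, n) := p.1 + p.2.

Lemma measurable_add_mx (R : realType) (m n : nat) :
  measurable_fun [set: 'M[R[i]]_(m, n) * 'M[R[i]]_(m, n)] (@add_mx R m n).
Proof.
apply: measurable_fun_mxP => i j; split.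
- rewrite (_ : (fun _ => _) = (fun p : 'M[R[i]]_(m, n) * 'M[R[i]]_(m, n) =>
      Re (p.1 i j) + Re (p.2 i j))); last first.
    by apply/funext => p; rewrite mxE; case: (p.1 i j) (p.2 i j) => [? ?] [].
  apply: measurable_funD.
    exact: (measurableT_comp (@measurable_mx_Re R m n i j)).
  exact: (measurableT_comp (@measurable_mx_Re R m n i j)).
- rewrite (_ : (fun _ => _) = (fun p : 'M[R[i]]_(m, n) * 'M[R[i]]_(m, n) =>
      Im (p.1 i j) + Im (p.2 i j))); last first.
    by apply/funext => p; rewrite mxE; case: (p.1 i j) (p.2 i j) => [? ?] [].
  apply: measurable_funD.
    exact: (measurableT_comp (@measurable_mx_Im R m n i j)).
  exact: (measurableT_comp (@measurable_mx_Im R m n i j)).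
Qed.

HB.instance Definition _ (R : realType) (m n : nat) :=
  isMeasurableFun.Build _ _ _ _ (@add_mx R m n) (@measurable_add_mx R m n).

Section convolution.
Context d (T : measurableType d) (R : realType) (zero : T)
  (add : {mfun (T * T)%type >-> T}).

Definition convolution (mu nu : probability T R) : probability T R :=
  distribution (mu \x nu)%E add.

Fixpoint convolution_pow (mu : probability T R) (k : nat) : probability T R :=
  if k is k'.+1 then convolution mu (convolution_pow mu k') else dirac zero.

End convolution.

Definition real_conv_pow (R : realType) :
    probability R R -> nat -> probability R R :=
  convolution_pow (0 : R) (@add_real R).

Definition mx_conv_pow (R : realType) (m n : nat) :
    probability 'M[R[i]]_(m, n) R -> nat -> probability 'M[R[i]]_(m, n) R :=
  convolution_pow (0 : 'M[R[i]]_(m, n)) (@add_mx R m n).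

(** Probabilities are compared on measurable sets only: Leibniz equality of
    [probability R R] would also compare the junk values elsewhere. *)
Definition infinitely_divisible (R : realType) (mu : probability R R) : Prop :=
  forall n, (0 < n)%N ->
    exists mu_n : probability R R,
      forall A : set R, measurable A -> real_conv_pow mu_n n A = mu A.

#[short(type="topologicalMeasurableType")]
HB.structure Definition TopologicalMeasurable d :=
  {T of Measurable d T & Topological T}.

HB.instance Definition _ (R : realType) := Topological.on R.
HB.instance Definition _ (R : realType) (m n : nat) :=
  Topological.on 'M[R[i]]_(m, n).

Definition weak_cvg d (T : topologicalMeasurableType d) (R : realType)
    (mu_ : nat -> probability T R) (mu : probability T R) : Prop :=
  forall f : T -> R, continuous f -> (exists C : R, forall x, `|f x| <= C) ->
    \int[mu_ n]_x f x @[n --> \oo] --> \int[mu]_x f x.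

Section iid.
Context d (T : measurableType d) (R : realType).

Definition cons_pair (n : nat) (p : T * n.-tuple T) : n.+1.-tuple T :=
  [tuple of p.1 :: p.2].

Lemma measurable_cons_pair (n : nat) :
  measurable_fun [set: T * n.-tuple T] (@cons_pair n).
Proof. exact: measurable_cons. Qed.

HB.instance Definition _ (n : nat) :=
  isMeasurableFun.Build _ _ _ _ (@cons_pair n) (@measurable_cons_pair n).

(** Joint law of [n] independent random variables with law [mu]. *)
Fixpoint iid_law (mu : probability T R) (n : nat) : probability (n.-tuple T) R :=
  if n is n'.+1 then distribution (mu \x iid_law mu n')%E (@cons_pair n')
  else dirac [tuple].

End iid.

Section random_matrices.
Context (R : realType) (d : nat).
Local Notation Md := 'M[R[i]]_d.
Local Notation Cd := 'cV[R[i]]_d.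

(** The Haar probability measure of the compact group U(d), seen as a measure
    on all matrices that is carried by U(d). *)
Definition haar_unitary (H : probability Md R) : Prop :=
  H [set U | U \is unitarymx] = 1%E /\
  forall W : Md, W \is unitarymx -> forall A : set Md, measurable A ->
    H [set U | A (W *m U)] = H A /\ H [set U | A (U *m W)] = H A.

(** Hermitian product, antilinear in the first argument. *)
Definition hdot (u v : Cd) : R[i] := (u^t* *m v) 0 0.

(** The uniform distribution on the unit sphere of C^d is the unique
    probability on it that is invariant under the unitary group. *)
Definition uniform_sphere (sigma : probability Cd R) : Prop :=
  sigma [set u | hdot u u = 1] = 1%E /\
  forall W : Md, W \is unitarymx -> forall A : set Cd, measurable A ->
    sigma [set u | A (W *m u)] = sigma A.

Definition UdiagV (p : Md * d.-tuple R * Md) : Md :=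
  p.1.1 *m diag_mx (\row_(i < d) (tnth p.1.2 i)%:C) *m p.2.

Lemma measurable_UdiagV : measurable_fun [set: Md * d.-tuple R * Md] UdiagV.
Proof.
have mRe i j (g : Md * d.-tuple R * Md -> Md) : measurable_fun [set: _] g ->
    measurable_fun [set: _] (fun p => Re (g p i j)).
  by move=> mg; exact: (measurableT_comp (@measurable_mx_Re R d d i j)).
have mIm i j (g : Md * d.-tuple R * Md -> Md) : measurable_fun [set: _] g ->
    measurable_fun [set: _] (fun p => Im (g p i j)).
  by move=> mg; exact: (measurableT_comp (@measurable_mx_Im R d d i j)).
have mU : measurable_fun [set: _] (fun p : Md * d.-tuple R * Md => p.1.1).
  exact: (measurableT_comp measurable_fst measurable_fst).
have mV : measurable_fun [set: _] (fun p : Md * d.-tuple R * Md => p.2).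
  exact: measurable_snd.
have mX k : measurable_fun [set: _]
    (fun p : Md * d.-tuple R * Md => tnth p.1.2 k).
  apply: (measurableT_comp (measurable_tnth k)).
  exact: (measurableT_comp measurable_snd measurable_fst).
apply: measurable_fun_mxP => i j.
have E (p : Md * d.-tuple R * Md) : UdiagV p i j =
    \sum_k (tnth p.1.2 k)%:C * (p.1.1 i k * p.2 k j).
  rewrite /UdiagV mxE; apply: eq_bigr => k _.
  by rewrite mul_mx_diag !mxE [_ * _%:C]mulrC mulrA.
have raddRe : {morph @complex.Re R : x y / x + y >-> x + y} by case=> ? ? [].
have raddIm : {morph @complex.Im R : x y / x + y >-> x + y} by case=> ? ? [].
split.
- rewrite (_ : (fun _ => _) = (fun p : Md * d.-tuple R * Md =>
      \sum_k tnth p.1.2 k *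
      (Re (p.1.1 i k) * Re (p.2 k j) - Im (p.1.1 i k) * Im (p.2 k j)))).
    apply: measurable_sum => k; apply: measurable_funM => //.
    by apply: measurable_funB; apply: measurable_funM;
      [exact: mRe mU|exact: mRe mV|exact: mIm mU|exact: mIm mV].
  apply/funext => p; rewrite E (big_morph _ raddRe (erefl : Re 0 = 0)).
  apply: eq_bigr => k _; case: (p.1.1 i k) (p.2 k j) => [a b] [c e] /=.
  by rewrite mul0r subr0.
- rewrite (_ : (fun _ => _) = (fun p : Md * d.-tuple R * Md =>
      \sum_k tnth p.1.2 k *
      (Re (p.1.1 i k) * Im (p.2 k j) + Im (p.1.1 i k) * Re (p.2 k j)))).
    apply: measurable_sum => k; apply: measurable_funM => //.
    by apply: measurable_funD; apply: measurable_funM;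
      [exact: mRe mU|exact: mIm mV|exact: mIm mU|exact: mRe mV].
  apply/funext => p; rewrite E (big_morph _ raddIm (erefl : Im 0 = 0)).
  apply: eq_bigr => k _; case: (p.1.1 i k) (p.2 k j) => [a b] [c e] /=.
  by rewrite mul0r addr0.
Qed.

HB.instance Definition _ :=
  isMeasurableFun.Build _ _ _ _ UdiagV measurable_UdiagV.

(** Law of [U diag(X_1, ..., X_d) V], for [U], [V] of law [H], the [X_i] of law
    [mu], all independent. *)
Definition K_law (H : probability Md R) (mu : probability R R) :
    probability Md R :=
  distribution ((H \x iid_law mu d) \x H)%E UdiagV.

End random_matrices.

Section fourier.
Context (R : realType).

Definition cexp (z : R[i]) : R[i] :=
  (expR (Re z) * cos (Im z)) +i* (expR (Re z) * sin (Im z)).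

Definition Cintegral d (T : measurableType d) (mu : probability T R)
    (f : T -> R[i]) : R[i] :=
  (\int[mu]_x Re (f x)) +i* (\int[mu]_x Im (f x)).

Definition levy_exponent (mu : probability R R) (psi : R -> R[i]) : Prop :=
  [/\ continuous psi, psi 0 = 0 &
      forall t : R, Cintegral mu (fun x => cexp ('i * (t * x)%:C)) = cexp (psi t)].

(** Fourier transform for the scalar product [Re (\tr (M^t* *m N))]. *)
Definition fourier_mx (d : nat) (L : probability 'M[R[i]]_d R)
    (A : 'M[R[i]]_d) : R[i] :=
  Cintegral L (fun M => cexp ('i * (Re (\tr (A^t* *m M)))%:C)).

End fourier.

(* Main.v *)
Require Import Defs.
From mathcomp Require Import all_boot all_order all_algebra.
From mathcomp Require Import complex.
From mathcomp Require Import all_classical all_reals all_analysis.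
From mathcomp Require Import measurable_realfun ring lra.

Set Implicit Arguments.
Unset Strict Implicit.
Unset Printing Implicit Defensive.

Import Order.TTheory GRing.Theory Num.Theory numFieldNormedType.Exports.

Local Open Scope classical_set_scope.
Local Open Scope ring_scope.
Local Open Scope complex_scope.
Local Open Scope sesquilinear_scope.

Local Notation Re := complex.Re.
Local Notation Im := complex.Im.
Local Notation normc := Normc.normc.

(** Let [phi] be the characteristic function of [mu], [psi] its Lévy exponent.
    If the [k_n]-th powers of [mu_n] converge to [mu], then
    [k_n (phi_n - 1) -> psi] pointwise and boundedly on compact sets.  Since the
    law [K] of [U diag(X) V] has Fourier transform
    [F_n A = E_(U,V) (\prod_j phi_n a_j)] with [a_j = Re (V A^* U)_jj], dominated
    convergence gives [k_n (F_n A - 1) -> E (\sum_j psi a_j)], whence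
    [F_n A ^+ k_n] tends to [exp (E (\sum_j psi a_j))].  Each [a_j] is distributed
    as [Re <u, A v>] with [u], [v] uniform on the sphere, which is the announced
    formula.  The limit is continuous at [0], so the laws are tight, and Lévy's
    continuity theorem gives the limit law.

    Prokhorov's theorem is obtained along an ultrafilter [U] on the indices: the
    space is cut by countably many rational thresholds on the coordinates, the
    [U]-limits of the masses of the resulting nested cells are realised as
    lengths of nested subintervals of [0, 1), and the limit law is the law of the
    point to which these cells shrink.  The passage from Fourier transforms to
    weak convergence uses Bernstein polynomials in the variables
    [(1 + sin (a x_c)) / 2], which are trigonometric and bounded on the whole
    space. *)

(** * Expectations of bounded functions *)

(** The obstacle is the choice of a root: knowing that [chf (mu_ n) t ^+ k n] is close to [chf mu t]
    determines [chf (mu_ n) t] only up to [k n]-th roots of unity. No complex logarithm is taken.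
    Instead, two continuous functions [f], [g] of modulus at most 1 that agree at one point, and
    whose [k]-th powers are close and away from 0, are compared through [k |f - g|], which starts at
    0 and cannot jump over a forbidden gap ([root_gap]). The same argument, applied to the
    convolution roots of [mu], gives the equicontinuity from which an exponent [psi] is extracted.
    The law [L] has to be fixed before the array [mu_], [k] is given. It is therefore built from the
    array of convolution roots that infinite divisibility provides; every other admissible array has
    the same limiting Fourier transforms. The exponent in the final formula is arbitrary, and is
    reconciled with the constructed one because both describe the limit of one and the same
    sequence. *)

Definition bounded_measurable d (T : measurableType d) (R : realType)
    (f : T -> R) :=
  measurable_fun [set: T] f /\ exists C, forall x, `|f x| <= C.

Section bounded_measurable.
Context d (T : measurableType d) (R : realType).
Implicit Types (f g : T -> R) (P : probability T R).

Lemma bm_cst (c : R) : bounded_measurable (fun _ : T => c).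
Proof. by split; [exact: measurable_cst|exists `|c|]. Qed.

Lemma bmD f g : bounded_measurable f -> bounded_measurable g ->
  bounded_measurable (fun x => f x + g x).
Proof.
move=> [mf [C fC]] [mg [D gD]]; split; first exact: measurable_funD.
by exists (C + D) => x; rewrite (le_trans (ler_normD _ _))// lerD.
Qed.

Lemma bmM f g : bounded_measurable f -> bounded_measurable g ->
  bounded_measurable (fun x => f x * g x).
Proof.
move=> [mf [C fC]] [mg [D gD]]; split; first exact: measurable_funM.
by exists (C * D) => x; rewrite normrM ler_pM.
Qed.

Lemma bmZ (c : R) f : bounded_measurable f ->
  bounded_measurable (fun x => c * f x).
Proof. by apply: bmM; exact: bm_cst. Qed.

Lemma bmN f : bounded_measurable f -> bounded_measurable (fun x => - f x).
Proof.
move=> [mf [C fC]]; split; first exact: measurable_funN.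
by exists C => x; rewrite normrN.
Qed.

Lemma bmB f g : bounded_measurable f -> bounded_measurable g ->
  bounded_measurable (fun x => f x - g x).
Proof. by move=> bf bg; apply: bmD bf (bmN bg). Qed.

Lemma bm_norm f : bounded_measurable f -> bounded_measurable (fun x => `|f x|).
Proof.
move=> [mf [C fC]]; split; first exact: measurableT_comp.
by exists C => x; rewrite normr_id.
Qed.

Lemma bm_sum (I : Type) (s : seq I) (f_ : I -> T -> R) :
  (forall i, bounded_measurable (f_ i)) ->
  bounded_measurable (fun x => \sum_(i <- s) f_ i x).
Proof.
move=> bf; elim: s => [|i s IH].
  by under eq_fun do rewrite big_nil; exact: bm_cst.
by under eq_fun do rewrite big_cons; exact: bmD.
Qed.

Lemma bm_indic (A : set T) : measurable A ->
  bounded_measurable (\1_A : T -> R).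
Proof.
move=> mA; split; first exact: measurable_indic.
by exists 1 => x; rewrite indicE; case: (_ \in _); rewrite ?normr1 ?normr0.
Qed.

Lemma bm_integrable P f : bounded_measurable f ->
  P.-integrable [set: T] (EFin \o f).
Proof.
move=> [mf [C fC]].
apply: (@le_integrable _ _ _ P _ measurableT _ (cst C%:E)).
- exact/measurable_EFinP.
- by move=> x _ /=; rewrite lee_fin (le_trans (fC x))// ler_norm.
- by apply: finite_measure_integrable_cst.
Qed.

Lemma E_cst P (c : R) : \int[P]_x c = c.
Proof. by rewrite Rintegral_cst// [X in fine X]probability_setT mulr1. Qed.

Lemma E_D P f g : bounded_measurable f -> bounded_measurable g ->
  \int[P]_x (f x + g x) = \int[P]_x f x + \int[P]_x g x.
Proof. by move=> bf bg; apply: RintegralD => //; exact: bm_integrable. Qed.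

Lemma E_B P f g : bounded_measurable f -> bounded_measurable g ->
  \int[P]_x (f x - g x) = \int[P]_x f x - \int[P]_x g x.
Proof. by move=> bf bg; apply: RintegralB => //; exact: bm_integrable. Qed.

Lemma E_Z P (c : R) f : bounded_measurable f ->
  \int[P]_x (c * f x) = c * \int[P]_x f x.
Proof. by move=> bf; apply: RintegralZl => //; exact: bm_integrable. Qed.

Lemma E_N P f : bounded_measurable f ->
  \int[P]_x (- f x) = - \int[P]_x f x.
Proof.
move=> bf; rewrite -mulN1r -E_Z//.
by apply: eq_Rintegral => x _; rewrite mulN1r.
Qed.

Lemma E_sum P (I : Type) (s : seq I) (f_ : I -> T -> R) :
  (forall i, bounded_measurable (f_ i)) ->
  \int[P]_x (\sum_(i <- s) f_ i x) = \sum_(i <- s) \int[P]_x f_ i x.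
Proof.
move=> bf; elim: s => [|i s IH].
  rewrite big_nil -[RHS](E_cst P).
  by apply: eq_Rintegral => x _; rewrite big_nil.
rewrite big_cons -IH -E_D//; last exact: bm_sum.
by apply: eq_Rintegral => x _; rewrite big_cons.
Qed.

Lemma E_le P f g : bounded_measurable f -> bounded_measurable g ->
  (forall x, f x <= g x) -> \int[P]_x f x <= \int[P]_x g x.
Proof. by move=> bf bg fg; apply: le_Rintegral => //; exact: bm_integrable. Qed.

Lemma E_norm P f : bounded_measurable f ->
  `|\int[P]_x f x| <= \int[P]_x `|f x|.
Proof. by move=> bf; apply: le_normr_Rintegral => //; exact: bm_integrable. Qed.

Lemma E_bound P f (C : R) : bounded_measurable f ->
  (forall x, `|f x| <= C) -> `|\int[P]_x f x| <= C.
Proof.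
move=> bf fC; apply: (le_trans (E_norm _ bf)).
by rewrite -[leRHS](E_cst P); apply: E_le => //; [exact: bm_norm|exact: bm_cst].
Qed.

Lemma E_indic P (A : set T) : measurable A ->
  \int[P]_x \1_A x = fine (P A).
Proof. by move=> mA; rewrite /Rintegral integral_indic// setIT. Qed.

Lemma full_ae P (D : set T) (Q : T -> Prop) : measurable D -> P D = 1%E ->
  (forall x, D x -> Q x) -> {ae P, forall x, Q x}.
Proof.
move=> mD PD DQ; exists (~` D); split; first exact: measurableC.
  by rewrite probability_setC// PD subee.
by move=> x /= nQ Dx; apply: nQ; exact: DQ.
Qed.

(** The set [D] of mass 1 stands for the unitary group or a sphere inside a space of matrices, or
    for an interval: the places where the laws live and the only ones where the integrands are under
    control. *)
Lemma E_eq_full P (D : set T) f g : measurable D -> P D = 1%E ->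
  measurable_fun [set: T] f -> measurable_fun [set: T] g ->
  (forall x, D x -> f x = g x) -> \int[P]_x f x = \int[P]_x g x.
Proof.
move=> mD PD mf mg fg; congr fine; apply: ae_eq_integral => //.
- exact/measurable_EFinP.
- exact/measurable_EFinP.
- by apply: (full_ae mD PD) => x Dx _; rewrite fg.
Qed.

Lemma E_dct P (D : set T) (f_ : nat -> T -> R) f (C : R) :
  measurable D -> P D = 1%E ->
  (forall n, measurable_fun [set: T] (f_ n)) -> measurable_fun [set: T] f ->
  (forall n x, D x -> `|f_ n x| <= C) ->
  (forall x, D x -> f_ n x @[n --> \oo] --> f x) ->
  \int[P]_x f_ n x @[n --> \oo] --> \int[P]_x f x.
Proof.
move=> mD PD mf_ mf fC fcv.
have [] := @dominated_convergence _ _ _ P [set: T] measurableT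
  (fun n x => (f_ n x)%:E) (fun x => (f x)%:E) (fun=> C%:E).
- by move=> n; exact/measurable_EFinP.
- exact/measurable_EFinP.
- apply: (full_ae mD PD) => x Dx _; apply: cvg_EFin; last exact: fcv.
  by apply: nearW.
- exact: finite_measure_integrable_cst.
- by apply: (full_ae mD PD) => x Dx n _; rewrite lee_fin fC.
move=> intf _ cvi.
apply: fine_cvg; rewrite fineK//.
by apply: integrable_fin_num.
Qed.

End bounded_measurable.

Lemma bm_comp d1 d2 (T1 : measurableType d1) (T2 : measurableType d2)
    (R : realType) (h : T1 -> T2) (f : T2 -> R) :
  measurable_fun [set: T1] h -> bounded_measurable f ->
  bounded_measurable (fun x => f (h x)).
Proof.
by move=> mh [mf [C fC]]; split; [exact: measurableT_comp mh|exists C].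
Qed.

Section distribution.
Context d1 d2 (T1 : measurableType d1) (T2 : measurableType d2) (R : realType).

Lemma E_distribution (P : probability T1 R) (X : {mfun T1 >-> T2})
    (f : T2 -> R) : bounded_measurable f ->
  \int[distribution P X]_y f y = \int[P]_x f (X x).
Proof.
move=> bf; rewrite /Rintegral integral_distribution//.
  by apply/measurable_EFinP; case: bf.
by apply: bm_integrable; exact: bm_comp.
Qed.

Variables (P : probability T1 R) (Q : probability T2 R) (f : T1 * T2 -> R).
Hypothesis bf : bounded_measurable f.

Lemma bm_slice1 x : bounded_measurable (fun y => f (x, y)).
Proof. exact: bm_comp (pair1_measurable x) bf. Qed.

Lemma bm_slice2 y : bounded_measurable (fun x => f (x, y)).
Proof. exact: bm_comp (pair2_measurable y) bf. Qed.

Lemma bm_param1 : bounded_measurable (fun x => \int[Q]_y f (x, y)).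
Proof.
split; last first.
  by have [_ [C fC]] := bf; exists C => x; apply: E_bound => //; exact: bm_slice1.
apply: measurableT_comp => //.
exact: (measurable_fubini_F (bm_integrable (P \x Q)%E bf)).
Qed.

Lemma bm_param2 : bounded_measurable (fun y => \int[P]_x f (x, y)).
Proof.
split; last first.
  by have [_ [C fC]] := bf; exists C => x; apply: E_bound => //; exact: bm_slice2.
apply: measurableT_comp => //.
exact: (measurable_fubini_G (bm_integrable (P \x Q)%E bf)).
Qed.

Lemma E_fubini1 :
  \int[(P \x Q)%E]_z f z = \int[P]_x \int[Q]_y f (x, y).
Proof.
have := integral12_prod_meas1 (bm_integrable (P \x Q)%E bf).
rewrite /Rintegral /fubini_F => <-; congr fine.
apply: eq_integral => x _; rewrite fineK//.
by apply: integrable_fin_num => //; apply: (bm_integrable Q); exact: bm_slice1.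
Qed.

Lemma E_fubini2 :
  \int[(P \x Q)%E]_z f z = \int[Q]_y \int[P]_x f (x, y).
Proof.
have := integral21_prod_meas1 (bm_integrable (P \x Q)%E bf).
rewrite /Rintegral /fubini_G => <-; congr fine.
apply: eq_integral => y _; rewrite fineK//.
by apply: integrable_fin_num => //; apply: (bm_integrable P); exact: bm_slice2.
Qed.

End distribution.

(** * Limits along an ultrafilter *)

Section ultralimit.
Context (R : realType) (U : set_system nat) (UU : UltraFilter U).

(** The image of an ultrafilter is an ultrafilter, and this one contains a compact segment. A single
    [U] serves all bounded sequences at once, which replaces diagonal extraction of subsequences. *)
Lemma ultralimit_exists (u : nat -> R) (C : R) :
  (\forall n \near U, `|u n| <= C) -> exists l : R, u n @[n --> U] --> l.
Proof.
move=> uC.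
have UF : UltraFilter (u @ U).
  split; first exact: fmap_proper_filter.
  move=> G GF sG; rewrite eqEsubset; split => // A GA.
  have [//|nA] := in_ultra_setVsetC (u @^-1` A) UU.
  have : G (~` A) by apply: sG.
  by move=> /(filterI GA); rewrite setICr => /filter_not_empty.
have := @segment_compact R (- C) C.
rewrite compact_ultra => /(_ _ UF) [].
  by apply: filterS uC => n /=; rewrite ler_norml in_itv.
by move=> l [_ ul]; exists l.
Qed.

End ultralimit.

(** * Complex limits, exponential and powers *)

Section modulus.
Context (R : realType).
Implicit Types z w : R[i].

Lemma cReD z w : Re (z + w) = Re z + Re w. Proof. by case: z w => [? ?] []. Qed.
Lemma cImD z w : Im (z + w) = Im z + Im w. Proof. by case: z w => [? ?] []. Qed.
Lemma cReN z : Re (- z) = - Re z. Proof. by case: z. Qed.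
Lemma cImN z : Im (- z) = - Im z. Proof. by case: z. Qed.
Lemma cReM z w : Re (z * w) = Re z * Re w - Im z * Im w.
Proof. by case: z w => [? ?] []. Qed.
Lemma cImM z w : Im (z * w) = Re z * Im w + Im z * Re w.
Proof. by case: z w => [? ?] []. Qed.

Lemma eq_ReIm z w : Re z = Re w -> Im z = Im w -> z = w.
Proof. by case: z w => [? ?] [? ?] /= -> ->. Qed.

Lemma normcE2 z : normc z = Num.sqrt (Re z ^+ 2 + Im z ^+ 2).
Proof. by case: z. Qed.

Lemma sqr_normc_ReIm z : normc z ^+ 2 = Re z ^+ 2 + Im z ^+ 2.
Proof. by rewrite normcE2 sqr_sqrtr// addr_ge0// sqr_ge0. Qed.

Lemma normc_ge0 z : 0 <= normc z.
Proof. by rewrite normcE2 sqrtr_ge0. Qed.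

Lemma normc_Re z : `|Re z| <= normc z.
Proof. by rewrite normcE2 -sqrtr_sqr ler_wsqrtr// lerDl sqr_ge0. Qed.

Lemma normc_Im z : `|Im z| <= normc z.
Proof. by rewrite normcE2 -sqrtr_sqr ler_wsqrtr// lerDr sqr_ge0. Qed.

Lemma normc_le z : normc z <= `|Re z| + `|Im z|.
Proof.
have ReIm0 : 0 <= `|Re z| + `|Im z| by rewrite addr_ge0.
rewrite -(ger0_norm ReIm0) -sqrtr_sqr normcE2 ler_wsqrtr//.
by rewrite sqrrD !real_normK ?num_real// addrAC lerDl mulrn_wge0// mulr_ge0.
Qed.

Lemma normc_real (x : R) : normc x%:C = `|x|.
Proof. by rewrite normcE2/= expr0n/= addr0 sqrtr_sqr. Qed.

Lemma normcX z n : normc (z ^+ n) = normc z ^+ n.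
Proof.
elim: n => [|n IH]; first by rewrite !expr0 Normc.normc1.
by rewrite !exprS Normc.normcM IH.
Qed.

Lemma le_normcB z w : normc (z - w) <= normc z + normc w.
Proof. by rewrite -(normcN w) le_normcD. Qed.

Lemma le_normc_dist z w : normc z - normc w <= normc (z - w).
Proof. by rewrite lerBlDr -{1}(subrK w z) le_normcD. Qed.

Lemma normc_distC z w : normc (z - w) = normc (w - z).
Proof. by rewrite -normcN opprB. Qed.

Lemma normc_sum (I : Type) (s : seq I) (F : I -> R[i]) :
  normc (\sum_(i <- s) F i) <= \sum_(i <- s) normc (F i).
Proof.
elim: s => [|i s IH]; first by rewrite !big_nil Normc.normc0.
by rewrite !big_cons (le_trans (le_normcD _ _))// lerD2l.
Qed.

Lemma natC (n : nat) : (n%:R : R[i]) = (n%:R)%:C.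
Proof. by rewrite (rmorph_nat (real_complex R)). Qed.

Lemma normc_nat n : normc (n%:R : R[i]) = n%:R.
Proof. by rewrite natC normc_real normr_nat. Qed.

Lemma Re_natM n z : Re (n%:R * z) = n%:R * Re z.
Proof. by rewrite natC cReM/= mul0r subr0. Qed.

Lemma normc_subX z w k : normc z <= 1 -> normc w <= 1 ->
  normc (z ^+ k - w ^+ k) <= k%:R * normc (z - w).
Proof.
move=> z1 w1; elim: k => [|k IH]; first by rewrite subrr Normc.normc0 mul0r.
have -> : z ^+ k.+1 - w ^+ k.+1 = z * (z ^+ k - w ^+ k) + (z - w) * w ^+ k.
  by rewrite !exprS; ring.
rewrite (le_trans (le_normcD _ _))// !Normc.normcM normcX -natr1 mulrDl mul1r.
apply: lerD.
  by rewrite (le_trans _ IH)// ler_piMl// normc_ge0.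
by rewrite ler_piMr ?normc_ge0// exprn_ile1// normc_ge0.
Qed.

(* The two factors of [z^k - w^k] are [z - w] and a sum of [k] terms, each of
   which is within [k |z - w|] of [w^(k-1)]. *)
Lemma normc_subX_ge z w k (c : R) : (0 < k)%N -> normc z <= 1 -> normc w <= 1 ->
  c <= normc w ^+ k ->
  (k%:R * normc (z - w)) * (c - k%:R * normc (z - w)) <= normc (z ^+ k - w ^+ k).
Proof.
move=> k0 z1 w1 cw; set y := k%:R * _.
have y0 : 0 <= y by rewrite mulr_ge0// normc_ge0.
rewrite subrXX Normc.normcM; set S := \sum_(i < k) _.
suff h : k%:R * (c - y) <= normc S.
  have -> : y * (c - y) = normc (z - w) * (k%:R * (c - y)) by rewrite /y; ring.
  by rewrite ler_wpM2l// normc_ge0.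
have -> : S = w ^+ k.-1 *+ k + \sum_(i < k) (z ^+ (k.-1 - i) - w ^+ (k.-1 - i)) * w ^+ i.
  rewrite -[k in _ *+ k]card_ord -sumr_const -big_split/=.
  apply: eq_bigr => i _; rewrite mulrBl -exprD subnK ?subrKC//.
  by case: i => i /=; case: (k) k0.
rewrite -[X in normc (_ + X)]opprK (le_trans _ (le_normc_dist _ _))// normcN.
rewrite mulrBr lerB//.
  have -> : w ^+ k.-1 *+ k = k%:R * w ^+ k.-1 by rewrite mulr_natl.
  rewrite Normc.normcM normc_nat ler_wpM2l// (le_trans cw)// normcX.
  rewrite -[in X in _ ^+ X <= _](prednK k0) exprS ler_piMl//.
  by rewrite exprn_ge0// normc_ge0.
rewrite (le_trans (normc_sum _ _))//.
rewrite -[k in k%:R]card_ord mulr_natl -sumr_const ler_sum// => i _.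
rewrite Normc.normcM normcX (le_trans (ler_piMr _ _)) ?normc_ge0//.
  by rewrite exprn_ile1// normc_ge0.
rewrite (le_trans (normc_subX _ _ _))// /y ler_wpM2r ?normc_ge0// ler_nat.
by rewrite (leq_trans (leq_subr _ _))// leq_pred.
Qed.

End modulus.

Section complex_limits.
Context (R : realType) (I : Type) (F : set_system I) (FF : Filter F).
Implicit Types (u v : I -> R[i]) (z w : R[i]).

(** Componentwise, so that limits under real integrals apply directly; [ccvgP] recovers the
    modulus. *)
Definition ccvg u z :=
  (Re (u n) @[n --> F] --> Re z) /\ (Im (u n) @[n --> F] --> Im z).

Lemma ccvg_cst z : ccvg (fun=> z) z.
Proof. by split; exact: cvg_cst. Qed.

Lemma ccvgD u v z w : ccvg u z -> ccvg v w -> ccvg (fun n => u n + v n) (z + w).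
Proof.
move=> [uR uI] [vR vI]; rewrite /ccvg cReD cImD.
by split; [under eq_fun do rewrite cReD|under eq_fun do rewrite cImD]; exact: cvgD.
Qed.

Lemma ccvgN u z : ccvg u z -> ccvg (fun n => - u n) (- z).
Proof.
move=> [uR uI]; rewrite /ccvg cReN cImN.
by split; [under eq_fun do rewrite cReN|under eq_fun do rewrite cImN]; exact: cvgN.
Qed.

Lemma ccvgB u v z w : ccvg u z -> ccvg v w -> ccvg (fun n => u n - v n) (z - w).
Proof. by move=> uz vw; apply: ccvgD uz (ccvgN vw). Qed.

Lemma ccvgM u v z w : ccvg u z -> ccvg v w -> ccvg (fun n => u n * v n) (z * w).
Proof.
move=> [uR uI] [vR vI]; rewrite /ccvg cReM cImM.
split; [under eq_fun do rewrite cReM|under eq_fun do rewrite cImM].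
  by apply: cvgB; exact: cvgM.
by apply: cvgD; exact: cvgM.
Qed.

Lemma ccvg_sum (J : Type) (s : seq J) (u_ : J -> I -> R[i]) (z_ : J -> R[i]) :
  (forall j, ccvg (u_ j) (z_ j)) ->
  ccvg (fun n => \sum_(j <- s) u_ j n) (\sum_(j <- s) z_ j).
Proof.
move=> uz; elim: s => [|j s IH].
  by rewrite big_nil; under eq_fun do rewrite big_nil; exact: ccvg_cst.
by rewrite big_cons; under eq_fun do rewrite big_cons; exact: ccvgD.
Qed.

Lemma ccvg_normc u z : ccvg u z -> normc (u n) @[n --> F] --> normc z.
Proof.
move=> [uR uI]; rewrite normcE2; under eq_fun do rewrite normcE2.
apply: continuous_cvg; first exact: sqrt_continuous.
by apply: cvgD; [exact: (cvgM uR uR)|exact: (cvgM uI uI)].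
Qed.

Lemma ccvgP u z : ccvg u z <->
  forall e : R, 0 < e -> \forall n \near F, normc (u n - z) <= e.
Proof.
split=> [[uR uI] e e0|h].
  have e20 : 0 < e / 2 by rewrite divr_gt0.
  have hR := (@cvgrPdist_le _ _ _ F FF (fun n => Re (u n)) (Re z)).1 uR _ e20.
  have hI := (@cvgrPdist_le _ _ _ F FF (fun n => Im (u n)) (Im z)).1 uI _ e20.
  apply: (@filterS2 _ F FF _ _ _ _ hR hI) => n hR0 hI0.
  rewrite normc_distC (le_trans (normc_le _))// cReD cImD cReN cImN.
  by rewrite [e]splitr lerD.
split; apply/cvgrPdist_le => e /h; apply: (@filterS _ F FF) => n;
  apply: le_trans; rewrite distrC.
  by rewrite -cReN -cReD normc_Re.
by rewrite -cImN -cImD normc_Im.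
Qed.

Lemma ccvg_le u z (f : I -> R) :
  (\forall n \near F, normc (u n - z) <= f n) -> f n @[n --> F] --> 0 ->
  ccvg u z.
Proof.
move=> uf f0; apply/ccvgP => e e0.
have := (@cvgrPdist_le _ _ _ F FF f 0).1 f0 _ e0.
move=> h; apply: (@filterS2 _ F FF _ _ _ _ uf h) => n uf0; rewrite sub0r normrN => fe.
by rewrite (le_trans uf0)// (le_trans _ fe)// ler_norm.
Qed.

Lemma ccvg_eq u v z : (forall n, u n = v n) -> ccvg u z -> ccvg v z.
Proof. by move=> /funext ->. Qed.

End complex_limits.

Lemma ccvg_unique (R : realType) (I : Type) (F : set_system I)
    (FF : ProperFilter F) (u : I -> R[i]) (z w : R[i]) :
  ccvg F u z -> ccvg F u w -> z = w.
Proof.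
by move=> [zR zI] [wR wI]; apply: eq_ReIm;
  [exact: cvg_unique zR wR|exact: cvg_unique zI wI].
Qed.

Section complex_exponential.
Context (R : realType).
Implicit Types (z w : R[i]) (x y : R).

Lemma cexpD z w : cexp (z + w) = cexp z * cexp w.
Proof.
apply: eq_ReIm; rewrite ?cReM ?cImM /cexp/= cReD cImD expRD ?cosD ?sinD; ring.
Qed.

Lemma cexp0 : cexp 0 = 1 :> R[i].
Proof. by rewrite /cexp/= expR0 cos0 sin0 mulr1 mulr0. Qed.

Lemma cexpMn z n : cexp (n%:R * z) = cexp z ^+ n.
Proof.
elim: n => [|n IH]; first by rewrite mul0r cexp0 expr0.
by rewrite exprS -IH -cexpD -natr1 mulrDl mul1r addrC.
Qed.

Lemma normc_cexp z : normc (cexp z) = expR (Re z).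
Proof.
by rewrite normcE2/= !exprMn -mulrDr cos2Dsin2 mulr1 sqrtr_sqr ger0_norm// expR_ge0.
Qed.

Lemma ccvg_cexp (I : Type) (F : set_system I) (FF : Filter F) (u : I -> R[i]) z :
  ccvg F u z -> ccvg F (fun n => cexp (u n)) (cexp z).
Proof.
move=> [uR uI]; split => /=; apply: cvgM.
- by apply: continuous_cvg uR; exact: continuous_expR.
- by apply: continuous_cvg uI; exact: continuous_cos.
- by apply: continuous_cvg uR; exact: continuous_expR.
- by apply: continuous_cvg uI; exact: continuous_sin.
Qed.

Lemma sin_lipschitz x y : `|sin x - sin y| <= `|x - y|.
Proof.
wlog yx : x y / y <= x.
  by move=> h; have [/h//|/ltW/h] := leP y x; rewrite distrC (distrC y).
have [] := @MVT_segment R sin cos y x yx.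
  by apply: continuous_subspaceT => t; exact: continuous_sin.
by move=> c _ ->; rewrite normrM ler_piMl// cos_max.
Qed.

Lemma cos_lipschitz x y : `|cos x - cos y| <= `|x - y|.
Proof. by rewrite -2!sinDpihalf (le_trans (sin_lipschitz _ _))// opprD addrACA subrr addr0. Qed.

Lemma onemcos_ge0 x : 0 <= 1 - cos x.
Proof. by rewrite subr_ge0 cos_le1. Qed.

Lemma onemcosE x : 1 - cos x = 2 * sin (x / 2) ^+ 2.
Proof.
rewrite {1}(_ : x = (x / 2) *+ 2); last by rewrite mulr2n -splitr.
by rewrite cos_mulr2n cos2sin2 mulr2n; ring.
Qed.

Lemma onemcos_le x : 1 - cos x <= x ^+ 2 / 2.
Proof.
rewrite onemcosE; have := sin_lipschitz (x / 2) 0; rewrite sin0 !subr0.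
rewrite -(@ler_pXn2r _ 2)// ?nnegrE// !real_normK ?num_real// => h.
by rewrite (le_trans (ler_wpM2l _ h))//; lra.
Qed.

Lemma norm_onemcos x : `|cos x - 1| <= x ^+ 2 / 2.
Proof. by rewrite distrC ger0_norm ?onemcos_le// onemcos_ge0. Qed.

Lemma norm_sinB x : `|x| <= 1 -> `|sin x - x| <= x ^+ 2.
Proof.
wlog x0 : x / 0 <= x => [h|].
  have [/h//|/ltW x0 x1] := leP 0 x.
  have := h (- x); rewrite oppr_ge0 normrN => /(_ x0 x1).
  by rewrite sinN -opprD normrN sqrrN.
rewrite ger0_norm// => x1.
have [] := @MVT_segment R (fun t => sin t - t) (fun t => cos t - 1) 0 x x0.
  apply: continuous_subspaceT => t; apply: cvgB; last exact: cvg_id.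
  exact: continuous_sin.
move=> c; rewrite in_itv/= => /andP[c0 cx]; rewrite sin0 !subr0 => ->.
rewrite normrM (ger0_norm x0) expr2 ler_wpM2r//.
rewrite (le_trans (norm_onemcos _))// (le_trans _ cx)//.
rewrite ler_pdivrMr// expr2 ler_wpM2l// (le_trans cx)// (le_trans x1)//.
by rewrite ler1n.
Qed.

(** Everything comes from [1 + x <= expR x]: at [x] it gives the sign, at [- x] it gives
    [expR x * (1 - x) <= 1]. *)
Lemma expR_quad x : `|x| <= 1 / 2 -> `|expR x - 1 - x| <= 2 * x ^+ 2.
Proof.
rewrite ler_norml => /andP[x1 x2].
have h1 := expR_ge1Dx x; have h2 := expR_ge1Dx (- x).
have e0 := expR_gt0 x.
have e1 : expR x * expR (- x) = 1 by rewrite -expRD subrr expR0.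
rewrite ger0_norm; last by lra.
have : expR x * (1 - x) <= 1 by rewrite -[leRHS]e1 ler_wpM2l// ltW.
nra.
Qed.

Lemma cexp_quad z : normc z <= 1 / 2 -> normc (cexp z - 1 - z) <= 10 * normc z ^+ 2.
Proof.
move=> z2; have an := normc_Re z; have bn := normc_Im z.
rewrite (le_trans (normc_le _))// !(cReD, cImD, cReN, cImN) [Re (cexp z)]/= [Im (cexp z)]/=.
have n0 := normc_ge0 z; move: z2 an bn n0.
move: (normc z) (Re z) (Im z) => n a b z2 an bn n0.
rewrite [Re 1]/= [Im 1]/= subr0.
have a2 : `|a| <= 1 / 2 by exact: le_trans an z2.
have b1 : `|b| <= 1 by rewrite (le_trans bn)// (le_trans z2)// ler_pdivrMr// mul1r ler1n.
have ea := expR_quad a2; have cb := norm_onemcos b; have sb := norm_sinB b1.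
have sq (x : R) : `|x| <= n -> x ^+ 2 <= n ^+ 2.
  by move=> xn; rewrite -real_normK ?num_real// ler_pXn2r// nnegrE.
have a2n := sq _ an; have b2n := sq _ bn.
have e2 : expR a <= 2.
  move: ea a2; rewrite !ler_norml => /andP[_ ea] /andP[a21 a22].
  nra.
have e0 := expR_ge0 a.
(* The constant 10 is 3 for the real part plus 7 for the imaginary part, with some slack in the
   latter. *)
have h1 : `|expR a * cos b - 1 - a| <= 3 * n ^+ 2.
  have -> : expR a * cos b - 1 - a = (expR a - 1 - a) + expR a * (cos b - 1) by ring.
  rewrite (le_trans (ler_normD _ _))// normrM (ger0_norm e0).
  have : expR a * `|cos b - 1| <= 2 * (b ^+ 2 / 2) by rewrite ler_pM.
  lra.
have h2 : `|expR a * sin b - b| <= 7 * n ^+ 2.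
  have -> : expR a * sin b - b =
      expR a * (sin b - b) + ((expR a - 1 - a) * b + a * b) by ring.
  rewrite (le_trans (ler_normD _ _))// normrM (ger0_norm e0).
  have : `|(expR a - 1 - a) * b + a * b| <= 3 * n ^+ 2.
    rewrite (le_trans (ler_normD _ _))// !normrM.
    have : `|expR a - 1 - a| * `|b| <= 2 * a ^+ 2 * 1 by rewrite ler_pM.
    have : `|a| * `|b| <= n * n by rewrite ler_pM.
    by rewrite -expr2; lra.
  have : expR a * `|sin b - b| <= 2 * (b ^+ 2) by rewrite ler_pM.
  by have := sqr_ge0 n; lra.
lra.
Qed.

Lemma cexp_root z k : (0 < k)%N -> cexp (z / k%:R) ^+ k = cexp z.
Proof.
by move=> k0; rewrite -cexpMn mulrC divfK// pnatr_eq0 -lt0n.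
Qed.

Lemma normc_divn z k : normc (z / k%:R) = normc z / k%:R.
Proof. by rewrite Normc.normcM Normc.normcV normc_nat. Qed.

Lemma Re_divn z k : Re (z / k%:R) = Re z / k%:R.
Proof.
by rewrite natC -(fmorphV (real_complex R)) cReM/= mulr0 subr0.
Qed.

(** The condition on [k] puts [z / k] in the disc of [cexp_quad], whose error is then multiplied by
    [k]. The bound depends on [z] only through [C], as uniform estimates on compact sets require. *)
Lemma cexp_root_quad z k (C : R) : normc z <= C -> C * 2 <= k%:R -> (0 < k)%N ->
  normc (k%:R * (cexp (z / k%:R) - 1) - z) <= 10 * C ^+ 2 / k%:R.
Proof.
move=> zC Ck k0; have k0' : (0 : R) < k%:R by rewrite ltr0n.
have kn0 : (k%:R : R[i]) != 0 by rewrite pnatr_eq0 -lt0n.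
have -> : k%:R * (cexp (z / k%:R) - 1) - z = k%:R * (cexp (z / k%:R) - 1 - z / k%:R).
  by rewrite [RHS]mulrBr [X in _ = _ - X]mulrC divfK.
rewrite Normc.normcM normc_nat.
have zk : normc (z / k%:R) <= 1 / 2.
  by rewrite normc_divn ler_pdivrMr// (le_trans zC)//; lra.
rewrite (le_trans (ler_wpM2l _ (cexp_quad zk)))// normc_divn.
have -> : k%:R * (10 * (normc z / k%:R) ^+ 2) = 10 * normc z ^+ 2 / k%:R :> R.
  by field; rewrite gt_eqF.
by rewrite ler_wpM2r ?invr_ge0 ?ler0n// ler_wpM2l// ler_pXn2r// nnegrE ?normc_ge0// (le_trans (normc_ge0 z)).
Qed.

End complex_exponential.

(** * Comparison of functions through their powers *)

Section powers.
Context (R : realType).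

(** Unordered endpoints: the base point [a] may lie on either side of [b]. *)
Definition between (a b t : R) := (Num.min a b <= t) && (t <= Num.max a b).

Lemma betweenx (a b : R) : between a b b.
Proof. by rewrite /between ge_min le_max lexx !orbT. Qed.

(* A continuous [y >= 0] starting from [0] cannot cross the level [c / 2], where
   [y (c - y) = c^2 / 4 > eta]; below that level, [y (c - y) <= eta] forces
   [y <= 2 eta / c]. *)
Lemma le_of_gap (y : R -> R) (a b c eta : R) : 0 < c -> 4 * eta < c ^+ 2 ->
  continuous y -> y a = 0 -> (forall t, 0 <= y t) ->
  (forall t, between a b t -> y t * (c - y t) <= eta) ->
  y b <= 2 * eta / c.
Proof.
move=> c0 etac cy ya y0 h; rewrite ler_pdivlMr//.
have hb := h _ (betweenx a b).
have [yb|yb] := leP (c / 2) (y b); last by have := y0 b; nra.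
suff [t tab yt] : exists2 t, between a b t & y t = c / 2.
  by have := h _ tab; rewrite yt; nra.
have c20 : 0 <= c / 2 by rewrite divr_ge0// ltW.
have [ab|/ltW ba] := leP a b.
  have [||t] := @IVT R y a b (c / 2) ab.
  - exact: continuous_subspaceT.
  - by rewrite ya ge_min c20/= le_max yb orbT.
  by rewrite in_itv/= => tab <-; exists t => //; rewrite /between min_l// max_r.
have [||t] := @IVT R y b a (c / 2) ba.
- exact: continuous_subspaceT.
- by rewrite ya ge_min c20/= orbT le_max yb.
by rewrite in_itv/= => tab <-; exists t => //; rewrite /between min_r// max_l.
Qed.

Definition ccontinuous (f : R -> R[i]) := forall t, ccvg (nbhs t) f (f t).

(** Selection of the right root: [y t = k |f t - g t|] satisfies [y (c - y) <= eta] by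
    [normc_subX_ge] and vanishes at [a], so continuity keeps it on the small side of the gap. The
    bound has no other dependence on [k]. *)
Lemma root_gap (f g : R -> R[i]) (k : nat) (a b c eta : R) :
  (0 < k)%N -> 0 < c -> 4 * eta < c ^+ 2 ->
  ccontinuous f -> ccontinuous g -> f a = g a ->
  (forall t, normc (f t) <= 1) -> (forall t, normc (g t) <= 1) ->
  (forall t, between a b t ->
    c <= normc (g t) ^+ k /\ normc (f t ^+ k - g t ^+ k) <= eta) ->
  k%:R * normc (f b - g b) <= 2 * eta / c.
Proof.
move=> k0 c0 etac cf cg fga f1 g1 h.
apply: (@le_of_gap (fun t => k%:R * normc (f t - g t)) a b) => //.
- move=> t; apply: cvgM; first exact: cvg_cst.
  by apply: ccvg_normc; apply: ccvgB; [exact: cf|exact: cg].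
- by rewrite fga subrr Normc.normc0 mulr0.
- by move=> t; rewrite mulr_ge0// normc_ge0.
move=> t /h[cgk fgk]; apply: le_trans fgk.
exact: normc_subX_ge.
Qed.

Lemma inv_nat_cvg0 (F : set_system nat) (FF : Filter F) (k : nat -> nat) (C : R) :
  k @ F --> \oo -> C / (k n)%:R @[n --> F] --> 0.
Proof.
move=> koo; rewrite -(mulr0 C); apply: cvgM; first exact: cvg_cst.
apply: (@cvg_comp _ _ _ k (fun m : nat => (m%:R : R)^-1) F \oo) => //.
apply/gtr0_cvgV0; last exact: cvgr_idn.
by near=> n; rewrite ltr0n; near: n; exact: nbhs_infty_gt.
Unshelve. all: by end_near. Qed.

Lemma near_nat_ge (F : set_system nat) (FF : Filter F) (k : nat -> nat) (C : R) :
  k @ F --> \oo -> \forall n \near F, (0 < k n)%N /\ C <= (k n)%:R.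
Proof.
move=> koo; apply: (koo (fun m => (0 < m)%N /\ C <= m%:R)).
near=> n; split; first by near: n; exact: nbhs_infty_gt.
by near: n; exact: nbhs_infty_ger.
Unshelve. all: by end_near. Qed.

(** Instead of a logarithm of [w n], the proof compares [w n] with the root [cexp (z / k n)] of
    [cexp z]: by [normc_subX] the distance of the powers is at most [k n] times that of the bases,
    and both bases are [1 + z / k n] up to [o(1 / k n)]. *)
Lemma exp_limit (F : set_system nat) (FF : ProperFilter F) (k : nat -> nat)
    (w : nat -> R[i]) (z : R[i]) :
  k @ F --> \oo -> (forall n, normc (w n) <= 1) ->
  ccvg F (fun n => (k n)%:R * (w n - 1)) z ->
  ccvg F (fun n => w n ^+ k n) (cexp z).
Proof.
move=> koo w1 wz.
(* This gives modulus at most 1 to [cexp (z / k n)], as [normc_subX] demands. *)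
have Rez : Re z <= 0.
  have [wzR _] := wz.
  apply: (@closed_cvg _ _ _ FF _ (fun x : R => x <= 0) _ _ _ wzR).
    exact: closed_le.
  apply: nearW => n; rewrite Re_natM cReD cReN/= mulr_ge0_le0//.
  by rewrite subr_le0 (le_trans (ler_norm _))// (le_trans (normc_Re _)).
set C := normc z.
have near2 := near_nat_ge FF (C * 2) koo.
apply: (@ccvg_le _ _ _ _ _ _ (fun n =>
  normc ((k n)%:R * (w n - 1) - z) + 10 * C ^+ 2 / (k n)%:R)).
  apply: (@filterS _ F FF) near2 => n [kn0 kn].
  rewrite -(cexp_root z kn0) (le_trans (normc_subX _ _ _))//.
    rewrite normc_cexp Re_divn -expR0 ler_expR.
    by rewrite mulr_le0_ge0// invr_ge0.
  rewrite -{1}(@normc_nat R (k n)) -Normc.normcM.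
  have -> : (k n)%:R * (w n - cexp (z / (k n)%:R)) =
    ((k n)%:R * (w n - 1) - z) - ((k n)%:R * (cexp (z / (k n)%:R) - 1) - z) by ring.
  rewrite (le_trans (le_normcB _ _))// lerD2l.
  exact: cexp_root_quad.
rewrite -[X in _ --> X]addr0; apply: cvgD; last exact: inv_nat_cvg0.
rewrite -(Normc.normc0 R) -(subrr z).
by apply: ccvg_normc; apply: ccvgB => //; exact: ccvg_cst.
Qed.

Lemma exp_root_limit (F : set_system nat) (FF : Filter F) (k : nat -> nat)
    (z : R[i]) : k @ F --> \oo ->
  ccvg F (fun n => (k n)%:R * (cexp (z / (k n)%:R) - 1)) z.
Proof.
move=> koo; apply: (@ccvg_le _ _ _ _ _ _ (fun n => 10 * normc z ^+ 2 / (k n)%:R)).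
  apply: (@filterS _ F FF) (near_nat_ge FF (normc z * 2) koo) => n [kn0 kn].
  exact: cexp_root_quad.
exact: inv_nat_cvg0.
Qed.

End powers.

(** * Complex expectations and Fourier transforms *)

Definition bounded_measurableC d (T : measurableType d) (R : realType)
    (f : T -> R[i]) :=
  bounded_measurable (fun x => Re (f x)) /\ bounded_measurable (fun x => Im (f x)).

Section complex_expectation.
Context d (T : measurableType d) (R : realType).
Implicit Types (f g : T -> R[i]) (P : probability T R).
Local Notation bmC := (@bounded_measurableC _ T R).

Lemma bmC_cst (z : R[i]) : bmC (fun=> z).
Proof. by split; exact: bm_cst. Qed.

Lemma bmCD f g : bmC f -> bmC g -> bmC (fun x => f x + g x).
Proof.
move=> [fR fI] [gR gI]; split.
  by under eq_fun do rewrite cReD; exact: bmD.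
by under eq_fun do rewrite cImD; exact: bmD.
Qed.

Lemma bmCN f : bmC f -> bmC (fun x => - f x).
Proof.
move=> [fR fI]; split.
  by under eq_fun do rewrite cReN; exact: bmN.
by under eq_fun do rewrite cImN; exact: bmN.
Qed.

Lemma bmCB f g : bmC f -> bmC g -> bmC (fun x => f x - g x).
Proof. by move=> bf bg; apply: bmCD bf (bmCN bg). Qed.

Lemma bmCM f g : bmC f -> bmC g -> bmC (fun x => f x * g x).
Proof.
move=> [fR fI] [gR gI]; split.
  by under eq_fun do rewrite cReM; apply: bmB; exact: bmM.
by under eq_fun do rewrite cImM; apply: bmD; exact: bmM.
Qed.

Lemma bmC_sum (I : Type) (s : seq I) (f_ : I -> T -> R[i]) :
  (forall i, bmC (f_ i)) -> bmC (fun x => \sum_(i <- s) f_ i x).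
Proof.
move=> bf; elim: s => [|i s IH].
  by under eq_fun do rewrite big_nil; exact: bmC_cst.
by under eq_fun do rewrite big_cons; exact: bmCD.
Qed.

Lemma bmC_prod (I : Type) (s : seq I) (f_ : I -> T -> R[i]) :
  (forall i, bmC (f_ i)) -> bmC (fun x => \prod_(i <- s) f_ i x).
Proof.
move=> bf; elim: s => [|i s IH].
  by under eq_fun do rewrite big_nil; exact: bmC_cst.
by under eq_fun do rewrite big_cons; exact: bmCM.
Qed.

Lemma bmC_le f (C : R) : measurable_fun [set: T] (fun x => Re (f x)) ->
  measurable_fun [set: T] (fun x => Im (f x)) ->
  (forall x, normc (f x) <= C) -> bmC f.
Proof.
by move=> mR mI fC; split; split => //; exists C => x;
  rewrite (le_trans _ (fC x))// ?normc_Re// normc_Im.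
Qed.

Lemma bm_normc f : bmC f -> bounded_measurable (fun x => normc (f x)).
Proof.
move=> [[mR [A fA]] [mI [B fB]]]; split.
  under eq_fun do rewrite normcE2.
  apply: (measurableT_comp (continuous_measurable_fun (@sqrt_continuous R))).
  by apply: measurable_funD; apply: measurable_funX.
exists (A + B) => x; rewrite ger0_norm ?normc_ge0//.
by rewrite (le_trans (normc_le _))// lerD.
Qed.

Lemma CE_cst P (z : R[i]) : Cintegral P (fun=> z) = z.
Proof. by apply: eq_ReIm; rewrite /= E_cst. Qed.

Lemma CE_ext P f g : (forall x, f x = g x) -> Cintegral P f = Cintegral P g.
Proof. by move=> /funext ->. Qed.

Lemma CE_D P f g : bmC f -> bmC g ->
  Cintegral P (fun x => f x + g x) = Cintegral P f + Cintegral P g.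
Proof.
move=> [fR fI] [gR gI]; apply: eq_ReIm; rewrite ?cReD ?cImD /= -E_D//;
  by apply: eq_Rintegral => x _; rewrite ?cReD ?cImD.
Qed.

Lemma CE_Z P (z : R[i]) f : bmC f ->
  Cintegral P (fun x => z * f x) = z * Cintegral P f.
Proof.
move=> [fR fI]; apply: eq_ReIm; rewrite ?cReM ?cImM /= -!E_Z//.
  rewrite -E_B//; [|exact: bmZ|exact: bmZ].
  by apply: eq_Rintegral => x _; rewrite cReM.
rewrite -E_D//; [|exact: bmZ|exact: bmZ].
by apply: eq_Rintegral => x _; rewrite cImM.
Qed.

Lemma CE_N P f : bmC f -> Cintegral P (fun x => - f x) = - Cintegral P f.
Proof.
by move=> bf; rewrite -mulN1r -CE_Z//; apply: CE_ext => x; rewrite mulN1r.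
Qed.

Lemma CE_B P f g : bmC f -> bmC g ->
  Cintegral P (fun x => f x - g x) = Cintegral P f - Cintegral P g.
Proof. by move=> bf bg; rewrite CE_D ?CE_N//; exact: bmCN. Qed.

Lemma CE_sum P (I : Type) (s : seq I) (f_ : I -> T -> R[i]) :
  (forall i, bmC (f_ i)) ->
  Cintegral P (fun x => \sum_(i <- s) f_ i x) = \sum_(i <- s) Cintegral P (f_ i).
Proof.
move=> bf; elim: s => [|i s IH].
  by rewrite big_nil -[RHS](CE_cst P); apply: CE_ext => x; rewrite big_nil.
rewrite big_cons -IH -CE_D//; last exact: bmC_sum.
by apply: CE_ext => x; rewrite big_cons.
Qed.

(* Rotate [Cintegral P f] to the positive real axis by its conjugate. *)
Lemma CE_norm P f : bmC f ->
  normc (Cintegral P f) <= \int[P]_x normc (f x).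
Proof.
move=> bf; set z := Cintegral P f.
have [->|z0] := eqVneq (normc z) 0.
  by apply: Rintegral_ge0 => x _; exact: normc_ge0.
have zp : 0 < normc z by rewrite lt_def z0 normc_ge0.
rewrite -(ler_pM2l zp) -expr2 sqr_normc_ReIm.
have -> : Re z ^+ 2 + Im z ^+ 2 = Re (Cintegral P (fun x => z^* * f x)).
  by rewrite CE_Z// -/z cReM; case: (z) => a b /=; ring.
rewrite -E_Z; last exact: bm_normc.
apply: E_le.
- by have [] := bmCM (bmC_cst z^*) bf.
- by apply: bmZ; exact: bm_normc.
move=> x; rewrite (le_trans (ler_norm _))// (le_trans (normc_Re _))//.
by rewrite Normc.normcM; case: (z) => a b /=; rewrite sqrrN.
Qed.

Lemma CE_bound P f (C : R) : bmC f -> (forall x, normc (f x) <= C) ->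
  normc (Cintegral P f) <= C.
Proof.
move=> bf fC; rewrite (le_trans (CE_norm _ bf))//.
rewrite -[leRHS](E_cst P); apply: E_le => //; last exact: bm_cst.
exact: bm_normc.
Qed.

Lemma CE_eq_full P (D : set T) f g : measurable D -> P D = 1%E ->
  measurable_fun [set: T] (fun x => Re (f x)) ->
  measurable_fun [set: T] (fun x => Im (f x)) ->
  measurable_fun [set: T] (fun x => Re (g x)) ->
  measurable_fun [set: T] (fun x => Im (g x)) ->
  (forall x, D x -> f x = g x) -> Cintegral P f = Cintegral P g.
Proof.
move=> mD PD fR fI gR gI fg; apply: eq_ReIm => /=;
  by apply: (@E_eq_full _ _ _ _ D) => // x Dx; rewrite fg.
Qed.

End complex_expectation.

Lemma bmC_comp d1 d2 (T1 : measurableType d1) (T2 : measurableType d2)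
    (R : realType) (h : T1 -> T2) (f : T2 -> R[i]) :
  measurable_fun [set: T1] h -> bounded_measurableC f ->
  bounded_measurableC (fun x => f (h x)).
Proof.
by move=> mh [fR fI]; split; [exact: (bm_comp mh fR)|exact: (bm_comp mh fI)].
Qed.

Section complex_expectation2.
Context d1 d2 (T1 : measurableType d1) (T2 : measurableType d2) (R : realType).

Lemma CE_distribution (P : probability T1 R) (X : {mfun T1 >-> T2})
    (f : T2 -> R[i]) : bounded_measurableC f ->
  Cintegral (distribution P X) f = Cintegral P (fun x => f (X x)).
Proof. by move=> [fR fI]; apply: eq_ReIm; rewrite /= E_distribution. Qed.

Variables (P : probability T1 R) (Q : probability T2 R).

Section fubini.
Variable f : T1 * T2 -> R[i].
Hypothesis bf : bounded_measurableC f.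

Lemma bmC_slice1 x : bounded_measurableC (fun y => f (x, y)).
Proof. by have [fR fI] := bf; split; [exact: (bm_slice1 fR)|exact: (bm_slice1 fI)]. Qed.

Lemma bmC_slice2 y : bounded_measurableC (fun x => f (x, y)).
Proof. by have [fR fI] := bf; split; [exact: (bm_slice2 fR)|exact: (bm_slice2 fI)]. Qed.

Lemma bmC_param1 : bounded_measurableC (fun x => Cintegral Q (fun y => f (x, y))).
Proof.
by have [fR fI] := bf; split; [exact: (bm_param1 P Q fR)|exact: (bm_param1 P Q fI)].
Qed.

Lemma bmC_param2 : bounded_measurableC (fun y => Cintegral P (fun x => f (x, y))).
Proof.
by have [fR fI] := bf; split; [exact: (bm_param2 P Q fR)|exact: (bm_param2 P Q fI)].
Qed.

Lemma CE_fubini1 : Cintegral (P \x Q)%E f =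
  Cintegral P (fun x => Cintegral Q (fun y => f (x, y))).
Proof.
by have [fR fI] := bf; apply: eq_ReIm; rewrite /= ?(E_fubini1 P Q fR) ?(E_fubini1 P Q fI).
Qed.

Lemma CE_fubini2 : Cintegral (P \x Q)%E f =
  Cintegral Q (fun y => Cintegral P (fun x => f (x, y))).
Proof.
by have [fR fI] := bf; apply: eq_ReIm; rewrite /= ?(E_fubini2 P Q fR) ?(E_fubini2 P Q fI).
Qed.

End fubini.

Lemma CE_tensor (f : T1 -> R[i]) (g : T2 -> R[i]) :
  bounded_measurableC f -> bounded_measurableC g ->
  Cintegral (P \x Q)%E (fun z => f z.1 * g z.2) = Cintegral P f * Cintegral Q g.
Proof.
move=> bf bg; rewrite CE_fubini1; last first.
  by apply: bmCM; [exact: (bmC_comp measurable_fst bf)|exact: (bmC_comp measurable_snd bg)].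
transitivity (Cintegral P (fun x => Cintegral Q g * f x)).
  by apply: CE_ext => x /=; rewrite mulrC CE_Z.
by rewrite CE_Z// mulrC.
Qed.

End complex_expectation2.

(** * Characteristic functions *)

Section characteristic_function.
Context (R : realType).
Implicit Types a b : R.

Definition expi a : R[i] := cexp ('i * a%:C).

Lemma expiE a : expi a = cos a +i* sin a.
Proof.
rewrite /expi /cexp cReM cImM/= !mul0r !mul1r sub0r oppr0 expR0 !mul1r add0r.
by rewrite ?addr0 ?add0r.
Qed.

Lemma expiD a b : expi (a + b) = expi a * expi b.
Proof. by apply: eq_ReIm; rewrite ?cReM ?cImM !expiE/= ?cosD ?sinD//; ring. Qed.

Lemma expi0 : expi 0 = 1.
Proof. by rewrite expiE cos0 sin0. Qed.

Lemma normc_expi a : normc (expi a) = 1.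
Proof. by rewrite expiE/= cos2Dsin2 sqrtr1. Qed.

(** The truncation at 1 makes the bound integrable under every law, no moment being available. *)
Lemma normc_expiB a b : normc (expi a - expi b) <= 2 * Num.min 1 `|a - b|.
Proof.
have h : normc (expi a - expi b) <= 2 * `|a - b|.
  rewrite (le_trans (normc_le _))// cReD cImD cReN cImN !expiE/=.
  have := cos_lipschitz a b; have := sin_lipschitz a b; lra.
have [ab|ab] := leP 1 `|a - b|; last by [].
by rewrite (le_trans (le_normcB _ _))// !normc_expi; lra.
Qed.

Lemma bmC_expi d (T : measurableType d) (l : T -> R) :
  measurable_fun [set: T] l -> bounded_measurableC (fun x => expi (l x)).
Proof.
move=> ml; apply: (@bmC_le _ _ _ _ 1); last by move=> x; rewrite normc_expi.
  under eq_fun do rewrite expiE/=.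
  apply: measurableT_comp ml; apply: continuous_measurable_fun.
  exact: continuous_cos.
under eq_fun do rewrite expiE/=.
apply: measurableT_comp ml; apply: continuous_measurable_fun.
exact: continuous_sin.
Qed.

(** One notion for both settings: [l] is a multiple of the identity on the line, and a real linear
    form on matrices. *)
Definition cf d (T : measurableType d) (P : probability T R) (l : T -> R) :=
  Cintegral P (fun x => expi (l x)).

Lemma normc_cf d (T : measurableType d) (P : probability T R) (l : T -> R) :
  measurable_fun [set: T] l -> normc (cf P l) <= 1.
Proof.
by move=> ml; apply: CE_bound => [|x]; [exact: bmC_expi|rewrite normc_expi].
Qed.

Lemma CE_dirac d (T : measurableType d) (a : T) (f : T -> R[i]) :
  bounded_measurableC f -> Cintegral (dirac a : probability T R) f = f a.
Proof.
move=> [[mR _] [mI _]]; apply: eq_ReIm => /=; rewrite /Rintegral integral_dirac//.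
- by rewrite diracT mul1e.
- exact/measurable_EFinP.
- by rewrite diracT mul1e.
- exact/measurable_EFinP.
Qed.

Lemma cf_convolution_pow d (T : measurableType d) (zero : T)
    (add : {mfun (T * T)%type >-> T}) (P : probability T R) (l : T -> R) k :
  measurable_fun [set: T] l -> l zero = 0 ->
  (forall p, l (add p) = l p.1 + l p.2) ->
  cf (convolution_pow zero add P k) l = cf P l ^+ k.
Proof.
move=> ml l0 lD; elim: k => [|k IH].
  by rewrite /= /cf CE_dirac ?l0 ?expi0 ?expr0//; exact: bmC_expi.
rewrite exprS -IH /= /cf CE_distribution; last exact: bmC_expi.
by rewrite -CE_tensor; [apply: CE_ext => p; rewrite lD expiD|exact: bmC_expi..].
Qed.

Definition chf (P : probability R R) (t : R) : R[i] := cf P (fun x => t * x).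

Lemma measurable_scale (t : R) : measurable_fun [set: R] (fun x => t * x).
Proof. by apply: measurable_funM. Qed.

Lemma chf0 P : chf P 0 = 1.
Proof.
by rewrite -[RHS](CE_cst P); apply: CE_ext => x; rewrite mul0r expi0.
Qed.

Lemma normc_chf P t : normc (chf P t) <= 1.
Proof. by apply: normc_cf; exact: measurable_scale. Qed.

Lemma chf_conv_pow P k t : chf (real_conv_pow P k) t = chf P t ^+ k.
Proof.
apply: cf_convolution_pow; first exact: measurable_scale.
  by rewrite mulr0.
by move=> p; rewrite -mulrDr.
Qed.

Lemma chf_eq (P Q : probability R R) t :
  (forall A, measurable A -> P A = Q A) -> chf P t = chf Q t.
Proof.
move=> PQ; apply: eq_ReIm; rewrite /chf/cf/= /Rintegral; congr fine;
  by apply: eq_measure_integral => A mA _; exact: PQ.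
Qed.

(** Bounded and continuous, hence an admissible test function for weak convergence; its expectation
    controls the modulus of continuity of a characteristic function. *)
Definition truncabs (h x : R) : R := Num.min 1 (h * `|x|).

Lemma truncabs_ge0 h x : 0 <= h -> 0 <= truncabs h x.
Proof. by move=> h0; rewrite le_min ler01 mulr_ge0. Qed.

Lemma truncabs_norm h x : 0 <= h -> `|truncabs h x| <= 1.
Proof. by move=> h0; rewrite ger0_norm ?truncabs_ge0// ge_min lexx. Qed.

Lemma continuous_truncabs h : continuous (truncabs h).
Proof.
move=> x; apply: (@continuous_min R R (fun=> 1) (fun x => h * `|x|)).
  exact: cst_continuous.
by apply: cvgM; [exact: cvg_cst|exact: norm_continuous].
Qed.

Lemma bm_truncabs h : 0 <= h -> bounded_measurable (truncabs h).
Proof.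
move=> h0; split; last by exists 1 => x; exact: truncabs_norm.
apply: continuous_measurable_fun; exact: continuous_truncabs.
Qed.

Lemma chf_modulus P h s t : `|s - t| <= h ->
  normc (chf P s - chf P t) <= 2 * \int[P]_x truncabs h x.
Proof.
move=> sth; have h0 : 0 <= h by exact: le_trans sth.
have bs u := bmC_expi (measurable_scale u).
rewrite -CE_B// (le_trans (CE_norm _ (bmCB _ _)))//.
rewrite -E_Z; last exact: bm_truncabs.
apply: E_le => [||x]; [exact/bm_normc/bmCB|exact/bmZ/bm_truncabs|].
rewrite (le_trans (normc_expiB _ _))// ler_wpM2l// -mulrBl normrM.
by rewrite le_min ge_min lexx/= ge_min ler_wpM2r ?orbT.
Qed.

Lemma truncabs_small (P : probability R R) (e : R) : 0 < e ->
  exists2 h, 0 < h & \int[P]_x truncabs h x <= e.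
Proof.
move=> e0.
have h : \int[P]_x truncabs (n.+1%:R^-1) x @[n --> \oo] --> \int[P]_x (0 : R).
  apply: (@E_dct _ _ _ P [set: R] (fun n x => truncabs (n.+1%:R^-1) x)
    (fun=> 0) 1) => //.
  - by rewrite probability_setT.
  - by move=> n; have [] := @bm_truncabs (n.+1%:R^-1) _.
  - by move=> n x _; exact: truncabs_norm.
  move=> x _; apply: (@squeeze_cvgr _ _ _ _ (fun=> 0) (fun n => n.+1%:R^-1 * `|x|)).
  - by apply: nearW => n; rewrite truncabs_ge0// ge_min lexx orbT.
  - exact: cvg_cst.
  - rewrite -(mul0r `|x|); apply: cvgM; last exact: cvg_cst.
    exact: cvg_harmonic.
move: h; rewrite E_cst => /cvgrPdist_le/(_ e e0)[N _ /(_ N (leqnn _))].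
rewrite sub0r normrN => hN; exists N.+1%:R^-1; first by rewrite invr_gt0.
by rewrite (le_trans (ler_norm _)).
Qed.

Lemma chf_uniformly_continuous P (e : R) : 0 < e ->
  exists2 h, 0 < h &
    forall s t, `|s - t| <= h -> normc (chf P s - chf P t) <= e.
Proof.
move=> e0; have [h h0 hP] := @truncabs_small P (e / 2) (divr_gt0 e0 (ltr0Sn R 1)).
exists h => // s t sth; rewrite (le_trans (chf_modulus P sth))//.
by rewrite mulrC -ler_pdivlMr.
Qed.

Lemma chf_continuous P : ccontinuous (chf P).
Proof.
move=> t; apply/ccvgP => e /(chf_uniformly_continuous P)[h h0 hP].
near=> s; apply: hP; rewrite distrC; near: s.
by apply: cvgr_dist_le => //; exact: cvg_id.
Unshelve. all: by end_near. Qed.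

End characteristic_function.

(** * Uniform convergence of characteristic functions on compact sets *)

Section weak_convergence.
Context (R : realType) (mu : probability R R) (nu : nat -> probability R R).
Hypothesis numu : weak_cvg nu mu.

Lemma chf_cvg t : ccvg \oo (fun n => chf (nu n) t) (chf mu t).
Proof.
split; rewrite /chf/cf/=.
  apply: (numu (f := fun x => Re (expi (t * x)))); last first.
    by exists 1 => x; rewrite (le_trans (normc_Re _))// normc_expi.
  under eq_fun do rewrite expiE/=.
  move=> x; apply: continuous_comp; last exact: continuous_cos.
  by apply: cvgM; [exact: cvg_cst|exact: cvg_id].
apply: (numu (f := fun x => Im (expi (t * x)))); last first.
  by exists 1 => x; rewrite (le_trans (normc_Im _))// normc_expi.
under eq_fun do rewrite expiE/=.
move=> x; apply: continuous_comp; last exact: continuous_sin.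
by apply: cvgM; [exact: cvg_cst|exact: cvg_id].
Qed.

Lemma grid_approx (h T : R) : 0 < h -> exists N : nat,
  forall t, `|t| <= T -> exists2 j : 'I_N, true & `|t - (j%:R * h - T)| <= h.
Proof.
move=> h0; pose N := (Num.truncn (2 * T / h)).+1; exists N => t.
rewrite ler_norml => /andP[t1 t2].
have q0 : 0 <= (t + T) / h by rewrite divr_ge0 ?(ltW h0)//; lra.
have jN : (Num.truncn ((t + T) / h) < N)%N.
  rewrite ltnS le_truncn// ler_wpM2r ?invr_ge0 ?(ltW h0)//; lra.
exists (Ordinal jN) => //=.
have /andP[q1 q2] := truncn_itv q0; move: q1 q2.
rewrite ler_pdivlMr// ltr_pdivrMr// -natr1 => q1 q2.
by rewrite ler_norml; apply/andP; split; lra.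
Qed.

(* Weak convergence makes the characteristic functions equicontinuous, which
   upgrades their pointwise convergence. *)
Lemma chf_cvg_uniform (T e : R) : 0 < e ->
  \forall n \near \oo, forall t, `|t| <= T ->
    normc (chf (nu n) t - chf mu t) <= e.
Proof.
(* After the factor 2 of [chf_modulus], [mu] costs [e / 8] and [nu n] costs [e / 4]; the grid point
   costs [e / 4]. *)
move=> e0; have e16 : 0 < e / 16 by rewrite divr_gt0.
have [h h0 hmu] := truncabs_small mu e16.
have hnu : \forall n \near \oo, \int[nu n]_x truncabs h x <= e / 8.
  have := numu (@continuous_truncabs R h).
  have bnd : exists C, forall x, `|truncabs h x| <= C.
    by exists 1 => x; apply: truncabs_norm; exact: ltW.
  move=> /(_ bnd) /cvgrPdist_le/(_ _ e16).
  by apply: filterS => n; rewrite ler_norml => /andP[? ?]; lra.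
have [N hN] := grid_approx T h0.
have hgrid : \forall n \near \oo, forall j : 'I_N,
    normc (chf (nu n) (j%:R * h - T) - chf mu (j%:R * h - T)) <= e / 4.
  apply: filter_forall => j.
  by have /ccvgP := chf_cvg (j%:R * h - T); apply; rewrite divr_gt0.
near=> n.
have hg : forall j : 'I_N,
    normc (chf (nu n) (j%:R * h - T) - chf mu (j%:R * h - T)) <= e / 4.
  by near: n.
have h4 : \int[nu n]_x truncabs h x <= e / 8 by near: n.
move=> t tT; have [j _ tj] := hN t tT; have h3 := hg j.
set s := _ - T in tj h3.
have h1 := chf_modulus (nu n) tj; have h2 := chf_modulus mu tj.
have -> : chf (nu n) t - chf mu t =
  (chf (nu n) t - chf (nu n) s) + (chf (nu n) s - chf mu s)
  - (chf mu t - chf mu s) by ring.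
rewrite (le_trans (le_normcB _ _))//.
have := le_normcD (chf (nu n) t - chf (nu n) s) (chf (nu n) s - chf mu s).
lra.
Unshelve. all: by end_near. Qed.

End weak_convergence.

Lemma continuous_ccontinuous (R : realType) (psi : R -> R[i]) :
  continuous psi -> ccontinuous psi.
Proof.
move=> cpsi t; apply/ccvgP => e e0.
have : nbhs (psi t) [set z | `|psi t - z| < e%:C].
  apply/nbhs_ballP; exists e%:C => /=; first by rewrite ltcE/= eqxx.
  by move=> z.
move=> /cpsi nt; apply: (@filterS _ (nbhs t) _ _ _ _ nt) => s /=; rewrite normc_distC.
by rewrite normc_def -normcE2 ltcR => /ltW.
Qed.

(** * The Lévy exponent as a limit over triangular arrays *)

Section levy_exponent.
Context (R : realType) (mu : probability R R) (psi : R -> R[i]).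
Hypotheses (cpsi : ccontinuous psi) (psi0 : psi 0 = 0).
Hypothesis psiE : forall t, chf mu t = cexp (psi t).

Lemma levy_Re_le0 t : Re (psi t) <= 0.
Proof.
by rewrite -ler_expR expR0 -normc_cexp -psiE normc_chf.
Qed.

Lemma ccontinuous_bounded (f : R -> R[i]) (T : R) : ccontinuous f ->
  exists B : R, forall t, `|t| <= T -> normc (f t) <= B.
Proof.
move=> cf; have [T0|T0] := ltP T 0.
  by exists 0 => t /le_lt_trans/(_ T0); rewrite ltNge normr_ge0.
have [||c _ hc] := @EVT_max R (fun t => normc (f t)) (- T) T.
- by lra.
- by apply: continuous_subspaceT => t; apply: ccvg_normc; exact: cf.
by exists (normc (f c)) => t tT; apply: hc; rewrite in_itv/= -ler_norml.
Qed.

Section triangular_array.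
Context (mu_ : nat -> probability R R) (k : nat -> nat).
Hypothesis koo : k n @[n --> \oo] --> \oo.
Hypothesis mucvg : weak_cvg (fun n => real_conv_pow (mu_ n) (k n)) mu.

(** Both [chf (mu_ n)] and [cexp (psi / k n)] are continuous, equal 1 at 0, and have uniformly close
    [k n]-th powers on [[- T, T]]; the power of the second is [chf mu], of modulus at least
    [expR (- B)] there. Hence [root_gap] applies from 0 to [t]. *)
Lemma chf_root_cvg (T e : R) : 0 < e ->
  \forall n \near \oo, forall t, `|t| <= T ->
    (k n)%:R * normc (chf (mu_ n) t - cexp (psi t / (k n)%:R)) <= e.
Proof.
move=> e0; have [B hB] := ccontinuous_bounded T cpsi.
pose c := expR (- B); have c0 : 0 < c by exact: expR_gt0.
(* The first entry meets the gap condition [4 * eta < c ^+ 2], the second turns the conclusion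
   [2 * eta / c] into [e]. *)
pose eta := Num.min (c ^+ 2 / 8) (e * c / 2).
have eta0 : 0 < eta by rewrite lt_min !divr_gt0 ?mulr_gt0// exprn_gt0.
near=> n.
have kn0 : (0 < k n)%N by near: n; exact: (koo (nbhs_infty_gt 0)).
have unif : forall s, `|s| <= T ->
    normc (chf (real_conv_pow (mu_ n) (k n)) s - chf mu s) <= eta.
  by near: n; exact: chf_cvg_uniform.
move=> t tT.
apply: (@le_trans _ _ (2 * eta / c)); last first.
  rewrite ler_pdivrMr//.
  by have : eta <= e * c / 2 by [rewrite ge_min lexx orbT]; lra.
apply: (@root_gap _ (chf (mu_ n)) (fun t => cexp (psi t / (k n)%:R)) _ 0) => //.
- have : eta <= c ^+ 2 / 8 by rewrite ge_min lexx.
  by have := exprn_gt0 2 c0; lra.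
- exact: chf_continuous.
- by move=> s; apply: ccvg_cexp; apply: ccvgM; [exact: cpsi|exact: ccvg_cst].
- by rewrite chf0 /= psi0 mul0r cexp0.
- by move=> s; exact: normc_chf.
- move=> s; rewrite normc_cexp Re_divn -expR0 ler_expR.
  by rewrite mulr_le0_ge0 ?levy_Re_le0// invr_ge0.
move=> s; rewrite /between => s0t.
have sT : `|s| <= T.
  rewrite (le_trans _ tT)// ler_norml; move: s0t; rewrite ge_min le_max.
  have := ler_norm t; have := ler_norm (- t); rewrite normrN.
  by move=> ? ? /andP[/orP[?|?] /orP[?|?]]; apply/andP; split; lra.
rewrite -normcX cexp_root// -psiE -chf_conv_pow; split; last exact: unif.
rewrite psiE normc_cexp ler_expR lerNl (le_trans _ (hB _ sT))//.
by rewrite (le_trans (ler_norm _))// normrN normc_Re.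
Unshelve. all: by end_near. Qed.

Lemma levy_cvg t :
  ccvg \oo (fun n => (k n)%:R * (chf (mu_ n) t - 1)) (psi t).
Proof.
apply/ccvgP => e e0; have e20 : 0 < e / 2 by rewrite divr_gt0.
near=> n.
have h1 : forall u, `|u| <= `|t| ->
    (k n)%:R * normc (chf (mu_ n) u - cexp (psi u / (k n)%:R)) <= e / 2.
  by near: n; exact: chf_root_cvg.
have h2 : normc ((k n)%:R * (cexp (psi t / (k n)%:R) - 1) - psi t) <= e / 2.
  near: n; move: (e / 2) e20.
  exact: ((ccvgP _ _ _).1 (exp_root_limit _ (psi t) koo)).
have -> : (k n)%:R * (chf (mu_ n) t - 1) - psi t =
  (k n)%:R * (chf (mu_ n) t - cexp (psi t / (k n)%:R)) +
  ((k n)%:R * (cexp (psi t / (k n)%:R) - 1) - psi t) by ring.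
rewrite (le_trans (le_normcD _ _))// Normc.normcM normc_nat [e]splitr lerD// h1.
Unshelve. all: by end_near. Qed.

(** The domination needed to pass to the limit under the Haar average, where the arguments of [chf]
    stay in a compact interval. *)
Lemma levy_bounded (T : R) : exists C : R, \forall n \near \oo,
  forall t, `|t| <= T -> normc ((k n)%:R * (chf (mu_ n) t - 1)) <= C.
Proof.
have [B hB] := ccontinuous_bounded T cpsi.
exists (1 + (10 * B ^+ 2 + B)).
near=> n.
have [kn0 kn] : (0 < k n)%N /\ B * 2 <= (k n)%:R.
  by near: n; exact: (near_nat_ge _ _ koo).
have h1 : forall t, `|t| <= T ->
    (k n)%:R * normc (chf (mu_ n) t - cexp (psi t / (k n)%:R)) <= 1.
  by near: n; exact: chf_root_cvg.
move=> t tT.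
have -> : (k n)%:R * (chf (mu_ n) t - 1) =
  (k n)%:R * (chf (mu_ n) t - cexp (psi t / (k n)%:R)) +
  (((k n)%:R * (cexp (psi t / (k n)%:R) - 1) - psi t) + psi t) by ring.
rewrite (le_trans (le_normcD _ _))// lerD//.
  by rewrite Normc.normcM normc_nat h1.
rewrite (le_trans (le_normcD _ _))// lerD ?hB//.
rewrite (le_trans (cexp_root_quad (hB _ tT) kn kn0))//.
apply: ler_piMr; first by rewrite mulr_ge0// sqr_ge0.
by rewrite invf_le1 ?ltr0n// ler1n.
Unshelve. all: by end_near. Qed.

End triangular_array.
End levy_exponent.

(** * Existence of the Lévy exponent *)

Section nonvanishing.
Context (R : realType).

(** The squared modulus is the characteristic function of [X - X'] for two independent copies, a
    real quantity. *)
Lemma sqr_normc_chf (P : probability R R) t :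
  normc (chf P t) ^+ 2 = \int[(P \x P)%E]_z cos (t * (z.1 - z.2)).
Proof.
have bc : bounded_measurable (fun x : R => cos (t * x)).
  have [+ _] := bmC_expi (measurable_scale t).
  by under eq_fun do rewrite expiE/=.
have bs : bounded_measurable (fun x : R => sin (t * x)).
  have [_] := bmC_expi (measurable_scale t).
  by under eq_fun do rewrite expiE/=.
have E : (fun z : R * R => cos (t * (z.1 - z.2))) = (fun z =>
    cos (t * z.1) * cos (t * z.2) + sin (t * z.1) * sin (t * z.2)).
  by apply/funext => z; rewrite mulrBr cosB.
have bcc : bounded_measurable (fun z : R * R => cos (t * z.1) * cos (t * z.2)).
  by apply: bmM; [exact: (bm_comp measurable_fst bc)|exact: (bm_comp measurable_snd bc)].
have bss : bounded_measurable (fun z : R * R => sin (t * z.1) * sin (t * z.2)).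
  by apply: bmM; [exact: (bm_comp measurable_fst bs)|exact: (bm_comp measurable_snd bs)].
have prodE f : bounded_measurable f ->
    bounded_measurable (fun z : R * R => f z.1 * f z.2) ->
    \int[(P \x P)%E]_z (f z.1 * f z.2) = (\int[P]_x f x) ^+ 2.
  move=> bf bff; rewrite E_fubini1// expr2 -E_Z//.
  by apply: eq_Rintegral => x _ /=; rewrite E_Z// mulrC.
rewrite E E_D// (prodE _ bc bcc) (prodE _ bs bss) sqr_normc_ReIm.
have -> : Re (chf P t) = \int[P]_x cos (t * x).
  by apply: eq_Rintegral => x _; rewrite expiE.
by have -> : Im (chf P t) = \int[P]_x sin (t * x)
  by apply: eq_Rintegral => x _; rewrite expiE.
Qed.

(* [1 - cos 2a <= 4 (1 - cos a)], integrated against the symmetrisation of P. *)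
Lemma chf_doubling (P : probability R R) t :
  1 - normc (chf P (2 * t)) ^+ 2 <= 4 * (1 - normc (chf P t) ^+ 2).
Proof.
have b u : bounded_measurable (fun z : R * R => cos (u * (z.1 - z.2))).
  have mu : measurable_fun [set: R * R] (fun z => u * (z.1 - z.2)).
    by apply: measurable_funM => //; apply: measurable_funB.
  have [bR _] := bmC_expi mu.
  by rewrite (_ : (fun _ => _) = fun z => Re (expi (u * (z.1 - z.2))));
    [exact: bR|apply/funext => z; rewrite expiE].
have B1 u : 1 - \int[(P \x P)%E]_z cos (u * (z.1 - z.2)) =
    \int[(P \x P)%E]_z (1 - cos (u * (z.1 - z.2))).
  by rewrite E_B ?E_cst//; exact: bm_cst.
rewrite !sqr_normc_chf !B1.
rewrite -E_Z; last by apply: bmB => //; exact: bm_cst.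
apply: E_le => [||z]; first by apply: bmB => //; exact: bm_cst.
  by apply: bmZ; apply: bmB => //; exact: bm_cst.
have -> : 2 * t * (z.1 - z.2) = (t * (z.1 - z.2)) *+ 2 by rewrite mulr2n; ring.
rewrite cos_mulr2n; set c := cos _.
have := cos_le1 (t * (z.1 - z.2)); have := cos_geN1 (t * (z.1 - z.2)).
by rewrite -/c mulr2n; nra.
Qed.

Context (mu : probability R R) (rt : nat -> probability R R).
Hypothesis rtE : forall n A, measurable A -> real_conv_pow (rt n) n.+1 A = mu A.

Lemma chf_root n t : chf mu t = chf (rt n) t ^+ n.+1.
Proof. by rewrite -chf_conv_pow; apply: chf_eq => A mA; rewrite rtE. Qed.

(** If [chf mu] vanishes at [2 * t], so do all roots [chf (rt n)]; by [chf_doubling] their squared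
    moduli at [t] are at most 3/4, and [(3 / 4) ^+ n.+1] bounds [normc (chf mu t) ^+ 2] for every
    [n]. *)
Lemma chf_neq0_double t : chf mu t != 0 -> chf mu (2 * t) != 0.
Proof.
apply: contra_neq => mu2t; apply: Normc.eq0_normc; apply/eqP.
have small n : normc (chf mu t) ^+ 2 <= (3 / 4) ^+ n.+1.
  have rt2 : chf (rt n) (2 * t) = 0.
    have : chf (rt n) (2 * t) ^+ n.+1 == 0 by rewrite -chf_root mu2t.
    by rewrite expf_eq0/= => /eqP.
  rewrite (chf_root n) normcX -exprM mulnC exprM lerXn2r ?nnegrE ?exprn_ge0 ?normc_ge0//.
  have := chf_doubling (rt n) t; rewrite rt2 Normc.normc0 expr0n/=; lra.
have cv : (3 / 4 : R) ^+ n @[n --> \oo] --> 0.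
  by apply: cvg_expr; rewrite ger0_norm//; lra.
rewrite -sqrf_eq0 eq_le sqr_ge0 andbT.
apply/ler_addgt0Pr => e e0; rewrite add0r.
have /cvgrPdist_le/(_ _ e0)[N _ /(_ N.+1 (leqnSn _))] := cv.
rewrite sub0r normrN => hN.
by rewrite (le_trans (small N))// (le_trans (ler_norm _)).
Qed.

(** Near 0 the function is close to 1, and every [t] is reached from there by finitely many
    doublings. *)
Lemma chf_neq0 t : chf mu t != 0.
Proof.
have c1 : ccvg \oo (fun n => chf mu ((2 ^- n) * t)) 1.
  apply/ccvgP => e e0.
  have [h h0 hmu] := chf_uniformly_continuous mu e0.
  have cv : (2^-1 : R) ^+ n * t @[n --> \oo] --> 0.
    rewrite -(mul0r t); apply: cvgM; last exact: cvg_cst.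
    by apply: cvg_expr; rewrite ger0_norm//; lra.
  have /cvgrPdist_le/(_ _ h0) := cv; apply: filterS => n; rewrite distrC => hn.
  by rewrite -(chf0 mu); apply: hmu; rewrite -exprVn.
have [n] : exists n : nat, chf mu ((2 ^- n) * t) != 0.
  have /ccvgP/(_ (1 / 2))[|N _ /(_ N (leqnn _)) hN] := c1; first by lra.
  exists N; apply/eqP => h0; move: hN; rewrite h0 sub0r normcN Normc.normc1; lra.
elim: n => [|n IH]; first by rewrite expr0 invr1 mul1r.
move=> /chf_neq0_double; rewrite mulrA exprS invfM mulrA mulfV// mul1r.
exact: IH.
Qed.

Lemma chf_lower_bound (T : R) :
  exists2 c, 0 < c & forall t, `|t| <= T -> c <= normc (chf mu t).
Proof.
have [T0|T0] := ltP T 0.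
  by exists 1 => // t /le_lt_trans/(_ T0); rewrite ltNge normr_ge0.
have [||c _ hc] := @EVT_min R (fun t => normc (chf mu t)) (- T) T.
- by lra.
- by apply: continuous_subspaceT => t; apply: ccvg_normc; exact: chf_continuous.
exists (normc (chf mu c)).
  rewrite lt_def normc_ge0 andbT; apply/eqP => /Normc.eq0_normc/eqP.
  exact/negP/chf_neq0.
by move=> t tT; apply: hc; rewrite in_itv/= -ler_norml.
Qed.

(* Near [a], the roots [chf (rt n)] stay within [O(1/n)] of their value at [a],
   uniformly in [n], because their powers stay close to [chf mu a]. *)
Lemma root_modulus (T e : R) : 0 < e -> exists2 h, 0 < h &
  forall n a b, `|a| <= T -> `|b| <= T -> `|b - a| <= h ->
    n.+1%:R * normc (chf (rt n) b - chf (rt n) a) <= e.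
Proof.
move=> e0; have [c c0 hc] := chf_lower_bound T.
pose eta := Num.min (c ^+ 2 / 8) (e * c / 2).
have eta0 : 0 < eta by rewrite lt_min !divr_gt0 ?mulr_gt0// exprn_gt0.
have [h h0 hmu] := chf_uniformly_continuous mu eta0.
exists h => // n a b aT bT abh.
apply: (@le_trans _ _ (2 * eta / c)); last first.
  rewrite ler_pdivrMr//.
  by have : eta <= e * c / 2 by [rewrite ge_min lexx orbT]; lra.
apply: (@root_gap _ (chf (rt n)) (fun=> chf (rt n) a) _ a) => //.
- have : eta <= c ^+ 2 / 8 by rewrite ge_min lexx.
  by have := exprn_gt0 2 c0; lra.
- exact: chf_continuous.
- by move=> s; exact: ccvg_cst.
- by move=> s; exact: normc_chf.
- by move=> s; exact: normc_chf.
move=> s; rewrite /between ge_min le_max => /andP[s1 s2].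
rewrite -normcX -!chf_root; split; first exact: hc.
apply: hmu; rewrite (le_trans _ abh)//.
rewrite ler_norml.
have := ler_norm (b - a); have := ler_norm (- (b - a)); rewrite normrN.
by move: s1 s2 => /orP[?|?] /orP[?|?] ? ?; apply/andP; split; lra.
Qed.

(** From 0 to [t] in [M] steps of length at most [h], each of which costs at most 1 by
    [root_modulus]. Since [h] does not depend on [n], neither does the bound [M]. *)
Lemma root_bounded (T : R) : exists C : R, forall n t, `|t| <= T ->
  n.+1%:R * normc (chf (rt n) t - 1) <= C.
Proof.
have [T0|T0] := ltP T 0.
  by exists 0 => n t /le_lt_trans/(_ T0); rewrite ltNge normr_ge0.
have [h h0 hrt] := @root_modulus T 1 ltr01.
pose M := (Num.truncn (T / h)).+1; exists M%:R => n t tT.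
have M0 : (0 : R) < M%:R by rewrite ltr0n.
have TM : T / M%:R <= h.
  rewrite ler_pdivrMr// mulrC -ler_pdivrMr// ltW//.
  by have /andP[_] := truncn_itv (divr_ge0 T0 (ltW h0)).
have step j : (j <= M)%N ->
    n.+1%:R * normc (chf (rt n) (j%:R * (t / M%:R)) - 1) <= j%:R.
  elim: j => [_|j IH jM].
    by rewrite mul0r chf0 subrr Normc.normc0 mulr0.
  have inT i : (i <= M)%N -> `|i%:R * (t / M%:R)| <= T.
    move=> iM; rewrite mulrA mulrAC normrM [`|_ / _|]ger0_norm ?divr_ge0//.
    rewrite (le_trans _ tT)// ler_piMl// ler_pdivrMr// mul1r ler_nat//.
  have jh : `|j.+1%:R * (t / M%:R) - j%:R * (t / M%:R)| <= h.
    rewrite -mulrBl -natrB// subSnn mul1r normrM (le_trans _ TM)//.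
    by rewrite [`|_^-1|]ger0_norm ?invr_ge0 ?ler0n// ler_wpM2r// invr_ge0 ler0n.
  have h1 := hrt n _ _ (inT j (ltnW jM)) (inT j.+1 jM) jh.
  have h2 := IH (ltnW jM).
  have := le_normcD (chf (rt n) (j.+1%:R * (t / M%:R)) - chf (rt n) (j%:R * (t / M%:R)))
    (chf (rt n) (j%:R * (t / M%:R)) - 1).
  rewrite addrA subrK => h3.
  rewrite (le_trans (ler_wpM2l _ h3))// mulrDr -[leRHS]natr1 [leRHS]addrC lerD//.
by have := step M (leqnn _); rewrite [M%:R * _]mulrC divfK// gt_eqF.
Qed.

(** The exponent is the [U]-limit of [n.+1 (chf (rt n) - 1)]: bounded by [root_bounded], continuous
    because [root_modulus] is uniform in [n], and an exponent by [exp_limit], the powers of the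
    roots being constantly [chf mu t]. *)
Lemma levy_exponent_exists : exists psi : R -> R[i],
  [/\ ccontinuous psi, psi 0 = 0 & forall t, chf mu t = cexp (psi t)].
Proof.
have [U [UU Uoo]] := ultraFilterLemma (_ : ProperFilter \oo).
pose u t n := n.+1%:R * (chf (rt n) t - 1) : R[i].
have limu t : exists z, ccvg U (u t) z.
  have [C hC] := root_bounded `|t|.
  have uC n : normc (u t n) <= C by rewrite Normc.normcM normc_nat hC.
  have [|a ha] := @ultralimit_exists R U UU (fun n => Re (u t n)) C.
    by apply: nearW => n; rewrite (le_trans (normc_Re _)).
  have [|b hb] := @ultralimit_exists R U UU (fun n => Im (u t n)) C.
    by apply: nearW => n; rewrite (le_trans (normc_Im _)).
  by exists (a +i* b).
pose psi t := sval (cid (limu t)).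
have psiP t : ccvg U (u t) (psi t) by rewrite /psi; case: cid.
have Soo : n.+1 @[n --> U] --> \oo.
  move=> A [N _ NA]; apply: Uoo; exists N => // n /= Nn.
  by apply: NA; exact: leqW.
exists psi; split.
- move=> t; apply/ccvgP => e e0.
  have [h h0 hrt] := root_modulus (`|t| + 1) e0.
  have hnear : \forall s \near t, `|t - s| <= Num.min h 1.
    apply/nbhs_ballP; exists (Num.min h 1); first by rewrite /= lt_min h0 ltr01.
    by move=> s /ltW.
  apply: filterS hnear => s; rewrite le_min distrC => /andP[sth st1].
  have cv : normc (u s n - u t n) @[n --> U] --> normc (psi s - psi t).
    by apply: ccvg_normc; apply: ccvgB.
  apply: (@closed_cvg _ _ U _ _ (fun x : R => x <= e) _ _ _ cv).
    exact: closed_le.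
  apply: nearW => n; rewrite /u -mulrBr Normc.normcM normc_nat.
  have -> : chf (rt n) s - 1 - (chf (rt n) t - 1) = chf (rt n) s - chf (rt n) t.
    by ring.
  apply: hrt => //; first by rewrite lerDl.
  by rewrite -[s](subrK t) addrC (le_trans (ler_normD _ _))// lerD2l.
- apply: (ccvg_unique _ (psiP 0)).
  have -> : u 0 = fun=> 0 by apply/funext => n; rewrite /u chf0 subrr mulr0.
  exact: ccvg_cst.
move=> t; apply: (@ccvg_unique _ _ U _ (fun n => chf (rt n) t ^+ n.+1)).
  by under eq_fun do rewrite -chf_root; exact: ccvg_cst.
apply: (@exp_limit R U _ S (fun n => chf (rt n) t) _ Soo) => [n|]; first exact: normc_chf.
exact: psiP.
Qed.

End nonvanishing.

(** * Complex functions that are bounded only almost surely *)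

Definition cmeasurable d (T : measurableType d) (R : realType) (f : T -> R[i]) :=
  measurable_fun [set: T] (fun x => Re (f x)) /\
  measurable_fun [set: T] (fun x => Im (f x)).

Section cmeasurable.
Context d (T : measurableType d) (R : realType).
Implicit Types f g : T -> R[i].
Local Notation mC := (@cmeasurable _ T R).

Lemma mC_cst (z : R[i]) : mC (fun=> z).
Proof. by split; exact: measurable_cst. Qed.

Lemma mCD f g : mC f -> mC g -> mC (fun x => f x + g x).
Proof.
move=> [fR fI] [gR gI]; split.
  by under eq_fun do rewrite cReD; exact: measurable_funD.
by under eq_fun do rewrite cImD; exact: measurable_funD.
Qed.

Lemma mCM f g : mC f -> mC g -> mC (fun x => f x * g x).
Proof.
move=> [fR fI] [gR gI]; split.
  by under eq_fun do rewrite cReM; apply: measurable_funB; exact: measurable_funM.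
by under eq_fun do rewrite cImM; apply: measurable_funD; exact: measurable_funM.
Qed.

Lemma cRe_conj (z : R[i]) : Re (Num.conj z) = Re z. Proof. by case: z. Qed.
Lemma cIm_conj (z : R[i]) : Im (Num.conj z) = - Im z. Proof. by case: z. Qed.

Lemma mC_conj f : mC f -> mC (fun x => Num.conj (f x)).
Proof.
move=> [fR fI]; split; first by under eq_fun do rewrite cRe_conj.
by under eq_fun do rewrite cIm_conj; exact: measurable_funN.
Qed.

Lemma mC_sum (I : Type) (s : seq I) (f_ : I -> T -> R[i]) :
  (forall i, mC (f_ i)) -> mC (fun x => \sum_(i <- s) f_ i x).
Proof.
move=> mf; elim: s => [|i s IH].
  by under eq_fun do rewrite big_nil; exact: mC_cst.
by under eq_fun do rewrite big_cons; exact: mCD.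
Qed.

Definition measurable_mx m n (f : T -> 'M[R[i]]_(m, n)) :=
  forall i j, mC (fun x => f x i j).

Lemma measurable_mx_cst m n (A : 'M[R[i]]_(m, n)) : measurable_mx (fun=> A).
Proof. by move=> i j; exact: mC_cst. Qed.

Lemma measurable_mxM m n p (f : T -> 'M[R[i]]_(m, n)) (g : T -> 'M[R[i]]_(n, p)) :
  measurable_mx f -> measurable_mx g -> measurable_mx (fun x => f x *m g x).
Proof.
move=> mf mg i j; under eq_fun do rewrite mxE.
by apply: mC_sum => k; apply: mCM; [exact: mf|exact: mg].
Qed.

Lemma measurable_mx_adj m n (f : T -> 'M[R[i]]_(m, n)) :
  measurable_mx f -> measurable_mx (fun x => (f x)^t*).
Proof.
by move=> mf i j; under eq_fun do rewrite !mxE; apply: mC_conj; exact: mf.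
Qed.

Lemma measurable_mxE m n (f : T -> 'M[R[i]]_(m, n)) :
  measurable_mx f <-> measurable_fun [set: T] f.
Proof.
split=> [mf|mf i j]; first by apply: measurable_fun_mxP => i j; exact: mf.
by split; [exact: (measurableT_comp (@measurable_mx_Re R m n i j))|
  exact: (measurableT_comp (@measurable_mx_Im R m n i j))].
Qed.

End cmeasurable.

(** An exponent [psi] may be unbounded on the line, so the bound is available on [D] only; cutting
    off by the indicator of [D] does not change the integral. *)
Lemma mC_bounded d (T : measurableType d) (R : realType) (P : probability T R)
    (D : set T) (f : T -> R[i]) (C : R) :
  measurable D -> P D = 1%E -> cmeasurable f ->
  (forall x, D x -> normc (f x) <= C) -> normc (Cintegral P f) <= C.
Proof.
move=> mD PD [mR mI] fC.
(* [D] has mass 1, hence a point; the sign of [C] is needed off [D], where the cut-off function is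
   0. *)
have C0 : 0 <= C.
  have [x Dx] : D !=set0.
    apply/set0P/eqP => D0; have : P D = 0%E by rewrite D0 measure0.
    by rewrite PD => /eqP; rewrite onee_eq0.
  exact: le_trans (normc_ge0 _) (fC x Dx).
have mind : measurable_fun [set: T] (\1_D : T -> R) by exact: measurable_indic.
pose g x := (\1_D x)%:C * f x.
have gR x : Re (g x) = \1_D x * Re (f x) by rewrite cReM/= mul0r subr0.
have gI x : Im (g x) = \1_D x * Im (f x) by rewrite cImM/= mul0r addr0.
have mgR : measurable_fun [set: T] (fun x => Re (g x)).
  by under eq_fun do rewrite gR; exact: measurable_funM.
have mgI : measurable_fun [set: T] (fun x => Im (g x)).
  by under eq_fun do rewrite gI; exact: measurable_funM.
have gC x : normc (g x) <= C.
  rewrite Normc.normcM normc_real indicE; case: (boolP (x \in D)) => xD.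
    by rewrite normr1 mul1r fC//; move: xD; rewrite inE.
  by rewrite normr0 mul0r.
rewrite (_ : Cintegral P f = Cintegral P g); last first.
  apply: (CE_eq_full mD PD) => // x Dx.
  by rewrite /g indicE mem_set// mul1r.
by apply: CE_bound => //; apply: bmC_le mgR mgI gC.
Qed.

Lemma mC_dct d (T : measurableType d) (R : realType) (P : probability T R)
    (D : set T) (f_ : nat -> T -> R[i]) (f : T -> R[i]) (C : R) :
  measurable D -> P D = 1%E ->
  (forall n, cmeasurable (f_ n)) -> cmeasurable f ->
  (\forall n \near \oo, forall x, D x -> normc (f_ n x) <= C) ->
  (forall x, D x -> ccvg \oo (fun n => f_ n x) (f x)) ->
  ccvg \oo (fun n => Cintegral P (f_ n)) (Cintegral P f).
Proof.
move=> mD PD mf_ [mfR mfI] [N _ fC] fcv.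
(* The bound holds from rank [N] on only, so the sequence is shifted by [N]. *)
split; rewrite -(cvg_shiftn N)/=.
  apply: (@E_dct _ _ _ P D (fun n x => Re (f_ (n + N)%N x)) (fun x => Re (f x)) C) => //.
  - by move=> n; case: (mf_ (n + N)%N).
  - by move=> n x Dx; rewrite (le_trans (normc_Re _)) ?fC//= leq_addl.
  - move=> x Dx; have [+ _] := fcv x Dx.
    by rewrite -(cvg_shiftn N).
apply: (@E_dct _ _ _ P D (fun n x => Im (f_ (n + N)%N x)) (fun x => Im (f x)) C) => //.
- by move=> n; case: (mf_ (n + N)%N).
- by move=> n x Dx; rewrite (le_trans (normc_Im _)) ?fC//= leq_addl.
- move=> x Dx; have [_] := fcv x Dx.
  by rewrite -(cvg_shiftn N).
Qed.

Lemma CE_iid d (T : measurableType d) (R : realType) (mu : probability T R) n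
    (g : 'I_n -> T -> R[i]) : (forall j, bounded_measurableC (g j)) ->
  Cintegral (iid_law mu n) (fun x => \prod_(j < n) g j (tnth x j)) =
  \prod_(j < n) Cintegral mu (g j).
Proof.
elim: n g => [|n IH] g bg.
  by rewrite big_ord0 -[RHS](CE_cst (iid_law mu 0)); apply: CE_ext => x; rewrite big_ord0.
have btn j : bounded_measurableC (fun x : n.+1.-tuple T => g j (tnth x j)).
  by apply: bmC_comp (bg j); exact: measurable_tnth.
have btn' j : bounded_measurableC (fun x : n.-tuple T => g (lift ord0 j) (tnth x j)).
  by apply: bmC_comp (bg _); exact: measurable_tnth.
rewrite /= CE_distribution; last exact: bmC_prod.
rewrite big_ord_recl -IH; last by move=> j; exact: bg.
rewrite -CE_tensor//; last exact: bmC_prod.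
apply: CE_ext => p; rewrite big_ord_recl; congr (_ * _).
by apply: eq_bigr => j _; rewrite tnthS.
Qed.

(** * Products of factors close to 1 *)

Section small_products.
Context (R : realType) (I : Type).

Lemma normc_prod_sub1 (s : seq I) (w : I -> R[i]) :
  (forall i, normc (w i) <= 1) ->
  normc (\prod_(i <- s) w i - 1) <= \sum_(i <- s) normc (w i - 1).
Proof.
move=> w1; elim: s => [|i s IH].
  by rewrite !big_nil subrr Normc.normc0.
rewrite !big_cons.
have -> : w i * \prod_(j <- s) w j - 1 =
  (w i - 1) + w i * (\prod_(j <- s) w j - 1) by ring.
rewrite (le_trans (le_normcD _ _))// lerD2l Normc.normcM.
by rewrite (le_trans _ IH)// ler_piMl// normc_ge0.
Qed.

(** To first order a product of factors [1 + z i / k] behaves as a sum: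
    [w P - 1 = (w - 1) P + (P - 1)], and the partial product [P] tends to 1 because [k (P - 1)]
    converges while [k] tends to infinity. *)
Lemma prod_sub1_cvg (k : nat -> nat) (s : seq I) (w : I -> nat -> R[i])
    (z : I -> R[i]) : k n @[n --> \oo] --> \oo ->
  (forall i, ccvg \oo (fun n => (k n)%:R * (w i n - 1)) (z i)) ->
  ccvg \oo (fun n => (k n)%:R * (\prod_(i <- s) w i n - 1)) (\sum_(i <- s) z i).
Proof.
move=> koo wz; elim: s => [|i s IH].
  rewrite big_nil; under eq_fun do rewrite big_nil subrr mulr0.
  exact: ccvg_cst.
rewrite big_cons.
have P1 : ccvg \oo (fun n => \prod_(j <- s) w j n) 1.
  apply: (@ccvg_le _ _ _ _ _ _ (fun n =>
    normc ((k n)%:R * (\prod_(j <- s) w j n - 1)) / (k n)%:R)).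
    have kpos := @near_nat_ge R \oo _ k 0 koo.
    near=> n; have [kn0 _] : (0 < k n)%N /\ 0 <= (k n)%:R :> R by near: n; exact: kpos.
    rewrite Normc.normcM normc_nat mulrC mulKf// gt_eqF// ltr0n//.
  rewrite -(mulr0 (normc (\sum_(j <- s) z j))).
  apply: cvgM; first exact: ccvg_normc.
  by under eq_fun do rewrite -[_^-1]mul1r; exact: inv_nat_cvg0.
have -> : z i + \sum_(j <- s) z j = z i * 1 + \sum_(j <- s) z j by rewrite mulr1.
apply: (ccvg_eq (u := fun n => (k n)%:R * (w i n - 1) * \prod_(j <- s) w j n +
  (k n)%:R * (\prod_(j <- s) w j n - 1))).
  by move=> n; rewrite big_cons; ring.
by apply: ccvgD => //; apply: ccvgM.
Unshelve. all: by end_near. Qed.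

End small_products.

Lemma mC_ccontinuous (R : realType) (f : R -> R[i]) : ccontinuous f -> cmeasurable f.
Proof.
move=> cf; split; apply: continuous_measurable_fun => t; first by case: (cf t).
by case: (cf t).
Qed.

Lemma mC_comp d1 d2 (T1 : measurableType d1) (T2 : measurableType d2)
    (R : realType) (h : T1 -> T2) (f : T2 -> R[i]) :
  measurable_fun [set: T1] h -> cmeasurable f -> cmeasurable (fun x => f (h x)).
Proof. by move=> mh [fR fI]; split; [exact: measurableT_comp fR mh|exact: measurableT_comp fI mh]. Qed.

Lemma bmC_mC d (T : measurableType d) (R : realType) (f : T -> R[i]) :
  bounded_measurableC f -> cmeasurable f.
Proof. by move=> [[? _] [? _]]. Qed.

Lemma measurable_eqC d (T : measurableType d) (R : realType) (f : T -> R[i]) z :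
  cmeasurable f -> measurable [set x | f x = z].
Proof.
move=> [mR mI].
have -> : [set x | f x = z] =
    (fun x => Re (f x)) @^-1` [set Re z] `&` (fun x => Im (f x)) @^-1` [set Im z].
  by apply/seteqP; split=> [x /= ->//|x [/= xR xI]]; exact: eq_ReIm.
apply: measurableI; rewrite -[X in measurable X]setTI.
  by apply: mR => //; exact: measurable_set1.
by apply: mI => //; exact: measurable_set1.
Qed.

Lemma full_setX d1 d2 (T1 : measurableType d1) (T2 : measurableType d2)
    (R : realType) (P : probability T1 R) (Q : probability T2 R) D1 D2 :
  measurable D1 -> measurable D2 -> P D1 = 1%E -> Q D2 = 1%E ->
  (P \x Q)%E (D1 `*` D2) = 1%E.
Proof. by move=> m1 m2 P1 Q1; rewrite product_measure1E//= P1 Q1 mule1. Qed.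

Lemma CE_preserving d (T : measurableType d) (R : realType) (P : probability T R)
    (g : T -> T) (f : T -> R[i]) : measurable_fun [set: T] g ->
  (forall A, measurable A -> P (g @^-1` A) = P A) -> bounded_measurableC f ->
  Cintegral P (fun x => f (g x)) = Cintegral P f.
Proof.
move=> mg Pg [fR fI].
have E (h : T -> R) : bounded_measurable h -> \int[P]_x h (g x) = \int[P]_x h x.
  move=> bh; rewrite /Rintegral; congr fine.
  transitivity (\int[pushforward P g]_y (EFin \o h) y)%E; last first.
    by apply: eq_measure_integral => A mA _; exact: Pg.
  rewrite (@integral_pushforward _ _ T T R g mg P setT (EFin \o h))//.
    by apply/measurable_EFinP; case: bh.
  by rewrite preimage_setT; exact: (bm_integrable P (bm_comp mg bh)).
by apply: eq_ReIm => /=; [exact: (E _ fR)|exact: (E _ fI)].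
Qed.

Lemma mulmx_col (K : pzSemiRingType) m n p (A : 'M[K]_(m, n)) (B : 'M[K]_(n, p)) j :
  A *m col j B = col j (A *m B).
Proof. by apply/colP => i; rewrite !mxE; apply: eq_bigr => k _; rewrite mxE. Qed.

Lemma mulmx_row_col (K : pzSemiRingType) m n p (A : 'M[K]_(m, n))
    (B : 'M[K]_(n, p)) i j : (row i A *m col j B) 0 0 = (A *m B) i j.
Proof. by rewrite mulmx_col -row_mul !mxE. Qed.

(** * Haar measure and uniform measure on the sphere *)

Section unit_vectors.
Context (R : realType) (d : nat).
Local Notation Cd := 'cV[R[i]]_d.

Lemma hdot_self (u : Cd) : hdot u u = (\sum_i normc (u i 0) ^+ 2)%:C.
Proof.
rewrite /hdot mxE (rmorph_sum (real_complex R)); apply: eq_bigr => i _.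
rewrite !mxE; case: (u i 0) => a b; apply: eq_ReIm => /=; last by ring.
by rewrite sqr_sqrtr ?addr_ge0 ?sqr_ge0//; ring.
Qed.

Lemma unit_entry (u : Cd) i : hdot u u = 1 -> normc (u i 0) <= 1.
Proof.
rewrite hdot_self => /complexI h; rewrite -(@ler_pXn2r _ 2)// ?nnegrE ?normc_ge0//.
rewrite expr1n -h (bigD1 i)//= lerDl sumr_ge0// => j _.
by rewrite exprn_ge0// normc_ge0.
Qed.

Definition bilin (A : 'M[R[i]]_d) (u v : Cd) : R := Re (hdot u (A *m v)).

(** A crude bound of the form on unit vectors, whose entries have modulus at most 1; only its
    independence from the vectors matters. *)
Definition bilin_bound (A : 'M[R[i]]_d) : R := \sum_i \sum_j normc (A i j).

Lemma bilin_le A u v : hdot u u = 1 -> hdot v v = 1 ->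
  `|bilin A u v| <= bilin_bound A.
Proof.
move=> u1 v1; rewrite (le_trans (normc_Re _))// /hdot mxE.
rewrite (le_trans (normc_sum _ _))// ler_sum// => i _.
rewrite !mxE mulr_sumr (le_trans (normc_sum _ _))// ler_sum// => j _.
rewrite !Normc.normcM.
have -> : normc (Num.conj (u i 0)) = normc (u i 0).
  by case: (u i 0) => a b /=; rewrite sqrrN.
rewrite mulrCA ler_piMr ?normc_ge0// mulr_ile1 ?normc_ge0//; exact: unit_entry.
Qed.

Lemma bilinZ (t : R) A u v : bilin (t%:C *: A) u v = t * bilin A u v.
Proof.
by rewrite /bilin /hdot -scalemxAl -scalemxAr mxE cReM/= mul0r subr0.
Qed.

Lemma col_unit (U : 'M[R[i]]_d) j : U \is unitarymx -> hdot (col j U) (col j U) = 1.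
Proof.
rewrite -trmxC_unitary => /unitarymxP; rewrite trmxCK => /matrixP/(_ j j).
rewrite [RHS]mxE eqxx mulr1n /hdot => <-.
by rewrite tr_col map_row mulmx_row_col.
Qed.

End unit_vectors.

(** Gram-Schmidt on a matrix all of whose rows are the transpose of [u]: the first row of the result
    is a multiple of it. *)
Lemma unitary_transitive (R : realType) d (u : 'cV[R[i]]_d.+1) : hdot u u = 1 ->
  exists2 W : 'M[R[i]]_d.+1, W \is unitarymx & col 0 W = u.
Proof.
move=> u1; pose A : 'M[R[i]]_d.+1 := \matrix_(i, j) u j 0.
have rowA : row 0 A = u^T by apply/rowP => j; rewrite !mxE.
pose B := schmidt A; have uB : B \is unitarymx by exact: schmidt_unitarymx.
have : (u^T <= row 0 B)%MS.
  rewrite -rowA (submx_trans (row_schmidt_sub _ _))//; apply/sumsmx_subP => k.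
  by rewrite leqn0 => /eqP k0; rewrite (_ : k = 0) ?genmxE//; exact: val_inj.
move=> /sub_rVP[a uaB].
(* The factor is a phase, both vectors being of norm 1; multiplying the whole matrix by it keeps it
   unitary. *)
have aa : a * Num.conj a = 1.
  move/unitarymxP/matrixP/(_ 0 0) : uB; rewrite [RHS]mxE eqxx mulr1n => B00.
  have : (u^T *m (u^T)^t*) 0 0 = 1.
    rewrite -[RHS]conjC1 -u1 /hdot !mxE rmorph_sum/=.
    by apply: eq_bigr => i _; rewrite !mxE rmorphM/= conjCK.
  rewrite uaB linearZ/= map_mxZ -scalemxAl -scalemxAr scalerA mxE.
  by rewrite tr_row map_col mulmx_row_col B00 mulr1.
exists (a *: B^T); last by apply/trmx_inj; rewrite uaB tr_col linearZ/= trmxK linearZ.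
apply/unitarymxP; move: uB; rewrite -trmx_unitary => /unitarymxP BB.
by rewrite linearZ/= map_mxZ -scalemxAl -scalemxAr scalerA BB aa scale1r.
Qed.

Section haar.
Context (R : realType) (n : nat).
Local Notation d := n.+1.
Local Notation Md := 'M[R[i]]_d.
Local Notation Cd := 'cV[R[i]]_d.
Context (H : probability Md R) (haarH : haar_unitary H).

Definition unitary_set : set Md := [set U | U \is unitarymx].

Lemma measurable_id_mx p q : measurable_mx (fun U : 'M[R[i]]_(p, q) => U).
Proof. by apply/measurable_mxE. Qed.

Lemma measurable_unitary_set : measurable unitary_set.
Proof.
have -> : unitary_set = \bigcap_(ij in [set: 'I_d * 'I_d])
    [set U | (U *m U^t*) ij.1 ij.2 = (1%:M : Md) ij.1 ij.2].
  apply/seteqP; split=> [U /unitarymxP UU [i j] _|U h] /=; first by rewrite UU.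
  by apply/unitarymxP/matrixP => i j; exact: (h (i, j)).
apply: fin_bigcap_measurable => // -[i j] _; apply: measurable_eqC.
apply: measurable_mxM; first exact: measurable_id_mx.
by apply: measurable_mx_adj; exact: measurable_id_mx.
Qed.

Lemma measurable_mulmx p q (W : 'M[R[i]]_p) :
  measurable_fun [set: 'M[R[i]]_(p, q)] (fun U => W *m U).
Proof.
apply/measurable_mxE/measurable_mxM; first exact: measurable_mx_cst.
exact: measurable_id_mx.
Qed.

Lemma measurable_mulmxr p q (W : 'M[R[i]]_q) :
  measurable_fun [set: 'M[R[i]]_(p, q)] (fun U => U *m W).
Proof.
apply/measurable_mxE/measurable_mxM; last exact: measurable_mx_cst.
exact: measurable_id_mx.
Qed.

Lemma measurable_col j : measurable_fun [set: Md] (fun U : Md => col j U).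
Proof.
apply/measurable_mxE => i k; under eq_fun do rewrite mxE.
exact: measurable_id_mx.
Qed.

Lemma measurable_adj : measurable_fun [set: Md] (fun U : Md => U^t*).
Proof. by apply/measurable_mxE/measurable_mx_adj; exact: measurable_id_mx. Qed.

Lemma haar_left (W : Md) (f : Md -> R[i]) : W \is unitarymx ->
  bounded_measurableC f -> Cintegral H (fun U => f (W *m U)) = Cintegral H f.
Proof.
move=> uW; apply: CE_preserving; first exact: measurable_mulmx.
by move=> A mA; have [] := haarH.2 W uW A mA.
Qed.

Lemma haar_right (W : Md) (f : Md -> R[i]) : W \is unitarymx ->
  bounded_measurableC f -> Cintegral H (fun U => f (U *m W)) = Cintegral H f.
Proof.
move=> uW; apply: CE_preserving; first exact: measurable_mulmxr.
by move=> A mA; have [] := haarH.2 W uW A mA.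
Qed.

Lemma measurable_sphere : measurable [set u : Cd | hdot u u = 1].
Proof.
apply: measurable_eqC; apply: measurable_mxM; last exact: measurable_id_mx.
by apply: measurable_mx_adj; exact: measurable_id_mx.
Qed.

(* Averaging over [W] of law [H] turns the invariant law of [X] into that of
   [W x], [x] being any point of the sphere: all invariant laws agree. *)
Lemma sphere_average dO (O : measurableType dO) (P : probability O R) (X : O -> Cd)
    (D : set O) (f : Cd -> R[i]) :
  measurable D -> P D = 1%E -> measurable_fun [set: O] X ->
  (forall w, D w -> hdot (X w) (X w) = 1) ->
  (forall W : Md, W \is unitarymx ->
    Cintegral P (fun w => f (W *m X w)) = Cintegral P (fun w => f (X w))) ->
  bounded_measurableC f ->
  Cintegral P (fun w => f (X w)) = Cintegral H (fun U => f (col 0 U)).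
Proof.
move=> mD PD mX X1 Xinv bf.
have bWX : bounded_measurableC (fun p : Md * O => f (p.1 *m X p.2)).
  apply: bmC_comp bf; apply/measurable_mxE/measurable_mxM.
    by apply/measurable_mxE; exact: measurable_fst.
  by apply/measurable_mxE; apply: (measurableT_comp mX); exact: measurable_snd.
have b0 : bounded_measurableC (fun U : Md => f (col 0 U)).
  exact: bmC_comp (measurable_col 0) bf.
transitivity (Cintegral H (fun W => Cintegral P (fun w => f (W *m X w)))).
  rewrite -[LHS](CE_cst H).
  have [mR mI] := bmC_mC (bmC_param1 H P bWX).
  apply: (CE_eq_full measurable_unitary_set haarH.1) => // W uW.
  by rewrite Xinv.
rewrite -(CE_fubini1 H P bWX) (CE_fubini2 H P bWX).
rewrite -[RHS](CE_cst P).
have [mR mI] := bmC_mC (bmC_param2 H P bWX).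
apply: (CE_eq_full mD PD) => // w Dw.
(* With the point of the sphere written as the first column of a unitary matrix, right invariance of
   [H] absorbs that matrix. *)
have [W uW XW] := unitary_transitive (X1 w Dw).
rewrite -(haar_right uW b0); apply: CE_ext => U.
by rewrite /= -XW mulmx_col.
Qed.

Lemma col_average j (f : Cd -> R[i]) : bounded_measurableC f ->
  Cintegral H (fun U => f (col j U)) = Cintegral H (fun U => f (col 0 U)).
Proof.
move=> bf; apply: (sphere_average measurable_unitary_set haarH.1) => //.
- exact: measurable_col.
- by move=> U; exact: col_unit.
move=> W uW; have bj := bmC_comp (measurable_col j) bf.
by rewrite -(haar_left uW bj); apply: CE_ext => U; rewrite mulmx_col.
Qed.

Lemma coladj_average j (f : Cd -> R[i]) : bounded_measurableC f ->
  Cintegral H (fun V => f (col j (V^t*))) = Cintegral H (fun U => f (col 0 U)).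
Proof.
move=> bf.
have mcol : measurable_fun [set: Md] (fun V : Md => col j (V^t*)).
  exact: measurableT_comp (measurable_col j) measurable_adj.
apply: (sphere_average measurable_unitary_set haarH.1) => //.
- by move=> U uU; apply: col_unit; rewrite trmxC_unitary.
move=> W uW; have bj := bmC_comp mcol bf.
have uW' : W^t* \is unitarymx by rewrite trmxC_unitary.
rewrite -(haar_right uW' bj); apply: CE_ext => V.
by rewrite mulmx_col trmx_mul map_mxM trmxCK.
Qed.

Lemma sigma_average (sigma : probability Cd R) (f : Cd -> R[i]) :
  uniform_sphere sigma -> bounded_measurableC f ->
  Cintegral sigma f = Cintegral H (fun U => f (col 0 U)).
Proof.
move=> [s1 sinv] bf.
apply: (@sphere_average _ _ sigma id _ f measurable_sphere s1) => //.
move=> W uW; apply: CE_preserving => //; first exact: measurable_mulmx.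
by move=> A mA; exact: sinv.
Qed.

(** The coefficient of [X_j] in the linear form of [A] at [U diag(X) V], written with columns so
    that the averages over the sphere apply; [hcoefE] is the diagonal entry that comes out of the
    trace. *)
Definition hcoef (A : Md) (j : 'I_d) (p : Md * Md) : R :=
  bilin A (col j p.1) (col j (p.2^t*)).

Lemma hcoefE A j p : hcoef A j p = Re ((p.2 *m A^t* *m p.1) j j).
Proof.
rewrite /hcoef /bilin /hdot mulmx_col tr_col map_row mulmx_row_col.
rewrite -[RHS]cRe_conj; congr Re.
have -> : p.1^t* *m (A *m p.2^t*) = (p.2 *m A^t* *m p.1)^t*.
  by rewrite !trmx_mul !map_mxM trmxCK.
by rewrite !mxE.
Qed.

Lemma measurable_bilin A :
  measurable_fun [set: Cd * Cd] (fun p => bilin A p.1 p.2).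
Proof.
have : cmeasurable (fun p : Cd * Cd => (p.1^t* *m (A *m p.2)) 0 0).
  apply: measurable_mxM.
    by apply: measurable_mx_adj; by apply/measurable_mxE; exact: measurable_fst.
  apply: measurable_mxM; first exact: measurable_mx_cst.
  by apply/measurable_mxE; exact: measurable_snd.
by case.
Qed.

Lemma measurable_hcols j :
  measurable_fun [set: Md * Md] (fun p => (col j p.1, col j (p.2^t*))).
Proof.
apply/measurable_fun_pairP; split.
  exact: measurableT_comp (measurable_col j) measurable_fst.
apply: measurableT_comp (measurable_col j) _.
exact: measurableT_comp measurable_adj measurable_snd.
Qed.

Lemma measurable_hcoef A j : measurable_fun [set: Md * Md] (hcoef A j).
Proof. exact: measurableT_comp (measurable_bilin A) (measurable_hcols j). Qed.

Definition unitary_pairs : set (Md * Md) := unitary_set `*` unitary_set.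

Lemma measurable_unitary_pairs : measurable unitary_pairs.
Proof. by apply: measurableX; exact: measurable_unitary_set. Qed.

Lemma unitary_pairs_full : (H \x H)%E unitary_pairs = 1%E.
Proof.
by apply: full_setX haarH.1 haarH.1; exact: measurable_unitary_set.
Qed.

Lemma hcoef_le A j p : unitary_pairs p -> `|hcoef A j p| <= bilin_bound A.
Proof.
move=> [u1 u2]; apply: bilin_le; apply: col_unit; first exact: u1.
by rewrite trmxC_unitary; exact: u2.
Qed.

(* The exponent of the limit law, with the two uniform vectors realised as the
   columns of [U] and of [V^*]. *)
Definition haar_exponent (psi : R -> R[i]) (A : Md) : R[i] :=
  Cintegral (H \x H)%E (fun p => \sum_j psi (hcoef A j p)).

(** Makes [psi] bounded, as the Fubini lemmas require, without changing it on the values taken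
    almost surely. *)
Definition clip (T t : R) : R := Num.max (- T) (Num.min t T).

Lemma clip_id T t : `|t| <= T -> clip T t = t.
Proof. by rewrite ler_norml => /andP[t1 t2]; rewrite /clip min_l// max_r. Qed.

Lemma clip_le T t : 0 <= T -> `|clip T t| <= T.
Proof.
move=> T0; rewrite ler_norml /clip le_max lexx/= ge_max ge_min lexx orbT andbT.
by rewrite (le_trans _ T0)// oppr_le0.
Qed.

Lemma measurable_clip T : measurable_fun [set: R] (clip T).
Proof. by apply: measurable_maxr => //; apply: measurable_minr. Qed.

(** The [d] summands are not independent, but linearity asks only for their individual laws: each is
    that of the form at two independent uniform vectors. Hence the factor [d]. *)
Lemma haar_exponent_sphere (psi : R -> R[i]) (sigma : probability Cd R) A :
  ccontinuous psi -> uniform_sphere sigma ->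
  haar_exponent psi A = Cintegral (sigma \x sigma)%E
    (fun uv => d%:R * psi (Re (hdot uv.1 (A *m uv.2)))).
Proof.
move=> cpsi us; set T := bilin_bound A.
have T0 : 0 <= T by rewrite sumr_ge0// => i _; rewrite sumr_ge0// => j _; exact: normc_ge0.
have mpsi := mC_ccontinuous cpsi.
pose F (uv : Cd * Cd) := psi (clip T (bilin A uv.1 uv.2)).
have bF : bounded_measurableC F.
  have [B hB] := ccontinuous_bounded T cpsi.
  have [mR mI] : cmeasurable F.
    apply: (mC_comp _ mpsi); apply: measurableT_comp (measurable_clip T) _.
    exact: measurable_bilin.
  by apply: (bmC_le mR mI) => uv; apply: hB; exact: clip_le.
have [mF _] := bF.
pose G v := Cintegral H (fun U => F (col 0 U, v)).
have bG : bounded_measurableC G.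
  have b0 : bounded_measurableC (fun p : Md * Cd => F (col 0 p.1, p.2)).
    apply: (bmC_comp _ bF); apply/measurable_fun_pairP; split => /=.
      exact: measurableT_comp (measurable_col 0) measurable_fst.
    exact: measurable_snd.
  by have := bmC_param2 H sigma b0.
pose c := Cintegral H (fun U => G (col 0 U)).
have sigmaE : Cintegral (sigma \x sigma)%E F = c.
  transitivity (Cintegral sigma G); last exact: sigma_average.
  rewrite (CE_fubini2 _ _ bF); apply: CE_ext => v.
  exact: (sigma_average us (bmC_slice2 bF v)).
have bFj j : bounded_measurableC (fun p : Md * Md => F (col j p.1, col j (p.2^t*))).
  exact: bmC_comp (measurable_hcols j) bF.
have HE j : Cintegral (H \x H)%E (fun p => F (col j p.1, col j (p.2^t*))) = c.
  transitivity (Cintegral H (fun V => G (col j (V^t*)))); last exact: coladj_average.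
  rewrite (CE_fubini2 _ _ (bFj j)); apply: CE_ext => V.
  exact: (col_average j (bmC_slice2 bF (col j (V^t*)))).
transitivity (d%:R * c).
  rewrite (_ : haar_exponent psi A = Cintegral (H \x H)%E
      (fun p => \sum_j F (col j p.1, col j (p.2^t*)))).
    rewrite CE_sum; last exact: bFj.
    by rewrite (eq_bigr (fun=> c)) ?sumr_const ?card_ord ?mulr_natl// => j _; exact: HE.
  have [mR mI] : cmeasurable (fun p => \sum_j psi (hcoef A j p)).
    apply: mC_sum => j; apply: (mC_comp _ mpsi); exact: measurable_hcoef.
  have [mR' mI'] := bmC_mC (bmC_sum (index_enum 'I_d) bFj).
  apply: (CE_eq_full measurable_unitary_pairs unitary_pairs_full) => // p up.
  by apply: eq_bigr => j _; rewrite /F/= clip_id//; exact: hcoef_le.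
rewrite -sigmaE -CE_Z//.
have [mR mI] : cmeasurable (fun uv : Cd * Cd => d%:R * psi (bilin A uv.1 uv.2)).
  apply: mCM; first exact: mC_cst.
  by apply: (mC_comp _ mpsi); exact: measurable_bilin.
have [mR' mI'] : cmeasurable (fun uv => d%:R * F uv).
  by apply: mCM; [exact: mC_cst|exact: bmC_mC].
apply: (CE_eq_full (measurableX measurable_sphere measurable_sphere)
  (full_setX measurable_sphere measurable_sphere us.1 us.1)) => // uv [/= u1 v1].
by rewrite /F clip_id//; exact: bilin_le.
Qed.

End haar.

(** * Fourier transform of the matrix laws *)

Section trace_form.
Context (R : realType) (d : nat).
Local Notation Md := 'M[R[i]]_d.

Definition trform (A M : Md) : R := Re (\tr (A^t* *m M)).

Lemma measurable_trform A : measurable_fun [set: Md] (trform A).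
Proof.
have : cmeasurable (fun M : Md => \tr (A^t* *m M)).
  apply: mC_sum => i; apply: measurable_mxM; first exact: measurable_mx_cst.
  exact: measurable_id_mx.
by case.
Qed.

Lemma trformD A M N : trform A (M + N) = trform A M + trform A N.
Proof. by rewrite /trform mulmxDr mxtraceD cReD. Qed.

Lemma trform0 A : trform A 0 = 0.
Proof. by rewrite /trform mulmx0 mxtrace0. Qed.

Lemma trformZl (t : R) A M : trform (t%:C *: A) M = t * trform A M.
Proof.
rewrite /trform linearZ/= map_mxZ/= -scalemxAl mxtraceZ cReM cRe_conj cIm_conj/=.
by rewrite oppr0 mul0r subr0.
Qed.

Lemma trform_UdiagV A (U V : Md) (x : d.-tuple R) :
  trform A (UdiagV (U, x, V)) =
  \sum_j Re ((V *m A^t* *m U) j j) * tnth x j.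
Proof.
rewrite /trform /UdiagV/= mulmxA mxtrace_mulC !mulmxA /mxtrace.
have raddRe : {morph (@complex.Re R) : x y / x + y >-> x + y} by exact: cReD.
rewrite (big_morph _ raddRe (erefl : Re 0 = 0)); apply: eq_bigr => j _.
by rewrite mul_mx_diag !mxE cReM/= mulr0 subr0.
Qed.

End trace_form.

Section fourier_K_law.
Context (R : realType) (n : nat).
Local Notation d := n.+1.
Local Notation Md := 'M[R[i]]_d.
Context (H : probability Md R) (haarH : haar_unitary H).

Lemma bmC_chf_hcoef (mu : probability R R) A j :
  bounded_measurableC (fun p : Md * Md => chf mu (hcoef A j p)).
Proof.
have [mR mI] := mC_comp (measurable_hcoef A j) (mC_ccontinuous (@chf_continuous R mu)).
by apply: (bmC_le mR mI) => p; exact: normc_chf.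
Qed.

Lemma fourier_K_law (mu : probability R R) (A : Md) :
  cf (K_law H mu) (trform A) =
  Cintegral (H \x H)%E (fun p => \prod_j chf mu (hcoef A j p)).
Proof.
pose f (q : Md * d.-tuple R * Md) :=
  \prod_j expi (hcoef A j (q.1.1, q.2) * tnth q.1.2 j).
have bf : bounded_measurableC f.
  apply: bmC_prod => j; apply: bmC_expi; apply: measurable_funM.
    apply: (measurableT_comp (measurable_hcoef A j)).
    apply/measurable_fun_pairP; split => /=; last exact: measurable_snd.
    exact: measurableT_comp measurable_fst measurable_fst.
  apply: (measurableT_comp (measurable_tnth j)).
  exact: measurableT_comp measurable_snd measurable_fst.
transitivity (Cintegral ((H \x iid_law mu d) \x H)%E f).
  rewrite /cf /K_law CE_distribution; last first.
    by apply: bmC_expi; exact: measurable_trform.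
  apply: CE_ext => -[[U x] V]; rewrite trform_UdiagV.
  rewrite (big_morph _ (@expiD R) (@expi0 R)); apply: eq_bigr => j _.
  by rewrite hcoefE.
rewrite (CE_fubini2 _ _ bf) (CE_fubini2 _ _ (bmC_prod _ (bmC_chf_hcoef mu A))).
apply: CE_ext => V.
rewrite (CE_fubini1 _ _ (bmC_slice2 bf V)); apply: CE_ext => U.
rewrite /f /= (CE_iid mu (g := fun j t => expi (hcoef A j (U, V) * t)))//.
by move=> j; apply: bmC_expi; exact: measurable_scale.
Qed.

Context (mu : probability R R) (psi : R -> R[i]).
Hypotheses (cpsi : ccontinuous psi) (psi0 : psi 0 = 0).
Hypothesis psiE : forall t, chf mu t = cexp (psi t).

Lemma cmeasurable_exponent A :
  cmeasurable (fun p : Md * Md => \sum_j psi (hcoef A j p)).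
Proof.
apply: mC_sum => j; apply: (mC_comp _ (mC_ccontinuous cpsi)).
exact: measurable_hcoef.
Qed.

Lemma fourier_conv_pow_cvg (mu_ : nat -> probability R R) (k : nat -> nat) A :
  k n @[n --> \oo] --> \oo ->
  weak_cvg (fun n => real_conv_pow (mu_ n) (k n)) mu ->
  ccvg \oo (fun n => cf (mx_conv_pow (K_law H (mu_ n)) (k n)) (trform A))
    (cexp (haar_exponent H psi A)).
Proof.
move=> koo mucv.
apply: (ccvg_eq (u := fun n => cf (K_law H (mu_ n)) (trform A) ^+ k n)).
  move=> m; rewrite [RHS]cf_convolution_pow//.
  - exact: measurable_trform.
  - exact: trform0.
  - by move=> p; exact: trformD.
apply: exp_limit => // [m|]; first by apply: normc_cf; exact: measurable_trform.
have bP m := bmC_prod (index_enum 'I_d) (bmC_chf_hcoef (mu_ m) A).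
apply: (ccvg_eq (u := fun m => Cintegral (H \x H)%E
    (fun p => (k m)%:R * (\prod_j chf (mu_ m) (hcoef A j p) - 1)))).
  move=> m; rewrite CE_Z; last by apply: bmCB => //; exact: bmC_cst.
  by rewrite CE_B ?CE_cst ?fourier_K_law//; exact: bmC_cst.
(* On unitary pairs all coefficients lie in [[- bilin_bound A, bilin_bound A]], and each of the [d]
   factors contributes at most [C]. *)
have [C hC] := levy_bounded cpsi psi0 psiE koo mucv (bilin_bound A).
apply: (@mC_dct _ _ _ _ (@unitary_pairs R n) _ _ (\sum_(j < d) C)).
- exact: measurable_unitary_pairs.
- exact: unitary_pairs_full.
- move=> m; apply: bmC_mC; apply: bmCM; first exact: bmC_cst.
  by apply: bmCB => //; exact: bmC_cst.
- exact: cmeasurable_exponent.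
- apply: filterS hC => m hC p up; rewrite Normc.normcM normc_nat.
  rewrite (le_trans (ler_wpM2l _ (normc_prod_sub1 _ _)))//.
    by move=> j; exact: normc_chf.
  rewrite mulr_sumr ler_sum// => j _.
  by rewrite -[X in X * _]normc_nat -Normc.normcM hC//; exact: hcoef_le.
move=> p up; apply: prod_sub1_cvg => // j.
exact: (levy_cvg cpsi psi0 psiE koo mucv).
Qed.

Lemma haar_exponent_small A (e : R) : 0 < e -> exists2 h, 0 < h &
  forall t : R, `|t| <= h -> normc (haar_exponent H psi (t%:C *: A)) <= e.
Proof.
move=> e0; set T := bilin_bound A.
have T0 : 0 <= T by rewrite sumr_ge0// => i _; rewrite sumr_ge0// => j _; exact: normc_ge0.
have ed : 0 < e / d%:R by rewrite divr_gt0.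
have : nbhs (0 : R) [set s | normc (psi s - psi 0) <= e / d%:R].
  by have /ccvgP := cpsi 0; apply.
move=> /nbhs_ballP[h h0 hpsi].
have T1 : 0 < T + 1 by rewrite ltr_wpDl.
(* [T] may be 0, hence [T + 1]; the factor 2 gives the strict inequality of the open ball. *)
exists (h / (2 * (T + 1))); first by rewrite !divr_gt0// mulr_gt0.
move=> t th; rewrite /haar_exponent; apply: (@mC_bounded _ _ R (H \x H)%E (@unitary_pairs R n)).
- exact: measurable_unitary_pairs.
- exact: unitary_pairs_full.
- exact: cmeasurable_exponent.
move=> p up; rewrite (le_trans (normc_sum _ _))//.
have -> : e = \sum_(j < d) (e / d%:R).
  by rewrite sumr_const card_ord -[RHS]mulr_natr divfK// pnatr_eq0.
apply: ler_sum => j _; rewrite -[psi _]subr0 -psi0; apply: hpsi.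
rewrite /ball/= sub0r normrN /hcoef bilinZ normrM.
have h1 := hcoef_le A j up.
rewrite (@le_lt_trans _ _ (h / (2 * (T + 1)) * T))// ?ler_pM//.
rewrite mulrAC ltr_pdivrMr ?mulr_gt0//.
by have := mulr_ge0 (ltW h0) T0; move: h0 => /= h0; nra.
Qed.

End fourier_K_law.

(** * Tightness from Fourier transforms *)

Section uniform_average.
Context (R : realType) (h : R) (h0 : 0 < h).

Local Notation rho := (uniform_prob h0).

Lemma uniform_full : rho `[0, h] = 1%E.
Proof. by rewrite /= /uniform_prob integral_uniform_pdf1. Qed.

Lemma uniform_average_cos (x : R) : x != 0 ->
  \int[rho]_t (1 - cos (t * x)) = 1 - sin (h * x) / (h * x).
Proof.
move=> x0; pose F t : R := t - sin (t * x) / x.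
have dF (t : R) : is_derive t (1 : R) F (1 - cos (t * x)).
  have dg : is_derive t (1 : R) (fun u : R => u * x) x.
    by apply: is_derive_eq; rewrite scaler0 add0r /GRing.scale/= mulr1.
  rewrite /F; apply: is_derive_eq. 
  by rewrite /GRing.scale/= mulr0 add0r mulrCA mulVf// mulr1.
have cf : continuous (fun t : R => 1 - cos (t * x)).
  move=> t; apply: cvgB; first exact: cvg_cst.
  apply: continuous_comp; last exact: continuous_cos.
  by apply: cvgM; [exact: cvg_id|exact: cvg_cst].
have mf : measurable_fun [set: R] (fun t : R => 1 - cos (t * x)).
  exact: continuous_measurable_fun.
rewrite /Rintegral integral_uniform; last 2 first.
- exact/measurable_EFinP.
- by move=> t; rewrite lee_fin onemcos_ge0.
rewrite (@continuous_FTC2 _ _ F)//.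
- rewrite subr0 /F mul0r sin0 mul0r !subr0 -EFinD -EFinM/=.
  by field; rewrite x0 gt_eqF.
- exact: continuous_subspaceT.
- split => [t _||].
  + by have [] := dF t.
  + apply: cvg_at_right_filter; apply: differentiable_continuous.
    by apply/derivable1_diffP; have [] := dF 0.
  + apply: cvg_at_left_filter; apply: differentiable_continuous.
    by apply/derivable1_diffP; have [] := dF h.
by move=> t _; rewrite derive1E; have [_ ->] := dF t.
Qed.

End uniform_average.

Section tightness.
Context d (T : measurableType d) (R : realType).
Implicit Types (P : probability T R) (l : T -> R).
Local Notation RL := (measurableTypeR R).

Definition tail l (r : R) : set T := [set x | r <= `|l x|].

Lemma measurable_tail l r : measurable_fun [set: T] l -> measurable (tail l r).
Proof.
move=> ml; rewrite -[tail l r]setTI.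
exact: (measurable_fun_ler (measurable_cst r) (measurableT_comp (@normr_measurable R setT) ml) measurableT).
Qed.

Lemma measurable_phase l : measurable_fun [set: T] l ->
  measurable_fun [set: T * RL] (fun z => (z.2 : R) * l z.1).
Proof.
move=> ml; apply: measurable_funM; first exact: measurable_snd.
exact: measurableT_comp ml measurable_fst.
Qed.

(** The average of [1 - cos (t * l x)] over [t] in [[0, h]] is nonnegative, and equals
    [1 - sin y / y] with [y = h * l x], which is at least 1/2 once [|y| >= 2]. Fubini exchanges this
    average with the law [P]. *)
Lemma tail_le P l (h : R) (h0 : 0 < h) : measurable_fun [set: T] l ->
  \int[P]_x \1_(tail l (2 / h)) x <=
  2 * normc (Cintegral (uniform_prob h0) (fun t : RL => cf P (fun x => t * l x) - 1)).
Proof.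
move=> ml; set Z := Cintegral _ _.
pose g (z : T * RL) : R[i] := expi (z.2 * l z.1) - 1.
have be : bounded_measurableC (fun z : T * RL => expi ((z.2 : R) * l z.1)).
  by apply: bmC_expi; exact: measurable_phase.
have bg : bounded_measurableC g by apply: bmCB => //; exact: bmC_cst.
have ZE : Z = Cintegral P (fun x => Cintegral (uniform_prob h0) (fun t : RL => g (x, t))).
  rewrite -CE_fubini1// CE_fubini2//; apply: CE_ext => t.
  rewrite CE_B ?CE_cst//; last exact: bmC_cst.
  exact: (bmC_slice2 be t).
have bG := bmC_param1 P (uniform_prob h0) bg.
have h1 : - Re Z <= normc Z.
  by rewrite (le_trans (ler_norm _))// normrN normc_Re.
rewrite (le_trans _ (ler_wpM2l _ h1))// ZE /= -E_N; last by case: bG.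
rewrite -E_Z; last by apply: bmN; case: bG.
apply: E_le => [||x].
- exact/bm_indic/measurable_tail.
- by apply/bmZ/bmN; case: bG.
have bc : bounded_measurable (fun t : RL => Re (g (x, t))) by have [] := bmC_slice1 bg x.
rewrite -E_N//.
rewrite (_ : (fun t : RL => - Re (g (x, t))) = (fun t : RL => 1 - cos ((t : R) * l x))); last first.
  by apply/funext => t; rewrite /g cReD cReN expiE/= opprB.
rewrite indicE; have [xA|_] := boolP (x \in tail _ _); last first.
  by rewrite mulr_ge0// Rintegral_ge0// => t _; exact: onemcos_ge0.
move: xA; rewrite inE /tail/= ler_pdivrMr// => hl.
have l0 : l x != 0.
  by apply/eqP => l0; move: hl; rewrite l0 normr0 mul0r; lra.
rewrite uniform_average_cos//.
have hl2 : 2 <= `|h * l x| by rewrite normrM (gtr0_norm h0) mulrC.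
have : sin (h * l x) / (h * l x) <= 1 / 2; last by lra.
rewrite (le_trans (ler_norm _))// normrM normfV ler_pdivrMr; last first.
  by rewrite (lt_le_trans _ hl2).
by have := sin_max (h * l x); lra.
Qed.

Lemma tight_of_cf (P_ : nat -> probability T R) l (Phi : R -> R[i]) :
  measurable_fun [set: T] l ->
  (forall t, ccvg \oo (fun n => cf (P_ n) (fun x => t * l x)) (Phi t)) ->
  (forall e : R, 0 < e ->
     exists2 h, 0 < h & forall t, `|t| <= h -> normc (Phi t - 1) <= e) ->
  forall e : R, 0 < e -> exists2 r, 0 < r &
    \forall n \near \oo, \int[P_ n]_x \1_(tail l r) x <= e.
Proof.
move=> ml cv Phi0 e e0.
(* [e / 4] for the limit and [e / 4] for the distance to it, doubled by [tail_le]. *)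
have [h h0 hPhi] := Phi0 (e / 4) (divr_gt0 e0 (ltr0Sn _ 3)).
exists (2 / h); first by rewrite divr_gt0.
have bcf n : bounded_measurableC (fun t : RL => cf (P_ n) (fun x => (t : R) * l x)).
  have b := bmC_expi (measurable_phase ml).
  exact: (bmC_param2 (P_ n) (uniform_prob h0) b).
(* Only the behaviour of [Phi] at 0 is assumed; measurability comes from being a pointwise limit. *)
have mPhi : cmeasurable (fun t : RL => Phi t).
  split.
    apply: (@measurable_fun_cvg _ _ _ setT
      (fun n (t : RL) => Re (cf (P_ n) (fun x => (t : R) * l x)))).
      by move=> n; have [[]] := bcf n.
    by move=> t _; have [] := cv t.
  apply: (@measurable_fun_cvg _ _ _ setT
    (fun n (t : RL) => Im (cf (P_ n) (fun x => (t : R) * l x)))).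
    by move=> n; have [_ []] := bcf n.
  by move=> t _; have [] := cv t.
pose Z n := Cintegral (uniform_prob h0) (fun t : RL => cf (P_ n) (fun x => (t : R) * l x) - 1).
pose Z0 := Cintegral (uniform_prob h0) (fun t : RL => Phi t - 1).
have mPhi1 : cmeasurable (fun t : RL => Phi t - 1) by apply: mCD mPhi (mC_cst _ _).
have mI : measurable (`[0, h]%classic : set RL) by exact: measurable_itv.
have full : uniform_prob h0 (`[0, h]%classic : set RL) = 1%E by exact: uniform_full.
have Zcv : ccvg \oo Z Z0.
  apply: (@mC_dct _ _ _ (uniform_prob h0) (`[0, h]%classic : set RL) _ _ 2) => //.
  - by move=> n; apply: bmC_mC; apply: bmCB => //; exact: bmC_cst.
  - apply: nearW => n t _; rewrite (le_trans (le_normcB _ _))// Normc.normc1.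
    have := @normc_cf R _ _ (P_ n) (fun x => (t : R) * l x) (measurable_funM (measurable_cst _) ml).
    by lra.
  - by move=> t _; apply: ccvgB => //; exact: ccvg_cst.
have Z0e : normc Z0 <= e / 4.
  apply: (mC_bounded mI full mPhi1) => t /=; rewrite in_itv/= => /andP[t0 th].
  by apply: hPhi; rewrite ger0_norm.
have /ccvgP/(_ (e / 4)) := Zcv; rewrite divr_gt0// => /(_ isT).
apply: filterS => n hn; rewrite (le_trans (tail_le _ h0 ml))//.
have := le_normcD (Z n - Z0) Z0; rewrite subrK -/(Z n); lra.
Qed.

End tightness.

(** * Prokhorov's theorem along an ultrafilter *)

Section matrix_coordinates.
Context (R : realType) (m p : nat).
Local Notation M := 'M[R[i]]_(m, p).

Definition coord_index : finType := ('I_m * 'I_p * bool)%type.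

Definition mxcoord (c : coord_index) (x : M) : R :=
  if c.2 then Im (x c.1.1 c.1.2) else Re (x c.1.1 c.1.2).

Definition mkmx (y : coord_index -> R) : M :=
  \matrix_(i, j) (y (i, j, false) +i* y (i, j, true)).

Lemma mxcoord_mkmx c y : mxcoord c (mkmx y) = y c.
Proof. by case: c => [[i j] []]; rewrite /mxcoord/= mxE. Qed.

Lemma measurable_mxcoord c : measurable_fun [set: M] (mxcoord c).
Proof.
by case: c => [[i j] []]; [exact: measurable_mx_Im|exact: measurable_mx_Re].
Qed.

Lemma measurable_mkmx d (T : measurableType d) (X : T -> coord_index -> R) :
  (forall c, measurable_fun [set: T] (fun t => X t c)) ->
  measurable_fun [set: T] (fun t => mkmx (X t)).
Proof.
move=> mX; apply: measurable_fun_mxP => i j.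
by split; under eq_fun do rewrite mxE/=;
  [exact: (mX (i, j, false))|exact: (mX (i, j, true))].
Qed.

Lemma continuous_coord (f : M -> R) (x : M) (e : R) : continuous f -> 0 < e ->
  exists2 h, 0 < h & forall y,
    (forall c, `|mxcoord c x - mxcoord c y| < h) -> `|f x - f y| < e.
Proof.
move=> cf e0.
have : nbhs x [set y | `|f x - f y| < e].
  by have /cvgrPdist_lt := cf x; exact.
move=> /nbhs_mx_box[h h0 hU]; exists h => // y hy; apply: hU => i j.
by split; [exact: (hy (i, j, false))|exact: (hy (i, j, true))].
Qed.

(** Bad pairs at scale [1 / n.+1] would have the same limit along an ultrafilter, where [f] is
    continuous. Only [x] is confined to the box: [y] is a sample point or an interpolation node,
    possibly outside. *)
Lemma continuous_uniform_on_box (f : M -> R) (N e : R) : continuous f -> 0 < e ->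
  exists2 h, 0 < h & forall x y, (forall c, `|mxcoord c x| <= N) ->
    (forall c, `|mxcoord c x - mxcoord c y| <= h) -> `|f x - f y| <= e.
Proof.
move=> cf e0; apply: contrapT => nh.
have bad n : exists xy : M * M, [/\ forall c, `|mxcoord c xy.1| <= N,
    forall c, `|mxcoord c xy.1 - mxcoord c xy.2| <= n.+1%:R^-1 &
    e < `|f xy.1 - f xy.2|].
  apply: contrapT => nb; apply: nh; exists n.+1%:R^-1; first by rewrite invr_gt0.
  move=> x y xN xy; rewrite leNgt; apply/negP => exy; apply: nb.
  by exists (x, y).
pose u n := sval (cid (bad n)).
have uP n : [/\ forall c, `|mxcoord c (u n).1| <= N,
    forall c, `|mxcoord c (u n).1 - mxcoord c (u n).2| <= n.+1%:R^-1 &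
    e < `|f (u n).1 - f (u n).2|] by rewrite /u; case: cid.
have [U [UU Uoo]] := ultraFilterLemma (_ : ProperFilter \oo).
have lim c : exists l : R, mxcoord c (u n).1 @[n --> U] --> l.
  by apply: (@ultralimit_exists R U UU _ N); apply: nearW => n; have [] := uP n.
pose z c := sval (cid (lim c)).
have zP c : mxcoord c (u n).1 @[n --> U] --> z c by rewrite /z; case: cid.
have e20 : 0 < e / 2 by rewrite divr_gt0.
have [h h0 hf] := continuous_coord (mkmx z) cf e20.
have h20 : 0 < h / 2 by rewrite divr_gt0.
have near1 : \forall n \near U, forall c, `|z c - mxcoord c (u n).1| < h / 2.
  by apply: filter_forall => c; have /cvgrPdist_lt/(_ _ h20) := zP c.
have near2 : \forall n \near U, (n.+1%:R^-1 : R) < h / 2.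
  apply: Uoo; have /cvgrPdist_lt/(_ _ h20) := @cvg_harmonic R.
  by apply: filterS => n; rewrite sub0r normrN => h'; rewrite (le_lt_trans (ler_norm _)).
have [n [n1 n2]] := @filter_ex _ U _ _ (filterI near1 near2).
have [_ un2] := uP n; apply/negP; rewrite -leNgt.
have -> : f (u n).1 - f (u n).2 =
  (f (mkmx z) - f (u n).2) - (f (mkmx z) - f (u n).1) by ring.
rewrite (le_trans (ler_normB _ _))// [e]splitr lerD// ltW// hf// => c;
  rewrite mxcoord_mkmx.
  rewrite -(subrK (mxcoord c (u n).1) (z c)) -addrA (le_lt_trans (ler_normD _ _))//.
  by rewrite [h]splitr ltrD ?n1// (le_lt_trans (un2 c)).
by rewrite (lt_trans (n1 c))// ltr_pdivrMr// ltr_pMr// ltr1n.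
Qed.

End matrix_coordinates.

Section ultralimit_functional.
Context d (T : measurableType d) (R : realType).
Context (U : set_system nat) (UU : UltraFilter U) (P_ : nat -> probability T R).
Implicit Types f g : T -> R.

(* A positive linear functional, but not yet a measure: only finite additivity
   survives the limit along [U]. *)
Definition ulim f : R := lim (\int[P_ n]_x f x @[n --> U]).

Lemma ulimP f : bounded_measurable f -> \int[P_ n]_x f x @[n --> U] --> ulim f.
Proof.
move=> bf; have [_ [C fC]] := bf.
have [|l ul] := @ultralimit_exists R U UU (fun n => \int[P_ n]_x f x) C.
  by apply: nearW => n; exact: E_bound.
by rewrite /ulim (cvg_lim _ ul).
Qed.

Lemma ulim_eq f (l : R) : \int[P_ n]_x f x @[n --> U] --> l -> ulim f = l.
Proof. by move=> ?; apply: cvg_lim. Qed.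

Lemma ulim_cst (c : R) : ulim (fun=> c) = c.
Proof.
by apply: ulim_eq; under eq_fun do rewrite E_cst; exact: cvg_cst.
Qed.

Lemma ulimD f g : bounded_measurable f -> bounded_measurable g ->
  ulim (fun x => f x + g x) = ulim f + ulim g.
Proof.
move=> bf bg; apply: ulim_eq; under eq_fun do rewrite E_D//.
by apply: cvgD; exact: ulimP.
Qed.

Lemma ulimZ (c : R) f : bounded_measurable f ->
  ulim (fun x => c * f x) = c * ulim f.
Proof.
move=> bf; apply: ulim_eq; under eq_fun do rewrite E_Z//.
by apply: cvgM; [exact: cvg_cst|exact: ulimP].
Qed.

Lemma ulimB f g : bounded_measurable f -> bounded_measurable g ->
  ulim (fun x => f x - g x) = ulim f - ulim g.
Proof.
move=> bf bg; apply: ulim_eq; under eq_fun do rewrite E_B//.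
by apply: cvgB; exact: ulimP.
Qed.

Lemma ulim_sum (I : Type) (s : seq I) (f_ : I -> T -> R) :
  (forall i, bounded_measurable (f_ i)) ->
  ulim (fun x => \sum_(i <- s) f_ i x) = \sum_(i <- s) ulim (f_ i).
Proof.
move=> bf; elim: s => [|i s IH].
  by rewrite big_nil -[RHS](ulim_cst 0); congr ulim; apply/funext => x; rewrite big_nil.
rewrite big_cons -IH -ulimD//; last exact: bm_sum.
by congr ulim; apply/funext => x; rewrite big_cons.
Qed.

Lemma ulim_le f g : bounded_measurable f -> bounded_measurable g ->
  (forall x, f x <= g x) -> ulim f <= ulim g.
Proof.
move=> bf bg fg; apply: (ler_cvg_to (ulimP bf) (ulimP bg)).
by apply: nearW => n; exact: E_le.
Qed.

Lemma ulim_ge0 f : bounded_measurable f -> (forall x, 0 <= f x) -> 0 <= ulim f.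
Proof.
by move=> bf f0; rewrite -(ulim_cst 0); apply: ulim_le => //; exact: bm_cst.
Qed.

Lemma ulim_near_le f (c : R) : bounded_measurable f ->
  (\forall n \near U, \int[P_ n]_x f x <= c) -> ulim f <= c.
Proof.
by move=> bf fc; apply: (@closed_cvg _ _ U _ _ (fun x : R => x <= c) _ _ _ (ulimP bf)).
Qed.

End ultralimit_functional.

(** * Realisation of limiting cell masses on the unit interval *)

Section nested_intervals.
Context d (T : measurableType d) (R : realType).
Context (U : set_system nat) (UU : UltraFilter U) (P_ : nat -> probability T R).
Context (bit : nat -> T -> bool).
Hypothesis mbit : forall j, measurable [set x | bit j x].
Local Notation ulim := (ulim U P_).
Local Notation RL := (measurableTypeR R).

(* Latest bit first, so that a refinement of a cell is a [cons]. *)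
Fixpoint bits k x : seq bool := if k is k'.+1 then bit k' x :: bits k' x else [::].

Lemma size_bits k x : size (bits k x) = k.
Proof. by elim: k => //= k ->. Qed.

Lemma bits_eq_le j k x y : (j <= k)%N -> bits k x = bits k y -> bits j x = bits j y.
Proof.
elim: k => [|k IH]; first by rewrite leqn0 => /eqP ->.
rewrite leq_eqVlt => /orP[/eqP -> //|]; rewrite ltnS => jk [_ h].
exact: IH.
Qed.

Lemma bits_eq_bit j k x y : (j < k)%N -> bits k x = bits k y -> bit j x = bit j y.
Proof. by move=> jk /(bits_eq_le jk)[]. Qed.

Definition cell s : set T := [set x | bits (size s) x = s].

Lemma cell_cons b s : cell (b :: s) = [set x | bit (size s) x = b] `&` cell s.
Proof.
by apply/seteqP; split=> x; rewrite /cell/=; [case=> h1 h2; split|case=> h1 h2; rewrite h1 h2].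
Qed.

Lemma measurable_cell s : measurable (cell s).
Proof.
elim: s => [|b s IH].
  by rewrite (_ : cell [::] = setT)//; apply/seteqP; split.
rewrite cell_cons; apply: measurableI => //; case: b; first exact: mbit.
have -> : [set x | bit (size s) x = false] = ~` [set x | bit (size s) x].
  by apply/seteqP; split=> x /=; [move=> h; rewrite /setC/= h|move=> /negP/negbTE].
exact: measurableC.
Qed.

Definition weight s : R := ulim \1_(cell s).

Lemma bm_cell s : bounded_measurable (\1_(cell s) : T -> R).
Proof. exact/bm_indic/measurable_cell. Qed.

Lemma weight_ge0 s : 0 <= weight s.
Proof.
by apply: ulim_ge0 => [|x]; [exact: bm_cell|rewrite indicE ler0n].
Qed.

Lemma weight_nil : weight [::] = 1.
Proof.
rewrite /weight (_ : \1_(cell [::]) = fun=> 1) ?ulim_cst//.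
by apply/funext => x; rewrite indicE mem_set.
Qed.

Lemma weight_split s : weight s = weight (false :: s) + weight (true :: s).
Proof.
rewrite /weight -ulimD; [|exact: bm_cell..].
rewrite (_ : (fun _ => _) = \1_(cell s))//; apply/funext => x.
rewrite !indicE !cell_cons !in_setI.
have E b : (x \in [set x | bit (size s) x = b]) = (bit (size s) x == b).
  by apply/idP/eqP; rewrite inE.
by rewrite !E; case: (bit _ x); rewrite /= ?add0r ?addr0.
Qed.

(** Ensures that a code met by a point of [[0, 1)] can be represented by an actual matrix. *)
Lemma weight_gt0 s : 0 < weight s -> cell s !=set0.
Proof.
move=> s0; apply/set0P/eqP => c0; move: s0; rewrite /weight c0.
by rewrite (_ : \1_set0 = fun=> 0) ?ulim_cst ?ltxx//; apply/funext => x; rewrite indic0.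
Qed.

Fixpoint left_end s : R :=
  if s is b :: s' then
    if b then left_end s' + weight (false :: s') else left_end s'
  else 0.

(** Half-open, so that the intervals of a given depth partition [[0, 1)]; inside the parent, the
    child [false] lies on the left. *)
Definition code_itv s : set R := `[left_end s, left_end s + weight s[%classic.

(* The sequence of [k] bits whose interval [code_itv] contains [w].  Under the
   uniform law on [0, 1) it has the [U]-limit of the laws of [bits k]. *)
Fixpoint bitcode k (w : R) : seq bool :=
  if k is k'.+1 then (left_end (true :: bitcode k' w) <= w) :: bitcode k' w else [::].

Lemma size_code k w : size (bitcode k w) = k.
Proof. by elim: k => //= k ->. Qed.

Lemma code_in k w : 0 <= w < 1 -> code_itv (bitcode k w) w.
Proof.
move=> w01; elim: k => [|k]; rewrite /code_itv/= !in_itv.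
  by rewrite weight_nil add0r.
rewrite weight_split => /andP[h1 h2].
by have [h|h] := leP (left_end (bitcode k w) + weight (false :: bitcode k w)) w => /=;
  apply/andP; split => //; rewrite -addrA.
Qed.

Lemma code_itv_tail b s : code_itv (b :: s) `<=` code_itv s.
Proof.
move=> w; rewrite /code_itv/= !in_itv /= (weight_split s).
have := weight_ge0 (true :: s); have := weight_ge0 (false :: s).
by case: b => /= ? ? /andP[? ?]; apply/andP; split; lra.
Qed.

Lemma code_itvP s w : code_itv s w -> bitcode (size s) w = s.
Proof.
elim: s => [//|b s IH] h /=; have -> := IH (code_itv_tail h); congr (_ :: _).
move: h; rewrite /code_itv/= !in_itv/=; case: b => /= /andP[h1 h2] //.
by apply/negbTE; rewrite -ltNge.
Qed.

Lemma code_itv01 s : 0 <= left_end s /\ left_end s + weight s <= 1.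
Proof.
elim: s => [|b s [IH1 IH2]] /=; first by rewrite weight_nil add0r.
move: IH2; rewrite (weight_split s).
have := weight_ge0 (true :: s); have := weight_ge0 (false :: s).
by case: b => /= ? ? ?; split; lra.
Qed.

Local Notation rho := (uniform_prob (@ltr01 R)).

Lemma rho_itv (a b : R) : 0 <= a -> a <= b -> b <= 1 ->
  rho (`[a, b[%classic : set RL) = (b - a)%:E.
Proof.
move=> a0 ab b1; rewrite /uniform_prob.
rewrite (eq_integral (fun=> 1%:E)); last first.
  move=> x; rewrite inE/= in_itv/= => /andP[ax xb].
  by rewrite /uniform_pdf (le_trans a0 ax) (le_trans (ltW xb) b1) subr0 invr1.
rewrite integral_cst//= mul1e lebesgue_measure_itv/= lte_fin.
case: ifPn => [_|]; first by rewrite EFinB.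
by rewrite -leNgt => ba; rewrite (@le_anti _ _ a b) ?ab// subrr.
Qed.

Lemma rho01 : rho (`[0, 1[%classic : set RL) = 1%E.
Proof. by rewrite rho_itv ?subr0. Qed.

Lemma measurable_code (h : seq bool -> R) k :
  measurable_fun [set: RL] (fun w : RL => h (bitcode k w)).
Proof.
elim: k h => [|k IH] h; first exact: (measurable_cst (h [::])).
pose A : set RL := [set w | left_end (true :: bitcode k w) <= w].
have mA : measurable A.
  rewrite -[A]setTI.
  exact: (measurable_fun_ler (IH (fun s => left_end (true :: s))) (@measurable_id _ RL setT)).
rewrite (_ : (fun w => _) = (fun w : RL => \1_A w * h (true :: bitcode k w) +
    (1 - \1_A w) * h (false :: bitcode k w))).
  apply: measurable_funD; apply: measurable_funM.
  - exact: measurable_indic.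
  - exact: (IH (fun s => h (true :: s))).
  - by apply: measurable_funB => //; exact: measurable_indic.
  - exact: (IH (fun s => h (false :: s))).
apply/funext => w; rewrite indicE.
have -> : (w \in A) = (left_end (true :: bitcode k w) <= w) by apply/idP/idP; rewrite inE.
by rewrite [bitcode _ _]/=; case: (_ <= w); rewrite ?subrr ?subr0 !mul1r !mul0r ?addr0 ?add0r.
Qed.

Lemma sum_tuple (s : seq bool) (h : seq bool -> R) k : size s = k ->
  \sum_(t : k.-tuple bool) h t * (s == t)%:R = h s.
Proof.
move=> sk; pose t0 : k.-tuple bool := Tuple (introT eqP sk).
rewrite (bigD1 t0)//= eqxx mulr1 big1 ?addr0// => t tt0.
rewrite (_ : (s == t) = false) ?mulr0//; apply/negbTE.
by apply: contra tt0 => /eqP st; apply/eqP/val_inj.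
Qed.

(** A function of [k] bits is a finite combination of indicators of cells, so finite additivity of
    [ulim] is enough: cell and interval have the same mass by construction. *)
Lemma E_code (h : seq bool -> R) k :
  \int[rho]_w h (bitcode k w) = ulim (fun x => h (bits k x)).
Proof.
have bi (t : k.-tuple bool) : bounded_measurable (\1_(code_itv t) : RL -> R).
  by apply: bm_indic; exact: measurable_itv.
transitivity (\sum_(t : k.-tuple bool) h t * weight t); last first.
  rewrite (_ : (fun x => h (bits k x)) =
      (fun x => \sum_(t : k.-tuple bool) h t * \1_(cell t) x)); last first.
    apply/funext => x; rewrite -(sum_tuple h (size_bits k x)).
    apply: eq_bigr => t _; rewrite indicE; congr (_ * (nat_of_bool _)%:R).
    by apply/eqP/idP; rewrite inE /cell/= size_tuple.
  rewrite ulim_sum; last by move=> t; exact/bmZ/bm_cell.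
  by apply: eq_bigr => t _; rewrite ulimZ//; exact: bm_cell.
transitivity (\int[rho]_w \sum_(t : k.-tuple bool) h t * \1_(code_itv t) w).
  have m01 : measurable (`[0, 1[%classic : set RL) by exact: measurable_itv.
  apply: (E_eq_full m01 rho01).
  - exact: (measurable_code h k).
  - by have [] := bm_sum (index_enum (k.-tuple bool)) (fun t => bmZ (h t) (bi t)).
  move=> w; rewrite /= in_itv/= => w01.
  rewrite -(sum_tuple h (size_code k w)); apply: eq_bigr => t _.
  rewrite indicE; congr (_ * (nat_of_bool _)%:R); apply/eqP/idP; rewrite inE.
    by move=> <-; exact: code_in.
  by move=> /code_itvP; rewrite size_tuple.
rewrite E_sum; last by move=> t; exact: bmZ.
apply: eq_bigr => t _; rewrite E_Z//; congr (_ * _).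
have [l0 l1] := code_itv01 t.
have le_end : left_end t <= left_end t + weight t by rewrite lerDl weight_ge0.
have mt : measurable (code_itv t : set RL) by exact: measurable_itv.
transitivity (fine (rho (code_itv t : set RL))); first exact: E_indic.
transitivity (fine (left_end t + weight t - left_end t)%:E).
  by congr fine; exact: rho_itv.
by rewrite /= addrAC subrr add0r.
Qed.

End nested_intervals.

Lemma measurable_set_le d (T : measurableType d) (R : realType) (f g : T -> R) :
  measurable_fun [set: T] f -> measurable_fun [set: T] g ->
  measurable [set x | f x <= g x].
Proof.
move=> mf mg; rewrite -[X in measurable X]setTI.
exact: (measurable_fun_ler mf mg measurableT).
Qed.

(** * Construction of the limit law *)

Section prokhorov.
Context (R : realType) (m p : nat).
Local Notation M := 'M[R[i]]_(m, p).
Local Notation RL := (measurableTypeR R).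
Local Notation CI := (coord_index m p).
Local Notation rho := (uniform_prob (@ltr01 R)).

(** Pairs of a coordinate and a rational are enumerated by [pickle]; an index that codes no pair
    gives a constant bit, which refines nothing. *)
Definition threshold_bit (j : nat) (x : M) : bool :=
  if @unpickle (CI * rat)%type j is Some cq then ratr cq.2 <= mxcoord cq.1 x
  else false.

Lemma measurable_threshold j : measurable [set x | threshold_bit j x].
Proof.
rewrite /threshold_bit; case: unpickle => [[c q]|] /=; last first.
  by rewrite (_ : [set x | _] = set0)//; apply/seteqP; split.
apply: measurable_set_le; first exact: measurable_cst.
exact: measurable_mxcoord.
Qed.

Local Notation bits := (bits threshold_bit).

Lemma thresholds_decided (L : seq (CI * rat)) : exists K, forall k x y,
  (K <= k)%N -> bits k x = bits k y ->
  forall c q, (c, q) \in L -> (ratr q <= mxcoord c x) = (ratr q <= mxcoord c y).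
Proof.
exists (\max_(cq <- L) pickle cq).+1 => k x y Kk xy c q cqL.
have := bits_eq_bit (leq_trans _ Kk) xy; rewrite /threshold_bit.
move=> /(_ (pickle (c, q))); rewrite pickleK/=; apply.
by rewrite ltnS; exact: (@leq_bigmax_seq _ _ xpredT).
Qed.

(** Once all thresholds of the grid of mesh [1 / D.+1] on [[- N, N]] are decided, equal bits put the
    coordinates of [x] and [y] in the same mesh. *)
Lemma bits_close (N D : nat) : exists K, forall k x y, (K <= k)%N ->
  bits k x = bits k y -> forall c, `|mxcoord c x| < N%:R ->
  `|mxcoord c x - mxcoord c y| <= D.+1%:R^-1 /\ `|mxcoord c y| <= N%:R.
Proof.
pose q i : rat := i%:R / D.+1%:R - N%:R.
have qE i : ratr (q i) = i%:R / D.+1%:R - N%:R :> R.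
  by rewrite rmorphB fmorph_div !rmorph_nat.
pose L := [seq (c, q i) | c <- enum CI, i <- iota 0 (2 * N * D.+1).+1].
have [K hK] := thresholds_decided L; exists K => k x y Kk xy c.
rewrite ltr_norml => /andP[x1 x2]; set t := mxcoord c x.
have D0 : (0 : R) < D.+1%:R by rewrite ltr0n.
have s0 : 0 <= (t + N%:R) * D.+1%:R by rewrite mulr_ge0//; rewrite /t; lra.
pose i := Num.truncn ((t + N%:R) * D.+1%:R).
have /andP[i1 i2] := truncn_itv s0; rewrite -/i in i1 i2.
(* Strict, because the coordinate is below [N]: the next threshold [q i.+1] is still in the grid. *)
have iN : (i < 2 * N * D.+1)%N.
  rewrite -(@ltr_nat R) (le_lt_trans i1)// !natrM ltr_pM2r//; rewrite /t; lra.
have inL j : (j <= 2 * N * D.+1)%N -> (c, q j) \in L.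
  by move=> jN; apply: allpairs_f; rewrite ?mem_enum// mem_iota add0n ltnS.
have h1 := hK k x y Kk xy c _ (inL i (ltnW iN)).
have h2 := hK k x y Kk xy c _ (inL i.+1 iN).
have q1 : ratr (q i) <= t by rewrite qE lerBlDr ler_pdivrMr.
have q2 : t < ratr (q i.+1) by rewrite qE ltrBrDr ltr_pdivlMr.
have y1 : ratr (q i) <= mxcoord c y by rewrite -h1.
have y2 : mxcoord c y < ratr (q i.+1).
  by rewrite ltNge -h2 -ltNge.
have qd : ratr (q i.+1) - ratr (q i) = D.+1%:R^-1 :> R.
  by rewrite !qE -(addn1 i) natrD; field; rewrite gt_eqF.
have qi0 : - N%:R <= ratr (q i) :> R by rewrite qE lerBrDr addrC subrr divr_ge0.
have qiN : ratr (q i.+1) <= N%:R :> R.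
  rewrite qE lerBlDr ler_pdivrMr// -natrD -natrM ler_nat.
  by rewrite (leq_trans iN)// mulSn mul1n addnn -mul2n.
move: q1 q2 y1 y2 qd qi0 qiN; rewrite !ler_norml /t.
move: (ratr (q i) : R) (ratr (q i.+1) : R) (mxcoord c y) (mxcoord c x) => a b u v.
move: (D.+1%:R^-1) (N%:R : R) => e n q1 q2 y1 y2 qd qi0 qiN.
by split; apply/andP; split; lra.
Qed.

Lemma measurable_bits (s : seq bool -> R) k :
  measurable_fun [set: M] (fun x => s (bits k x)).
Proof.
elim: k s => [|k IH] s; first exact: (measurable_cst (s [::])).
rewrite (_ : (fun x => _) = (fun x => if threshold_bit k x then s (true :: bits k x)
  else s (false :: bits k x))); last by apply/funext => x /=; case: threshold_bit.
apply: measurable_fun_ifT; [|exact: (IH (fun t => s (true :: t)))|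
  exact: (IH (fun t => s (false :: t)))].
by apply: (@measurable_fun_bool _ _ _ _ true); rewrite setTI; exact: measurable_threshold.
Qed.

Context (U : set_system nat) (UU : UltraFilter U) (P_ : nat -> probability M R).
Hypothesis tightU : forall c (e : R), 0 < e ->
  exists2 r, 0 < r & \forall n \near U, \int[P_ n]_x \1_(tail (mxcoord c) r) x <= e.

Local Notation ulim := (ulim U P_).
Local Notation bitcode := (bitcode U P_ threshold_bit).

Lemma bm_tail c r : bounded_measurable (\1_(tail (mxcoord c) r) : M -> R).
Proof. by apply: bm_indic; apply: measurable_tail; exact: measurable_mxcoord. Qed.

Lemma tail_antitone (l : M -> R) (r s : R) x : r <= s ->
  \1_(tail l s) x <= \1_(tail l r) x :> R.
Proof.
move=> rs; rewrite !indicE ler_nat; have [|//] := boolP (x \in tail l s).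
by rewrite !inE /tail/= => sx; rewrite mem_set//= (le_trans rs).
Qed.

Lemma ulim_tail (e : R) : 0 < e ->
  exists N : nat, forall c, ulim \1_(tail (mxcoord c) N%:R) <= e.
Proof.
move=> e0; have h c : exists r, ulim \1_(tail (mxcoord c) r) <= e.
  have [r _ hr] := tightU c e0; exists r.
  by apply: ulim_near_le hr; exact: bm_tail.
pose r c := sval (cid (h c)); pose N := (\max_(c : CI) (Num.truncn (r c)).+1)%N.
exists N => c; have hr : ulim \1_(tail (mxcoord c) (r c)) <= e by rewrite /r; case: cid.
rewrite (le_trans _ hr)//; apply: ulim_le => [||x]; [exact: bm_tail..|].
apply: tail_antitone; rewrite (le_trans (ltW (truncnS_gt _)))// ler_nat.
exact: (leq_bigmax c).
Qed.

(** The default 0 serves empty cells only. These have weight 0, so they are not codes of points of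
    [[0, 1)] ([bits_code]). *)
Definition sample s : M := xget 0 (cell threshold_bit s).

Lemma bits_sample x k : bits k (sample (bits k x)) = bits k x.
Proof.
have : cell threshold_bit (bits k x) (sample (bits k x)).
  by apply: (@xgetI _ _ _ x); rewrite /cell/= size_bits.
by rewrite /cell/= size_bits.
Qed.

Lemma bits_code k (w : R) : 0 <= w < 1 -> bits k (sample (bitcode k w)) = bitcode k w.
Proof.
move=> w01; have := code_in UU P_ measurable_threshold k w01.
rewrite /code_itv/= in_itv/= => /andP[h1 h2].
have [x hx] : cell threshold_bit (bitcode k w) !=set0.
  apply: (weight_gt0 UU (P_ := P_)).
  by rewrite -(ltrD2l (left_end U P_ threshold_bit (bitcode k w))) addr0 (le_lt_trans h1).
have <- : bits k x = bitcode k w by move: hx; rewrite /cell/= size_code.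
exact: bits_sample.
Qed.

Lemma bits_code_le j k (w : R) : (j <= k)%N -> 0 <= w < 1 ->
  bits j (sample (bitcode k w)) = bits j (sample (bitcode j w)).
Proof.
move=> jk w01; rewrite bits_code//.
have {w01} : bits k (sample (bitcode k w)) = bitcode k w by exact: bits_code.
move: (sample _) => x; elim: k jk => [|k IH]; first by rewrite leqn0 => /eqP ->.
rewrite leq_eqVlt => /orP[/eqP -> //|]; rewrite ltnS => jk /= [_ h].
exact: IH.
Qed.

Lemma bounded_level (N : nat) : exists K,
  (forall x, (forall c, `|mxcoord c x| < N%:R) ->
     forall c, `|mxcoord c (sample (bits K x))| <= N%:R) /\
  (forall (w : R) k, (K <= k)%N -> 0 <= w < 1 ->
     (forall c, `|mxcoord c (sample (bitcode K w))| <= N%:R) ->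
     forall c, `|mxcoord c (sample (bitcode k w))| <= N.+1%:R).
Proof.
(* Mesh 1 suffices, since only sizes matter. The second use starts from a bound by [N] that is not
   strict, hence [N.+1]. *)
have [K1 h1] := bits_close N 0; have [K2 h2] := bits_close N.+1 0.
exists (maxn K1 K2); split=> [x xN c|w k Kk w01 wN c].
  have := h1 _ _ _ (leq_maxl K1 K2) (esym (bits_sample x _)) c (xN c).
  by case.
have b := esym (bits_code_le Kk w01).
have [|_ //] := h2 _ _ _ (leq_maxr K1 K2) b c.
by rewrite (le_lt_trans (wN c))// ltr_nat.
Qed.

Definition level N := sval (cid (bounded_level N)).

(* All cells of [w] from depth [level N] on are within bounded distance of the
   origin: no mass escapes to infinity along the coding. *)
Definition bounded_event (N : nat) : set RL :=
  [set w | 0 <= (w : R) < 1 /\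
     forall c, `|mxcoord c (sample (bitcode (level N) w))| <= N%:R].

Lemma measurable_sample k c :
  measurable_fun [set: RL] (fun w : RL => mxcoord c (sample (bitcode k w))).
Proof.
exact: (measurable_code U P_ threshold_bit (fun s => mxcoord c (sample s)) k).
Qed.

Lemma measurable_bounded_event N : measurable (bounded_event N).
Proof.
have -> : bounded_event N = (`[0, 1[%classic : set RL) `&`
    \bigcap_(c in [set: CI]) [set w : RL | `|mxcoord c (sample (bitcode (level N) w))| <= N%:R].
  apply/seteqP; split=> w /=.
    by move=> [w01 h]; split; [rewrite in_itv|move=> c _; exact: h].
  by rewrite in_itv => -[w01 h]; split => // c; exact: h.
apply: measurableI; first exact: measurable_itv.
apply: fin_bigcap_measurable => // c _; apply: measurable_set_le; last exact: measurable_cst.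
exact: measurableT_comp (@normr_measurable R setT) (measurable_sample (level N) c).
Qed.

Lemma bounded_event_ge (e : R) : 0 < e -> exists N, 1 - e <= fine (rho (bounded_event N)).
Proof.
(* An equal share for each coordinate; the successor covers an empty set of coordinates. *)
move=> e0; have e0' : 0 < e / (#|CI|.+1)%:R by rewrite divr_gt0.
have [N hN] := ulim_tail e0'; exists N.
pose g s : R := [forall c, `|mxcoord c (sample s)| <= N%:R]%:R.
have mB := measurable_bounded_event N.
have m01 : measurable (`[0, 1[%classic : set RL) by exact: measurable_itv.
have -> : fine (rho (bounded_event N)) = \int[rho]_w g (bitcode (level N) w).
  transitivity (\int[rho]_w \1_(bounded_event N) w); first by rewrite E_indic.
  apply: (E_eq_full m01 (rho01 R)).
  - exact: measurable_indic.
  - exact: (measurable_code U P_ threshold_bit g).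
  move=> w /=; rewrite in_itv/= => w01; rewrite indicE /g; congr (nat_of_bool _)%:R.
  apply/idP/forallP; rewrite inE; first by case.
  by move=> h; split.
rewrite (E_code UU P_ measurable_threshold).
have bg : bounded_measurable (fun x => g (bits (level N) x)).
  split; first exact: measurable_bits.
  by exists 1 => x; rewrite /g; case: [forall c, _]; rewrite ?normr1 ?normr0.
(* Union bound, pointwise in [x]: if the sample leaves the box, then some coordinate of [x] has
   modulus at least [N]. *)
apply: (@le_trans _ _ (ulim (fun x => 1 - \sum_(c : CI) \1_(tail (mxcoord c) N%:R) x))).
  rewrite ulimB ?ulim_cst//; [|exact: bm_cst|by apply: bm_sum => c; exact: bm_tail].
  rewrite lerD2l lerN2 ulim_sum; last by move=> c; exact: bm_tail.
  apply: (@le_trans _ _ (\sum_(c : CI) e / (#|CI|.+1)%:R)); first exact: ler_sum.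
  rewrite sumr_const -[leLHS]mulr_natr mulrAC ler_pdivrMr ?ltr0n//.
  by rewrite ler_wpM2l ?(ltW e0)// ler_nat.
apply: ulim_le => //.
  by apply: bmB; [exact: bm_cst|apply: bm_sum => c; exact: bm_tail].
move=> x; rewrite /g; case: (boolP [forall c, `|mxcoord c (sample (bits (level N) x))| <= N%:R]) => [_|].
  by rewrite mulr1n lerBlDr lerDl sumr_ge0// => c _; rewrite indicE ler0n.
move=> /forallPn[c hc]; rewrite mulr0n subr_le0.
have [c' hc'] : exists c', N%:R <= `|mxcoord c' x|.
  apply: contrapT => nc; move: hc; apply/negP; rewrite negbK.
  have [h _] : _ /\ _ := svalP (cid (bounded_level N)).
  apply: h => c'; rewrite ltNge; apply/negP => hc'; apply: nc; by exists c'.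
by rewrite (bigD1 c')//= indicE mem_set// lerDl sumr_ge0.
Qed.

Definition tight_event : set RL := \bigcup_N bounded_event N.

Lemma measurable_tight_event : measurable tight_event.
Proof. by apply: bigcup_measurable => N _; exact: measurable_bounded_event. Qed.

Lemma tight_event_full : rho tight_event = 1%E.
Proof.
have mD := measurable_tight_event.
have le1 : (rho tight_event <= 1)%E by exact: probability_le1.
apply/eqP; rewrite eq_le le1/=.
have fD : rho tight_event \is a fin_num by exact: fin_num_measure.
rewrite -(fineK fD) lee_fin; apply/ler_addgt0Pr => e /bounded_event_ge[N hN].
have mB := measurable_bounded_event N.
rewrite -lerBlDr (le_trans hN)// fine_le//; first exact: fin_num_measure.
by apply: le_measure; rewrite ?inE//; exact: bigcup_sup.
Qed.

Lemma sample_cvg c w : tight_event w ->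
  cvg (mxcoord c (sample (bitcode k w)) @[k --> \oo]).
Proof.
move=> [N _ [w01 hw]]; apply/cauchy_cvgP/cauchy_exP => e e0.
have [D hD] : exists D : nat, D.+1%:R^-1 < e.
  have /cvgrPdist_lt/(_ _ e0)[D _ /(_ D (leqnn _))] := @cvg_harmonic R.
  by rewrite /= sub0r normrN => hD; exists D; rewrite (le_lt_trans (ler_norm _)).
have [_ hbound] : _ /\ _ := svalP (cid (bounded_level N)).
(* From [level N] on the samples are bounded by [N.+1], and [bits_close] wants a strict bound. *)
have [K hK] := bits_close N.+2 D; pose K' := maxn K (level N).
exists (mxcoord c (sample (bitcode K' w))); exists K' => // k /= K'k.
have b := bits_code_le K'k w01.
have [|h _] := hK _ _ _ (leq_maxl K (level N)) (esym b) c.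
  by rewrite (le_lt_trans (hbound w K' (leq_maxr _ _) w01 hw c))// ltr_nat.
exact: le_lt_trans hD.
Qed.

(** Pointwise convergence of the samples would not suffice, as [ulim] is only finitely additive. The
    error is made uniform on a box, and tightness bounds the [ulim] of the rest. *)
Lemma ulim_sample_cvg (f : M -> R) (C : R) : continuous f -> (forall x, `|f x| <= C) ->
  ulim (fun x => f (sample (bits k x))) @[k --> \oo] --> ulim f.
Proof.
move=> cf fC; apply/cvgrPdist_le => e e0.
have C0 : 0 <= C by exact: le_trans (normr_ge0 _) (fC 0).
have mf : measurable_fun [set: M] f by exact: continuous_mx_measurable.
have bf : bounded_measurable f by split => //; exists C.
(* Chosen so that the tails, each of mass [e / B] and weighted by [2 * C], add up to at most
   [e / 2]. *)
pose B := 4 * (C + 1) * (#|CI|.+1)%:R; have B0 : 0 < B by rewrite !mulr_gt0//; lra.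
have [N hN] := ulim_tail (divr_gt0 e0 B0).
have [h h0 hf] := continuous_uniform_on_box N%:R cf (divr_gt0 e0 (ltr0Sn R 1)).
have [D hD] : exists D : nat, D.+1%:R^-1 < h.
  have /cvgrPdist_lt/(_ _ h0)[D _ /(_ D (leqnn _))] := @cvg_harmonic R.
  by rewrite /= sub0r normrN => hD; exists D; rewrite (le_lt_trans (ler_norm _)).
have [K hK] := bits_close N D; exists K => // k /= Kk.
pose g x := f (sample (bits k x)).
have bg : bounded_measurable g.
  by split; [exact: (measurable_bits (fun s => f (sample s)))|exists C => x; exact: fC].
pose S (x : M) : R := \sum_(c : CI) \1_(tail (mxcoord c) N%:R) x.
pose H x := e / 2 + 2 * C * S x.
have bS : bounded_measurable S.
  by apply: bm_sum => c; exact: bm_tail.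
have bH : bounded_measurable H by apply: bmD; [exact: bm_cst|exact: bmZ].
have fgH x : `|f x - g x| <= H x.
  have S0 : 0 <= S x.
    by apply: sumr_ge0 => c _; rewrite indicE ler0n.
  have [[c hc]|nc] := pselect (exists c, N%:R <= `|mxcoord c x|).
    have S1 : 1 <= S x.
      by rewrite /S (bigD1 c)//= indicE mem_set// lerDl sumr_ge0.
    rewrite (le_trans (ler_normB _ _))// /H.
    have := fC x; have := fC (sample (bits k x)); rewrite -/(g x).
    have : 2 * C * 1 <= 2 * C * S x.
      by rewrite ler_wpM2l// mulr_ge0.
    lra.
  have xN c : `|mxcoord c x| < N%:R by rewrite ltNge; apply/negP => ?; apply: nc; exists c.
  rewrite (@le_trans _ _ (e / 2))//; last by rewrite lerDl !mulr_ge0.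
  apply: hf => c; first exact: ltW.
  have [h1 _] := hK k x (sample (bits k x)) Kk (esym (bits_sample x k)) c (xN c).
  exact: le_trans h1 (ltW hD).
have HE : ulim H <= e.
  rewrite ulimD; [|exact: bm_cst|exact: bmZ]; rewrite ulim_cst ulimZ// ulim_sum; last first.
    by move=> c; exact: bm_tail.
  have : \sum_(c : CI) ulim \1_(tail (mxcoord c) N%:R) <= \sum_(c : CI) (e / B).
    exact: ler_sum.
  rewrite sumr_const -[leRHS]mulr_natr => hS.
  have h2 : 2 * C * (e / B * #|CI|%:R) <= e / 2.
    have -> : 2 * C * (e / B * #|CI|%:R) = e * (2 * C * #|CI|%:R) / B by ring.
    rewrite ler_pdivrMr// /B -(addn1 #|CI|) natrD.
    have n0 : (0 : R) <= #|CI|%:R by [].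
    have := mulr_ge0 C0 n0; move: (#|CI|%:R : R) n0 => n n0 Cn0.
    have := mulr_ge0 (ltW e0) Cn0; have := mulr_ge0 (ltW e0) n0; have := mulr_ge0 (ltW e0) C0.
    nra.
  have : 2 * C * \sum_(c : CI) ulim \1_(tail (mxcoord c) N%:R) <= 2 * C * (e / B * #|CI|%:R).
    by rewrite ler_wpM2l// mulr_ge0.
  lra.
rewrite ler_norml -ulimB//; apply/andP; split.
  rewrite lerNl -[leLHS]mulN1r -ulimZ; last exact: bmB.
  apply: le_trans HE; apply: ulim_le => [||x] //; first by apply: bmZ; exact: bmB.
  by rewrite mulN1r (le_trans _ (fgH x))// (le_trans (ler_norm _))// normrN.
apply: le_trans HE; apply: ulim_le => [||x] //; first exact: bmB.
by rewrite (le_trans _ (fgH x))// ler_norm.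
Qed.

(** The numbers [ulim (f \o sample_k)] have two limits in [k]: [ulim f] by the uniform estimate, and
    the integral of [f] against the constructed law by dominated convergence on [[0, 1)]. *)
Theorem prokhorov : exists L : probability M R, forall f : M -> R,
  continuous f -> (exists C, forall x, `|f x| <= C) ->
  \int[P_ n]_x f x @[n --> U] --> \int[L]_x f x.
Proof.
(* The indicator makes the sequence converge at every [w], so that its limit is measurable. *)
pose Y c (w : RL) k : R := \1_tight_event w * mxcoord c (sample (bitcode k w)).
have mind : measurable_fun [set: RL] (\1_tight_event : RL -> R).
  by apply: measurable_indic; exact: measurable_tight_event.
have cvY c w : cvg (Y c w k @[k --> \oo]).
  rewrite /Y indicE; have [|_] := boolP (w \in tight_event).
    rewrite inE => Dw; under eq_fun do rewrite mul1r.
    exact: sample_cvg.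
  by under eq_fun do rewrite mul0r; exact: is_cvg_cst.
pose X (w : RL) c : R := lim (Y c w k @[k --> \oo]).
have mX c : measurable_fun [set: RL] (fun w => X w c).
  apply: (@measurable_fun_cvg _ _ _ setT (fun k w => Y c w k)).
    by move=> k; apply: measurable_funM => //; exact: measurable_sample.
  by move=> w _; exact: cvY.
have mXM : measurable_fun [set: RL] (fun w => mkmx (X w)) by exact: measurable_mkmx.
exists (distribution rho (mfun_Sub (mem_set mXM : _ \in mfun))) => f cf [C fC].
have mf : measurable_fun [set: M] f by exact: continuous_mx_measurable.
have bf : bounded_measurable f by split => //; exists C.
rewrite E_distribution//.
suff -> : \int[rho]_w f (mkmx (X w)) = ulim f by exact: ulimP.
have cv1 := ulim_sample_cvg cf fC.
have cv2 : ulim (fun x => f (sample (bits k x))) @[k --> \oo] -->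
    \int[rho]_w f (mkmx (X w)).
  have E k : ulim (fun x => f (sample (bits k x))) =
      \int[rho]_w f (sample (bitcode k w)).
    by rewrite -(E_code UU P_ measurable_threshold (fun s => f (sample s))).
  under eq_fun do rewrite E.
  apply: (@E_dct _ _ _ rho tight_event (fun k (w : RL) => f (sample (bitcode k w)))
    (fun w => f (mkmx (X w))) C).
  - exact: measurable_tight_event.
  - exact: tight_event_full.
  - by move=> k; exact: (measurable_code U P_ threshold_bit (fun s => f (sample s)) k).
  - exact: measurableT_comp mf mXM.
  - by move=> k w _; exact: fC.
  move=> w Dw; apply/cvgrPdist_lt => e e0.
  have [h h0 hf] := continuous_coord (mkmx (X w)) cf e0.
  have : \forall k \near \oo, forall c, `|X w c - Y c w k| < h.
    by apply: filter_forall => c; have /cvgrPdist_lt/(_ _ h0) := cvY c w.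
  apply: filterS => k hk; apply: hf => c; rewrite mxcoord_mkmx.
  by have := hk c; rewrite /Y indicE mem_set// mul1r.
exact: cvg_unique cv2 cv1.
Qed.

End prokhorov.

(** * Lévy's continuity theorem *)

Section bernstein.
Context (R : realType).
Implicit Types (z : R) (h : nat -> R).

(** The Bernstein basis polynomial, that is the probability of [k] successes in [m] trials of
    parameter [z], by conditioning on one trial rather than with binomial coefficients. *)
Fixpoint bern z m k : R :=
  if m is m'.+1 then
    (1 - z) * bern z m' k + (if k is k'.+1 then z * bern z m' k' else 0)
  else (k == 0%N)%:R.

Lemma bern_ge0 z m k : 0 <= z <= 1 -> 0 <= bern z m k.
Proof.
move=> /andP[z0 z1]; elim: m k => [|m IH] k /=; first by rewrite ler0n.
rewrite addr_ge0 ?mulr_ge0 ?subr_ge0//; case: k => // k.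
by rewrite mulr_ge0.
Qed.

Lemma bern_gt z m k : (m < k)%N -> bern z m k = 0.
Proof.
elim: m k => [|m IH] [|k]//=; rewrite ltnS => mk.
by rewrite !IH ?mulr0 ?addr0// ltnW// ltnS.
Qed.

Definition bern_sum z m h : R := \sum_(k < m.+1) bern z m k * h k.

Lemma bern_sumS z m h :
  bern_sum z m.+1 h = (1 - z) * bern_sum z m h + z * bern_sum z m (h \o S).
Proof.
rewrite /bern_sum.
under eq_bigr do rewrite /= mulrDl.
rewrite big_split/=; congr (_ + _).
  rewrite big_ord_recr/= bern_gt// mulr0 mul0r addr0 mulr_sumr.
  by apply: eq_bigr => k _; rewrite mulrA.
rewrite big_ord_recl/= mul0r add0r mulr_sumr.
by apply: eq_bigr => k _; rewrite /= mulrA.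
Qed.

Lemma bern_sum1 z m : bern_sum z m (fun=> 1) = 1.
Proof.
elim: m => [|m IH]; first by rewrite /bern_sum big_ord1/= mulr1.
by rewrite bern_sumS !IH; ring.
Qed.

(** A free centre [a] is what the induction needs: a success replaces [a] by [a - 1]. *)
Lemma bern_sum_sqr z m a :
  bern_sum z m (fun k => (k%:R - a) ^+ 2) = m%:R * (z * (1 - z)) + (m%:R * z - a) ^+ 2.
Proof.
elim: m a => [|m IH] a; first by rewrite /bern_sum big_ord1/=; ring.
rewrite bern_sumS IH.
have -> : (fun k : nat => (k%:R - a) ^+ 2) \o S = fun k => (k%:R - (a - 1)) ^+ 2.
  by apply/funext => k /=; rewrite -natr1; ring.
by rewrite IH -natr1; ring.
Qed.

Lemma bern_variance z m : 0 <= z <= 1 -> (0 < m)%N ->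
  bern_sum z m (fun k => (k%:R / m%:R - z) ^+ 2) <= m%:R^-1.
Proof.
move=> /andP[z0 z1] m0; have m0' : (0 : R) < m%:R by rewrite ltr0n.
have -> : bern_sum z m (fun k => (k%:R / m%:R - z) ^+ 2) =
    m%:R^-1 ^+ 2 * bern_sum z m (fun k => (k%:R - m%:R * z) ^+ 2).
  rewrite /bern_sum mulr_sumr; apply: eq_bigr => k _.
  by field; rewrite gt_eqF.
rewrite bern_sum_sqr subrr expr0n addr0 expr2 -mulrA mulKf ?gt_eqF//.
rewrite ler_piMr ?invr_ge0 ?ltW//; nra.
Qed.

Context (I : finType) (m : nat) (m0 : (0 < m)%N) (z : I -> R).
Hypothesis z01 : forall c, 0 <= z c <= 1.

Definition bern_weight (k : {ffun I -> 'I_m.+1}) : R := \prod_c bern (z c) m (k c).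

Lemma bern_weight_ge0 k : 0 <= bern_weight k.
Proof. by apply: prodr_ge0 => c _; exact: bern_ge0. Qed.

Lemma bern_weight_sum : \sum_k bern_weight k = 1.
Proof.
rewrite -(bigA_distr_bigA (fun c (k : 'I_m.+1) => bern (z c) m k)) big1// => c _.
by rewrite -[RHS](bern_sum1 (z c) m); apply: eq_bigr => k _; rewrite mulr1.
Qed.

Lemma bern_weight_variance c0 :
  \sum_k bern_weight k * ((k c0)%:R / m%:R - z c0) ^+ 2 <= m%:R^-1.
Proof.
pose F c (k : 'I_m.+1) : R := bern (z c) m k *
  (if c == c0 then (k%:R / m%:R - z c0) ^+ 2 else 1).
have -> : \sum_k bern_weight k * ((k c0)%:R / m%:R - z c0) ^+ 2 =
    \sum_(k : {ffun I -> 'I_m.+1}) \prod_c F c (k c).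
  apply: eq_bigr => k _; rewrite big_split/=; congr (_ * _).
  by rewrite (bigD1 c0)//= eqxx big1 ?mulr1// => c /negbTE ->.
rewrite -bigA_distr_bigA (bigD1 c0)//= [X in _ * X]big1 ?mulr1; last first.
  move=> c cc0; rewrite -[RHS](bern_sum1 (z c) m); apply: eq_bigr => k _.
  by rewrite /F (negbTE cc0).
apply: le_trans (bern_variance (z01 c0) m0).
by rewrite /bern_sum le_eqVlt; apply/orP; left; apply/eqP/eq_bigr => k _; rewrite /F eqxx.
Qed.

End bernstein.

(** The sine increases on [[- pi / 2, pi / 2]], and between [v] and [v + h], both in [[- 1, 1]], its
    slope is at least [cos 1]. The asymmetry is intended: [v] comes from a point of the box, [u] is
    any arcsine. *)
Lemma sin_separation (R : realType) (u v h : R) :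
  `|v| <= 1 / 2 -> `|u| <= pi / 2 -> 0 < h -> h <= 1 / 2 -> h <= `|u - v| ->
  cos 1 * h <= `|sin u - sin v|.
Proof.
wlog vu : u v / v <= u => [hw|].
  have [/hw//|/ltW uv] := leP v u.
  have := hw (- u) (- v); rewrite lerN2 !normrN !sinN -!opprD !normrN.
  exact.
move=> v2 u2 h0 h2; rewrite ger0_norm ?subr_ge0// => huv.
have pi2 := pihalf_ge1 R.
move: v2 u2; rewrite !ler_norml => /andP[v1 v2] /andP[u1 u2].
have mono : sin (v + h) <= sin u.
  rewrite leNgt ltr_sin ?in_itv/=; [by rewrite -leNgt; lra|..];
    by apply/andP; split; lra.
have [||c hc E] := @MVT R sin cos v (v + h).
- by rewrite ltrDl.
- by apply: continuous_subspaceT => t; exact: continuous_sin.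
move: hc; rewrite in_itv/= => /andP[c1 c2].
have cosc : cos 1 <= cos c.
  rewrite -(cos_norm c) leNgt; apply/negP.
  have c01 : `|c| <= 1 by rewrite ler_norml; apply/andP; split; lra.
  have pi1 : 1 <= pi :> R by have := @pi_ge2 R; lra.
  rewrite ltr_cos ?in_itv/= ?ler01 ?normr_ge0//=; last exact: le_trans pi1.
  by rewrite ltNge c01.
have := cos1_gt0 R.
move: E; rewrite addrAC subrr add0r => E c10.
have X : cos 1 * h <= sin (v + h) - sin v by rewrite E ler_wpM2r// ltW.
have Y : 0 <= cos 1 * h by rewrite mulr_ge0 ?ltW.
by rewrite ger0_norm; lra.
Qed.

(** * Approximation by trigonometric polynomials *)

Section trigonometric_approximation.
Context (R : realType) (d : nat).
Local Notation Md := 'M[R[i]]_d.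
Local Notation CI := (coord_index d d).

Lemma trformDl (A B M : Md) : trform (A + B) M = trform A M + trform B M.
Proof. by rewrite /trform linearD/= map_mxD mulmxDl mxtraceD cReD. Qed.

Lemma trformNl (A M : Md) : trform (- A) M = - trform A M.
Proof. by rewrite /trform linearN/= map_mxN mulNmx raddfN cReN. Qed.

Lemma trform0l (M : Md) : trform 0 M = 0.
Proof. by rewrite /trform trmx0 map_mx0 mul0mx mxtrace0. Qed.

Definition coord_mx (c : CI) : Md :=
  (if c.2 then 'i else 1) *: delta_mx c.1.1 c.1.2.

Lemma mxcoordE (c : CI) (M : Md) : mxcoord c M = trform (coord_mx c) M.
Proof.
case: c => [[i j] b]; rewrite /mxcoord /trform /coord_mx/= linearZ/= map_mxZ/=.
rewrite trmx_delta map_delta_mx -scalemxAl mxtraceZ.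
have -> : \tr (delta_mx j i *m M) = M i j.
  rewrite /mxtrace (bigD1 j)//= big1 => [|k kj].
    rewrite addr0 mxE (bigD1 i)//= big1 => [|l li].
      by rewrite mxE !eqxx mul1r addr0.
    by rewrite mxE (negbTE li) andbF mul0r.
  by rewrite mxE big1// => l _; rewrite mxE (negbTE kj) mul0r.
rewrite cReM cRe_conj cIm_conj; case: b => /=.
  by rewrite mul0r sub0r mulN1r opprK.
by rewrite oppr0 mul1r mul0r subr0.
Qed.

(** The shift [s] brings in sines, and [A = 0] the constants; products stay in the span by the
    addition formulas. *)
Inductive trigonometric : (Md -> R) -> Prop :=
| trig_cos A s : trigonometric (fun x => cos (trform A x + s))
| trigD f g : trigonometric f -> trigonometric g -> trigonometric (fun x => f x + g x)
| trigZ c f : trigonometric f -> trigonometric (fun x => c * f x).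

Lemma trig_ext f g : (forall x, f x = g x) -> trigonometric f -> trigonometric g.
Proof. by move=> /funext ->. Qed.

Lemma trig_cst c : trigonometric (fun=> c).
Proof.
apply: (@trig_ext (fun x => c * cos (trform 0 x + 0))).
  by move=> x; rewrite trform0l addr0 cos0 mulr1.
exact/trigZ/trig_cos.
Qed.

Lemma trigM f g : trigonometric f -> trigonometric g ->
  trigonometric (fun x => f x * g x).
Proof.
move=> tf; elim: tf g => {f} [A s|f1 f2 _ IH1 _ IH2|c f _ IH] g tg.
- elim: tg => {g} [B t|g1 g2 _ IH1 _ IH2|c g _ IH].
  + apply: (@trig_ext (fun x => 1 / 2 * (cos (trform (A + B) x + (s + t)) +
      cos (trform (A - B) x + (s - t))))); last exact/trigZ/trigD/trig_cos/trig_cos.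
    move=> x; rewrite !trformDl trformNl.
    have -> : trform A x + trform B x + (s + t) = (trform A x + s) + (trform B x + t).
      by ring.
    have -> : trform A x - trform B x + (s - t) = (trform A x + s) - (trform B x + t).
      by ring.
    by rewrite cosD cosB; field.
  + by apply: (trig_ext _ (trigD IH1 IH2)) => x; rewrite mulrDr.
  + by apply: (trig_ext _ (trigZ c IH)) => x; rewrite mulrCA.
- by apply: (trig_ext _ (trigD (IH1 _ tg) (IH2 _ tg))) => x; rewrite mulrDl.
- by apply: (trig_ext _ (trigZ c (IH _ tg))) => x; rewrite mulrA.
Qed.

Lemma trig_sum (I : Type) (s : seq I) (f_ : I -> Md -> R) :
  (forall i, trigonometric (f_ i)) -> trigonometric (fun x => \sum_(i <- s) f_ i x).
Proof.
move=> tf; elim: s => [|i s IH].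
  by under eq_fun do rewrite big_nil; exact: trig_cst.
by under eq_fun do rewrite big_cons; exact: trigD.
Qed.

Lemma trig_prod (I : Type) (s : seq I) (f_ : I -> Md -> R) :
  (forall i, trigonometric (f_ i)) -> trigonometric (fun x => \prod_(i <- s) f_ i x).
Proof.
move=> tf; elim: s => [|i s IH].
  by under eq_fun do rewrite big_nil; exact: trig_cst.
by under eq_fun do rewrite big_cons; exact: trigM.
Qed.

Lemma trig_bern (z : Md -> R) m k : trigonometric z ->
  trigonometric (fun x => bern (z x) m k).
Proof.
move=> tz; elim: m k => [|m IH] k; first exact: trig_cst.
rewrite /=; apply: trigD.
  apply: trigM (IH k); apply: (trig_ext _ (trigD (trig_cst 1) (trigZ (-1) tz))).
  by move=> x; rewrite mulN1r.
by case: k => [|k]; [exact: trig_cst|exact: trigM].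
Qed.

Definition phase (a : R) (c : CI) (x : Md) : R := (1 + sin (a * mxcoord c x)) / 2.

Lemma trig_phase a c : trigonometric (phase a c).
Proof.
apply: (@trig_ext (fun x => 1 / 2 * (1 + cos (trform (a%:C *: coord_mx c) x + (- (pi / 2)))))).
  by move=> x; rewrite cosBpihalf trformZl -mxcoordE /phase; ring.
exact/trigZ/trigD/trig_cos/trig_cst.
Qed.

Lemma phase01 a c x : 0 <= phase a c x <= 1.
Proof.
have := sin_geN1 (a * mxcoord c x); have := sin_le1 (a * mxcoord c x).
by rewrite /phase; move=> ? ?; apply/andP; split; lra.
Qed.

(* Bernstein approximation of [f] in the variables [phase a c x], which take
   values in [0, 1] for every [x]; the bound by [C] therefore holds globally. *)
Lemma trig_approx (f : Md -> R) (C T e : R) : continuous f ->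
  (forall x, `|f x| <= C) -> 0 < T -> 0 < e ->
  exists q, [/\ trigonometric q, forall x, `|q x| <= C &
    forall x, (forall c, `|mxcoord c x| <= T) -> `|q x - f x| <= e].
Proof.
move=> cf fC T0 e0; have e20 : 0 < e / 2 by rewrite divr_gt0.
have C0 : 0 <= C by exact: le_trans (normr_ge0 _) (fC 0).
have [h h0 hf] := continuous_uniform_on_box T cf e20.
(* On the box [a * mxcoord c x] lies in [[- 1 / 2, 1 / 2]], the range of [v] in [sin_separation]. *)
pose a := (2 * T)^-1; have a0 : 0 < a by rewrite invr_gt0 mulr_gt0.
have c10 := cos1_gt0 R.
pose dl := Num.min (a * h) (1 / 2).
have dl0 : 0 < dl by rewrite lt_min mulr_gt0//= divr_gt0.
(* The separation of sines, halved by [phase]. Then [B * gam ^+ 2 = 2 * C] pays for a distant node,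
   and [m] makes the total variance term at most [e / 2]. *)
pose gam := cos 1 * dl / 2; have gam0 : 0 < gam by rewrite divr_gt0// mulr_gt0.
pose B := 2 * C / gam ^+ 2.
have B0 : 0 <= B by rewrite divr_ge0 ?sqr_ge0 ?mulr_ge0.
pose m := (Num.truncn (B * #|CI|%:R / (e / 2))).+1.
have m0 : (0 < m)%N by [].
have m0' : (0 : R) < m%:R by rewrite ltr0n.
have mB : B * #|CI|%:R / m%:R <= e / 2.
  rewrite ler_pdivrMr// [leRHS]mulrC -ler_pdivrMr//.
  have n0 : 0 <= B * #|CI|%:R / (e / 2) by rewrite divr_ge0 ?(ltW e20)// mulr_ge0.
  by have /andP[_ /ltW] := truncn_itv n0.
(* The matrix whose phases are the grid values [k c / m]. *)
pose node (k : {ffun CI -> 'I_m.+1}) : Md :=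
  mkmx (fun c => asin (2 * ((k c)%:R / m%:R) - 1) / a).
pose W (x : Md) (k : {ffun CI -> 'I_m.+1}) : R := bern_weight (fun c => phase a c x) k.
exists (fun x => \sum_(k : {ffun CI -> 'I_m.+1}) f (node k) * W x k).
have W0 x k : 0 <= W x k by apply: bern_weight_ge0 => c; exact: phase01.
have W1 x : \sum_k W x k = 1 by exact: bern_weight_sum.
split=> [|x|x xT].
- apply: trig_sum => k; apply: trigZ; apply: trig_prod => c.
  by apply: trig_bern; exact: trig_phase.
- rewrite (le_trans (ler_norm_sum _ _ _))// -[leRHS]mulr1 -(W1 x) mulr_sumr.
  by apply: ler_sum => k _; rewrite normrM (ger0_norm (W0 x k)) ler_wpM2r.
(* Either the node is within [h] of [x] in every coordinate, and [f] varies by at most [e / 2], or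
   some phase is off by [gam] and the quadratic term exceeds the trivial bound [2 * C]. *)
have key (k : {ffun CI -> 'I_m.+1}) : `|f (node k) - f x| <=
    e / 2 + B * \sum_(c : CI) ((k c)%:R / m%:R - phase a c x) ^+ 2.
  have S0 : 0 <= \sum_(c : CI) ((k c)%:R / m%:R - phase a c x) ^+ 2.
    by apply: sumr_ge0 => c _; rewrite sqr_ge0.
  have [[c hc]|nc] := pselect (exists c, h < `|mxcoord c x - mxcoord c (node k)|).
    
    have km : (k c)%:R / m%:R <= 1 :> R.
      by rewrite ler_pdivrMr// mul1r ler_nat -ltnS.
    have km0 : 0 <= (k c)%:R / m%:R :> R by rewrite divr_ge0.
    pose w : R := 2 * ((k c)%:R / m%:R) - 1.
    have u1 : -1 <= w <= 1 by rewrite /w; apply/andP; split; lra.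
    pose u : R := asin w.
    have sinu : sin u = w by rewrite asinK ?in_itv/=.
    have upi : `|u| <= pi / 2 by rewrite ler_norml asin_geNpi2//= asin_lepi2.
    have v2 : `|a * mxcoord c x| <= 1 / 2.
      rewrite normrM (gtr0_norm a0) /a mulrC ler_pdivrMr ?mulr_gt0//.
      by rewrite (le_trans (xT c))//; lra.
    have uv : dl <= `|u - a * mxcoord c x|.
      apply: (@le_trans _ _ (a * h)); first by rewrite ge_min lexx.
      have -> : u - a * mxcoord c x = - (a * (mxcoord c x - mxcoord c (node k))).
        by rewrite mxcoord_mkmx -/u; field; rewrite gt_eqF.
      by rewrite normrN normrM (gtr0_norm a0) ler_wpM2l ?ltW.
    have dl2 : dl <= 1 / 2 by rewrite ge_min lexx orbT.
    have := sin_separation v2 upi dl0 dl2 uv; rewrite sinu => hsep.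
    have gk : gam <= `|(k c)%:R / m%:R - phase a c x|.
      have -> : (k c)%:R / m%:R - phase a c x =
          (w - sin (a * mxcoord c x)) / 2 by rewrite /phase /w; set r := _%:R / _; field.
      by rewrite normrM [`|2^-1|]ger0_norm// /gam ler_wpM2r.
    have gk2 : gam ^+ 2 <= ((k c)%:R / m%:R - phase a c x) ^+ 2.
      by rewrite -[leRHS]real_normK ?num_real// ler_pXn2r// nnegrE ltW.
    rewrite (le_trans (ler_normB _ _))//.
    apply: (@le_trans _ _ (B * gam ^+ 2)).
      rewrite /B divfK ?gt_eqF// ?exprn_gt0//.
      by have := fC (node k); have := fC x; lra.
    rewrite (@le_trans _ _ (B * \sum_(c : CI) ((k c)%:R / m%:R - phase a c x) ^+ 2))//.
      rewrite ler_wpM2l// (le_trans gk2)// (bigD1 c)//= lerDl sumr_ge0// => c' _.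
      exact: sqr_ge0.
    by rewrite lerDr ltW.
  rewrite distrC (@le_trans _ _ (e / 2))//.
    by apply: hf => // c; rewrite leNgt; apply/negP => ?; apply: nc; exists c.
  by rewrite lerDl mulr_ge0.
have -> : \sum_k f (node k) * W x k - f x = \sum_k (f (node k) - f x) * W x k.
  rewrite -[X in _ - X]mulr1 -(W1 x) mulr_sumr -sumrB.
  by apply: eq_bigr => k _; rewrite mulrBl.
rewrite (le_trans (ler_norm_sum _ _ _))//.
apply: (@le_trans _ _ (\sum_k (e / 2 * W x k +
    B * \sum_(c : CI) W x k * ((k c)%:R / m%:R - phase a c x) ^+ 2))).
  apply: ler_sum => k _; rewrite normrM (ger0_norm (W0 x k)).
  rewrite (le_trans (ler_wpM2r (W0 x k) (key k)))// mulrDl lerD2l -mulrA ler_wpM2l//.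
  by rewrite mulrC mulr_sumr.
rewrite big_split/= -!mulr_sumr W1 mulr1 exchange_big/=.
rewrite [leRHS]splitr lerD2l (le_trans _ mB)// -mulrA ler_wpM2l//.
apply: (@le_trans _ _ (\sum_(c : CI) m%:R^-1)).
  by apply: ler_sum => c _; apply: bern_weight_variance => // c'; exact: phase01.
by rewrite sumr_const -[leLHS]mulr_natl.
Qed.

End trigonometric_approximation.

(** * From Fourier transforms to weak convergence *)

Section levy_continuity.
Context (R : realType) (d : nat).
Local Notation Md := 'M[R[i]]_d.
Local Notation CI := (coord_index d d).
Implicit Types Phi : Md -> R[i].

(** Continuity along rays only: tightness is checked one coordinate at a time. *)
Definition continuous_at0 Phi := forall A (e : R), 0 < e -> exists2 h, 0 < h &
  forall t : R, `|t| <= h -> normc (Phi (t%:C *: A) - 1) <= e.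

Lemma tight_of_fourier (P_ : nat -> probability Md R) Phi : continuous_at0 Phi ->
  (forall A, ccvg \oo (fun n => cf (P_ n) (trform A)) (Phi A)) ->
  forall c (e : R), 0 < e -> exists2 r, 0 < r &
    \forall n \near \oo, \int[P_ n]_x \1_(tail (mxcoord c) r) x <= e.
Proof.
move=> Phi0 cv c.
apply: (@tight_of_cf _ _ _ P_ (mxcoord c) (fun t => Phi (t%:C *: coord_mx R c))).
- exact: measurable_mxcoord.
- move=> t; apply: ccvg_eq (cv _) => n.
  by apply: CE_ext => x; rewrite trformZl -mxcoordE.
- exact: Phi0.
Qed.

Lemma bm_trigonometric (q : Md -> R) : trigonometric q -> bounded_measurable q.
Proof.
elim=> [A s|f g _ bf _ bg|c f _ bf]; [|exact: bmD|exact: bmZ].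
split; last by exists 1 => x; exact: cos_max.
apply: measurableT_comp; first exact: continuous_measurable_fun (@continuous_cos R).
by apply: measurable_funD (measurable_cst _); exact: measurable_trform.
Qed.

Lemma E_cos (P : probability Md R) A s : \int[P]_x cos (trform A x + s) =
  cos s * Re (cf P (trform A)) - sin s * Im (cf P (trform A)).
Proof.
have [bR bI] := bmC_expi (@measurable_trform R d A).
have -> : cf P (trform A) = (\int[P]_x cos (trform A x)) +i* (\int[P]_x sin (trform A x)).
  by apply: eq_ReIm; apply: eq_Rintegral => x _; rewrite -/(expi _) expiE.
have bc : bounded_measurable (fun x => cos (trform A x)).
  by move: bR; under eq_fun do rewrite expiE.
have bs : bounded_measurable (fun x => sin (trform A x)).
  by move: bI; under eq_fun do rewrite expiE.
rewrite /= -!E_Z// -E_B; [|exact: bmZ..].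
by apply: eq_Rintegral => x _; rewrite cosD [cos s * _]mulrC [sin s * _]mulrC.
Qed.

Context (P_ : nat -> probability Md R) (L : probability Md R).
Hypothesis cvL : forall A, ccvg \oo (fun n => cf (P_ n) (trform A)) (cf L (trform A)).

Lemma trigonometric_cvg (q : Md -> R) : trigonometric q ->
  \int[P_ n]_x q x @[n --> \oo] --> \int[L]_x q x.
Proof.
elim=> [A s|f g tf cvf tg cvg|c f tf cvf].
- have [cR cI] := cvL A; rewrite E_cos; under eq_fun do rewrite E_cos.
  by apply: cvgB; apply: cvgM => //; exact: cvg_cst.
- have bf := bm_trigonometric tf; have bg := bm_trigonometric tg.
  by rewrite E_D//; under eq_fun do (rewrite E_D; [|exact: bf|exact: bg]); exact: cvgD.
- have bf := bm_trigonometric tf.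
  by rewrite E_Z//; under eq_fun do rewrite E_Z//; exact: cvgMr.
Qed.

Lemma box_approximation (P : probability Md R) (f q : Md -> R) (C T e : R) :
  bounded_measurable f -> bounded_measurable q ->
  (forall x, `|f x| <= C) -> (forall x, `|q x| <= C) -> 0 <= e ->
  (forall x, (forall c : CI, `|mxcoord c x| <= T) -> `|q x - f x| <= e) ->
  `|\int[P]_x q x - \int[P]_x f x| <=
    e + 2 * C * \sum_(c : CI) \int[P]_x \1_(tail (mxcoord c) T) x.
Proof.
move=> bf bq fC qC e0 qf.
have C0 : 0 <= C by exact: le_trans (normr_ge0 _) (fC 0).
have bt (c : CI) : bounded_measurable (\1_(tail (mxcoord c) T) : Md -> R).
  apply: bm_indic; apply: measurable_tail; exact: measurable_mxcoord.
have bs := bm_sum (index_enum CI) bt.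
rewrite -E_B// (le_trans (E_norm _ (bmB bq bf)))//.
rewrite -E_sum// -E_Z// -[X in X + _](E_cst P) -E_D//; [|exact: bm_cst|exact: bmZ].
apply: E_le => [||x].
- exact/bm_norm/bmB.
- by apply: bmD; [exact: bm_cst|exact: bmZ].
have s0 : 0 <= \sum_(c : CI) \1_(tail (mxcoord c) T) x :> R.
  by apply: sumr_ge0 => c _; rewrite indicE ler0n.
have [h|/existsNP[c /negP]] := pselect (forall c : CI, `|mxcoord c x| <= T).
  by rewrite (le_trans (qf x h))// lerDl !mulr_ge0.
rewrite -ltNge => Tc.
rewrite (le_trans (ler_normB _ _))// (@le_trans _ _ (2 * C))//.
  by have := fC x; have := qC x; lra.
have : 1 <= \sum_(c : CI) \1_(tail (mxcoord c) T) x :> R.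
  rewrite (bigD1 c)//= indicE mem_set/=; last exact: ltW.
  by rewrite lerDl sumr_ge0// => c' _; rewrite indicE ler0n.
by move=> s1; rewrite -[leLHS]add0r lerD// ler_peMr// mulr_ge0.
Qed.

Lemma levy_continuity : continuous_at0 (fun A => cf L (trform A)) -> weak_cvg P_ L.
Proof.
move=> L0 f cf [C fC].
have tightP := tight_of_fourier L0 cvL.
have cvLL A : ccvg \oo (fun _ : nat => Cintegral L (fun x => expi (trform A x)))
  (Cintegral L (fun x => expi (trform A x))) by exact: ccvg_cst.
(* Tightness of the single law [L], seen as a constant sequence. *)
have tightL := tight_of_fourier (P_ := fun=> L) L0 cvLL.
have C0 : 0 <= C by exact: le_trans (normr_ge0 _) (fC 0).
have bf : bounded_measurable f by split; [exact: continuous_mx_measurable|exists C].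
apply/cvgrPdist_le => e e0.
pose N : R := (#|CI|.+1)%:R; have N0 : 0 < N by rewrite ltr0n.
(* The [+ 1] allows [C = 0]; [a] is the tail mass granted to each coordinate. *)
pose D := 2 * C * N + 1.
have D0 : 0 < D by rewrite ltr_wpDl// !mulr_ge0// ltW.
pose a := e / 8 / D; have a0 : 0 < a by rewrite !divr_gt0.
have aD : 2 * C * (N * a) <= e / 8.
  have -> : e / 8 = D * a by rewrite /a [RHS]mulrC divfK ?gt_eqF.
  by rewrite mulrA ler_wpM2r ?(ltW a0)// lerDl.
pose rP c := s2val (cid2 (tightP c a a0)); pose rL c := s2val (cid2 (tightL c a a0)).
have rP0 c : 0 < rP c by exact: (s2valP (cid2 (tightP c a a0))).
have rL0 c : 0 < rL c by exact: (s2valP (cid2 (tightL c a a0))).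
pose T := 1 + \sum_(c : CI) (rP c + rL c).
have sT c : rP c + rL c <= T.
  rewrite /T (bigD1 c)//= addrCA lerDl addr_ge0// sumr_ge0// => c' _.
  by rewrite addr_ge0// ltW.
have T0 : 0 < T by rewrite ltr_wpDr// sumr_ge0// => c _; rewrite addr_ge0// ltW.
have tP : \forall n \near \oo, forall c, \int[P_ n]_x \1_(tail (mxcoord c) T) x <= a.
  apply: filter_forall => c.
  have := s2valP' (cid2 (tightP c a a0)); apply: filterS => n; apply: le_trans.
  apply: E_le => [||x]; try (apply: bm_indic; apply: measurable_tail; exact: measurable_mxcoord).
  by apply: tail_antitone; rewrite (le_trans _ (sT c))// lerDl ltW.
have tL c : \int[L]_x \1_(tail (mxcoord c) T) x <= a.
  have [n _ /(_ n (leqnn n))] := s2valP' (cid2 (tightL c a a0)); apply: le_trans.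
  apply: E_le => [||x]; try (apply: bm_indic; apply: measurable_tail; exact: measurable_mxcoord).
  by apply: tail_antitone; rewrite (le_trans _ (sT c))// lerDr ltW.
have e80 : 0 < e / 8 by rewrite divr_gt0.
have [q [tq qC qf]] := trig_approx cf fC T0 e80.
have bq := bm_trigonometric tq.
have bound (P : probability Md R) : (forall c, \int[P]_x \1_(tail (mxcoord c) T) x <= a) ->
    `|\int[P]_x q x - \int[P]_x f x| <= e / 4.
  move=> tPa; rewrite (le_trans (box_approximation P bf bq fC qC (ltW e80) qf))//.
  have sa : \sum_(c : CI) \int[P]_x \1_(tail (mxcoord c) T) x <= N * a.
    rewrite (@le_trans _ _ (\sum_(c : CI) a))//; first exact: ler_sum.
    by rewrite sumr_const -[leLHS]mulr_natl ler_wpM2r ?(ltW a0)// ler_nat.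
  by have := ler_wpM2l (mulr_ge0 (ler0n R 2) C0) sa; lra.
have /cvgrPdist_le/(_ (e / 4)) := trigonometric_cvg tq.
rewrite divr_gt0// => /(_ isT); apply: filterS2 tP => n /bound hP hq.
have hL := bound L tL.
have -> : \int[L]_x f x - \int[P_ n]_x f x =
  - (\int[L]_x q x - \int[L]_x f x) + (\int[L]_x q x - \int[P_ n]_x q x)
  + (\int[P_ n]_x q x - \int[P_ n]_x f x) by ring.
rewrite (le_trans (ler_normD _ _))// (le_trans (lerD (ler_normD _ _) (lexx _)))//.
by rewrite normrN; lra.
Qed.

End levy_continuity.

Lemma continuous_trform (R : realType) (d : nat) (A : 'M[R[i]]_d) :
  continuous (trform A).
Proof.
move=> M.
have trE N : \tr (A^t* *m N) = \sum_i \sum_j A^t* i j * N j i.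
  by apply: eq_bigr => i _; rewrite mxE.
have [+ _] : ccvg (nbhs M) (fun N => \tr (A^t* *m N)) (\tr (A^t* *m M)).
  rewrite trE; under eq_fun do rewrite trE.
  apply: ccvg_sum => i; apply: ccvg_sum => j; apply: ccvgM; first exact: ccvg_cst.
  by have [cR cI] := @continuous_mx_coord R d d j i; split; [exact: cR|exact: cI].
exact.
Qed.

(** * The limit law *)

Section limit_law.
Context (R : realType) (n : nat).
Local Notation d := n.+1.
Local Notation Md := 'M[R[i]]_d.
Context (H : probability Md R) (haarH : haar_unitary H).
Context (mu : probability R R) (rt : nat -> probability R R).
Hypothesis rtE : forall m A, measurable A -> real_conv_pow (rt m) m.+1 A = mu A.

Lemma weak_cvg_roots : weak_cvg (fun m => real_conv_pow (rt m) m.+1) mu.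
Proof.
move=> f cf [C fC]; apply: cvg_near_cst; apply: nearW => m.
by rewrite /Rintegral; congr fine; apply: eq_measure_integral => A mA _; exact: rtE.
Qed.

Lemma cvg_succn_oo : m.+1 @[m --> \oo] --> \oo.
Proof. exact: (cvg_addnl 1). Qed.

Lemma cexp_haar_exponent_at0 (psi : R -> R[i]) : ccontinuous psi -> psi 0 = 0 ->
  continuous_at0 (fun A => cexp (haar_exponent H psi A)).
Proof.
move=> cpsi psi0 A e e0.
have key : ccvg (nbhs (0 : R)) (fun t => cexp (haar_exponent H psi (t%:C *: A))) (cexp 0).
  apply: ccvg_cexp; apply/ccvgP => a a0.
  have [h h0 hh] := haar_exponent_small haarH cpsi psi0 A a0.
  apply/nbhs_ballP; exists h => // t th.
  suff : normc (haar_exponent H psi (t%:C *: A) - 0) <= a by [].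
  rewrite subr0; apply: hh; apply: ltW.
  by move: th; rewrite /ball/= sub0r normrN.
move: key; rewrite cexp0 => /ccvgP/(_ _ e0)/nbhs_ballP[h h0 hh].
exists (h / 2); first by rewrite divr_gt0.
move=> t th; apply: (hh t); rewrite /ball/= sub0r normrN.
by rewrite (le_lt_trans th)// ltr_pdivrMr// ltr_pMr// ltr1n.
Qed.

(** The array of convolution roots has powers equal to [mu], hence trivially convergent; it yields
    [L] before any other array is considered. Limits along [U] agree with those along [\oo], which
    identifies the Fourier transform. *)
Lemma limit_law_exists (psi : R -> R[i]) : ccontinuous psi -> psi 0 = 0 ->
  (forall t, chf mu t = cexp (psi t)) ->
  exists L : probability Md R, forall A, cf L (trform A) = cexp (haar_exponent H psi A).
Proof.
move=> cpsi psi0 psiE.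
pose P_ m := mx_conv_pow (K_law H (rt m)) m.+1.
have cvP A : ccvg \oo (fun m => cf (P_ m) (trform A)) (cexp (haar_exponent H psi A)).
  exact: fourier_conv_pow_cvg cvg_succn_oo weak_cvg_roots.
have tightP := tight_of_fourier (cexp_haar_exponent_at0 cpsi psi0) cvP.
have [U [UU ooU]] := ultraFilterLemma eventually_filter.
have tightU c (e : R) : 0 < e -> exists2 r, 0 < r &
    \forall m \near U, \int[P_ m]_x \1_(tail (mxcoord c) r) x <= e.
  by move=> /(tightP c)[r r0 hr]; exists r => //; exact: ooU.
have [L hL] := prokhorov UU tightU; exists L => A.
have cvU : ccvg U (fun m => cf (P_ m) (trform A)) (cexp (haar_exponent H psi A)).
  by have [cR cI] := cvP A; split; [apply: cvg_trans cR|apply: cvg_trans cI]; exact: cvg_app.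
apply: ccvg_unique cvU.
have cRe : continuous (fun M : Md => Re (expi (trform A M))).
  under eq_fun do rewrite expiE/=.
  move=> M; apply: continuous_comp; [exact: continuous_trform|exact: continuous_cos].
have cIm : continuous (fun M : Md => Im (expi (trform A M))).
  under eq_fun do rewrite expiE/=.
  move=> M; apply: continuous_comp; [exact: continuous_trform|exact: continuous_sin].
split; apply: hL => //; exists 1 => M; rewrite -(normc_expi (trform A M)).
  exact: normc_Re.
exact: normc_Im.
Qed.

End limit_law.

(** Both sides are limits of the same Fourier transforms, which bypasses the uniqueness of
    continuous logarithms. *)
Lemma limit_law_unique_exponent (R : realType) (n : nat) (H : probability 'M[R[i]]_n.+1 R)
    (mu : probability R R) (rt : nat -> probability R R) (psi psi' : R -> R[i]) A :
  haar_unitary H ->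
  (forall m A, measurable A -> real_conv_pow (rt m) m.+1 A = mu A) ->
  ccontinuous psi -> psi 0 = 0 -> (forall t, chf mu t = cexp (psi t)) ->
  ccontinuous psi' -> psi' 0 = 0 -> (forall t, chf mu t = cexp (psi' t)) ->
  cexp (haar_exponent H psi A) = cexp (haar_exponent H psi' A).
Proof.
move=> haarH rtE c1 z1 E1 c2 z2 E2.
have wr := weak_cvg_roots rtE.
apply: ccvg_unique (fourier_conv_pow_cvg haarH c1 z1 E1 A cvg_succn_oo wr)
  (fourier_conv_pow_cvg haarH c2 z2 E2 A cvg_succn_oo wr).
Qed.

Theorem theorem7p1 (R : realType) (mu : probability R R)
    (mu_id : infinitely_divisible mu)
    (d : nat) (d_gt0 : (0 < d)%N)
    (H : probability 'M[R[i]]_d R) (haarH : haar_unitary H) :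
  exists L : probability 'M[R[i]]_d R,
    (forall (mu_ : nat -> probability R R) (k : nat -> nat),
       k n @[n --> \oo] --> \oo ->
       weak_cvg (fun n => real_conv_pow (mu_ n) (k n)) mu ->
       weak_cvg (fun n => mx_conv_pow (K_law H (mu_ n)) (k n)) L) /\
    (forall (psi : R -> R[i]) (sigma : probability 'cV[R[i]]_d R),
       levy_exponent mu psi -> uniform_sphere sigma ->
       forall A : 'M[R[i]]_d,
         fourier_mx L A =
         cexp (Cintegral (sigma \x sigma)%E
                 (fun uv => d%:R * psi (complex.Re (hdot uv.1 (A *m uv.2)))))).
Proof.
(* A successor dimension, so that the first column exists. *)
case: d d_gt0 H haarH => // n _ H haarH.
have [rt rtE] := choice (fun m => mu_id m.+1 isT).
(* This exponent serves to construct [L]; the formula concerns an arbitrary exponent [psi']. *)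
have [psi [cpsi psi0 psiE]] := levy_exponent_exists rtE.
have [L LE] := limit_law_exists haarH rtE cpsi psi0 psiE.
exists L; split=> [mu_ k koo mucv|psi' sigma [cpsi' psi'0 psi'E] sphere A].
  apply: levy_continuity => [A|].
    by rewrite LE; exact: fourier_conv_pow_cvg.
  by under eq_fun do rewrite LE; exact: cexp_haar_exponent_at0.
have ccpsi' := continuous_ccontinuous cpsi'.
rewrite -(haar_exponent_sphere haarH A ccpsi' sphere) -[LHS]/(cf L (trform A)) LE.
exact: limit_law_unique_exponent haarH rtE cpsi psi0 psiE ccpsi' psi'0 psi'E.
Qed.
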